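(* For any $c\in(1,\infty)$, $\delta\in(0,1)$, $\beta\in(0,1)$ and $\lambda\in(0,2)$ there exists a constant $C'_{c,\delta,\beta,\lambda}>0$, depending only on $c,\delta,\beta,\lambda$ (and in particular independent of $N$, $\alpha$ and the weights), such that the following holds. Let $\alpha>1/2$ satisfy $1/\alpha<\lambda$, let $d\in\mathbb{N}$, let $\boldsymbol{\gamma}=(\gamma_u)_{u\subset\mathbb{N},|u|<\infty}$ be a collection of non-negative weights with $\gamma_\emptyset=1$, let $M\ge1$, and let $\mathcal{A}_d=\mathcal{A}_{d,\alpha,\boldsymbol{\gamma}}(M)=\{\boldsymbol{k}\in\mathbb{Z}^d \mid r_{\alpha,\boldsymbol{\gamma}}(\boldsymbol{k})\le M\}$. Assume $|\mathcal{A}_d|\ge 2$ and $\eta:=c(|\mathcal{A}_d|-1)\ge \max(N_{\mathcal{A}_d},\,4L_{\max}\log L_{\max})$. Consider the randomized (randomly shifted) multiple rank-1 lattice-based algorithm $A_{N,\boldsymbol{\Delta}}^{\mathrm{mult}}$ in which the number of lattices $L$ and the lattice parameters $(n_t,\boldsymbol{g}_t)$, $t=1,\ldots,L$, are the output of the random construction (Algorithm LC, described in the context) with input $\mathcal{A}_d,c,\delta$, and $N=\sum_{t=1}^L n_t$. Then, with probability at least $1-\delta$ (with respect to the random construction of the lattices), $$\mathrm{err}_2^{\mathrm{rand}}(A_{N,\boldsymbol{\Delta}}^{\mathrm{mult}},H_{d,\alpha,\boldsymbol{\gamma}})\le\frac{C'_{c,\delta,\beta,\lambda}}{N^{(1-\lambda\beta)/(\lambda(1+\beta))}}\left(\sum_{u\subseteq\{1,\ldots,d\}}\gamma_u^\lambda(2\zeta(\alpha\lambda))^{|u|}\right)^{1/\lambda},$$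 where $\zeta$ is the Riemann zeta function. In particular, as $\lambda\to1/\alpha$ and $\beta\to0$, the exponent $(1-\lambda\beta)/(\lambda(1+\beta))$ tends to $\alpha$, i.e. the convergence rate gets arbitrarily close to $\mathcal{O}(N^{-\alpha})$.
   Context: **Weighted Korobov space.** For $\boldsymbol{k}\in\mathbb{Z}^d$ let $u=\mathrm{supp}(\boldsymbol{k})=\{j\in\{1,\ldots,d\}\mid k_j\ne0\}$ and $r_{\alpha,\boldsymbol{\gamma}}(\boldsymbol{k})=\frac{1}{\gamma_u}\prod_{j\in u}|k_j|^\alpha$ (empty product $=1$; if $\gamma_u=0$, then $r_{\alpha,\boldsymbol{\gamma}}(\boldsymbol{k})=+\infty$ and $\widehat f(\boldsymbol{k})=0$ is required). $H_{d,\alpha,\boldsymbol{\gamma}}$ is the space of continuous functions $f$ on $[0,1]^d$, 1-periodic in each variable, with finite norm $\|f\|_{d,\alpha,\boldsymbol{\gamma}}=\big(\sum_{\boldsymbol{k}\in\mathbb{Z}^d}r_{\alpha,\boldsymbol{\gamma}}^2(\boldsymbol{k})|\widehat f(\boldsymbol{k})|^2\big)^{1/2}$, where $\widehat f(\boldsymbol{k})=\int_{[0,1]^d}f(\boldsymbol{x})e^{-2\pi i\boldsymbol{k}\cdot\boldsymbol{x}}\,\mathrm{d}\boldsymbol{x}$ (terms with $\gamma_u=0$ are omitted). **Rank-1 lattices.** For $n\in\mathbb{N}$ and an integer vector $\boldsymbol{g}=(g_1,\ldots,g_d)$, $P_{n,\boldsymbol{g}}=\{(\{ig_1/n\},\ldots,\{ig_d/n\})\mid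 0\le i<n\}$, where $\{\cdot\}$ is the fractional part (applied componentwise to vectors). **Aliasing-free frequencies.** A frequency $\boldsymbol{k}\in\mathcal{A}_d$ is aliasing-free for $(n,\boldsymbol{g})$ if no $\boldsymbol{m}\in\mathcal{A}_d\setminus\{\boldsymbol{k}\}$ satisfies $\boldsymbol{m}\cdot\boldsymbol{g}\equiv\boldsymbol{k}\cdot\boldsymbol{g}\pmod n$. For lattices $(n_t,\boldsymbol{g}_t)$, $t=1,\ldots,L$, put $U_t(\boldsymbol{k})=1$ if $\boldsymbol{k}$ is aliasing-free for $(n_t,\boldsymbol{g}_t)$ and $U_t(\boldsymbol{k})=0$ otherwise, and $\xi(\boldsymbol{k})=\sum_{t=1}^LU_t(\boldsymbol{k})$. **Algorithm LC.** Input: $\mathcal{A}_d$, $c\in(1,\infty)$, $\delta\in(0,1)$. Set $L_{\max}=\left\lceil\left(\frac{c}{c-1}\right)^2\frac{\log|\mathcal{A}_d|-\log\delta}{2}\right\rceil$ and $\eta=c(|\mathcal{A}_d|-1)$. Let $\mathcal{P}_{\mathcal{A}_d}$ be the set of primes $n$ such that the vectors $\boldsymbol{k}\bmod n$ (componentwise), $\boldsymbol{k}\in\mathcal{A}_d$, are pairwise distinct, and let $p_1<\cdots<p_{L_{\max}}$ be the $L_{\max}$ smallest elements of $\mathcal{P}_{\mathcal{A}_d}$ greater than $\eta$. Start with $t=0$, $\mathcal{B}_d=\varnothing$. While $|\mathcal{B}_d|<|\mathcal{A}_d|$ and $t<L_{\max}$: replace $t$ by $t+1$; set $n_t=p_t$;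 draw $\boldsymbol{g}_t$ uniformly at random from $\{1,\ldots,n_t\}^d$ (independently of all previous draws); let $\mathcal{A}_{d,t}$ be the set of $\boldsymbol{k}\in\mathcal{A}_d$ aliasing-free for $(n_t,\boldsymbol{g}_t)$; if $\mathcal{A}_{d,t}\not\subseteq\mathcal{B}_d$, replace $\mathcal{B}_d$ by $\mathcal{B}_d\cup\mathcal{A}_{d,t}$, otherwise replace $t$ by $t-1$ (discarding the draw). Output: $(n_1,\boldsymbol{g}_1),\ldots,(n_L,\boldsymbol{g}_L)$ with $L=t$. The total number of points is $N=\sum_{t=1}^Ln_t$. Also $N_{\mathcal{A}_d}=\max_{1\le j\le d}\big(\max_{\boldsymbol{k}\in\mathcal{A}_d}k_j-\min_{\boldsymbol{h}\in\mathcal{A}_d}h_j\big)$. **Approximation algorithm.** Write $P_{n_t,\boldsymbol{g}_t}=\{\boldsymbol{y}^{(t)}_0,\ldots,\boldsymbol{y}^{(t)}_{n_t-1}\}$ and, for a shift $\boldsymbol{\Delta}\in[0,1]^d$, $\boldsymbol{y}^{(t)}_{i,\boldsymbol{\Delta}}=\{\boldsymbol{y}^{(t)}_i+\boldsymbol{\Delta}\}$. Then $A_{N,\boldsymbol{\Delta}}^{\mathrm{mult}}(f)(\boldsymbol{x})=\sum_{\boldsymbol{k}\in\mathcal{A}_d}\widehat f_{N,\boldsymbol{\Delta}}^{\mathrm{mult}}(\boldsymbol{k})e^{2\pi i\boldsymbol{k}\cdot\boldsymbol{x}}$ with $\widehat f_{N,\boldsymbol{\Delta}}^{\mathrm{mult}}(\boldsymbol{k})=\frac1{\xi(\boldsymbol{k})}\sum_{t=1}^L\frac{U_t(\boldsymbol{k})}{n_t}\sum_{i=0}^{n_t-1}f(\boldsymbol{y}_{i,\boldsymbol{\Delta}}^{(t)})e^{-2\pi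 i\boldsymbol{k}\cdot\boldsymbol{y}_{i,\boldsymbol{\Delta}}^{(t)}}$, and $\boldsymbol{\Delta}$ is uniformly distributed on $[0,1]^d$. It is well defined when $\xi(\boldsymbol{k})\ge1$ for all $\boldsymbol{k}\in\mathcal{A}_d$; ''with probability at least $1-\delta$'' means that the event that the algorithm is well defined and the stated bound holds has probability at least $1-\delta$. **Error.** $\mathrm{err}_2^{\mathrm{rand}}(A_{N,\boldsymbol{\Delta}}^{\mathrm{mult}},H_{d,\alpha,\boldsymbol{\gamma}})=\sup_{\|f\|_{d,\alpha,\boldsymbol{\gamma}}\le1}\left(\int_{[0,1]^d}\|f-A_{N,\boldsymbol{\Delta}}^{\mathrm{mult}}(f)\|_{L_2([0,1]^d)}^2\,\mathrm{d}\boldsymbol{\Delta}\right)^{1/2}$ (for fixed lattices). *)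

(* Defs.v *)
From HB Require Import structures.
From mathcomp Require Import all_boot all_order all_algebra finmap.
From mathcomp Require Import complex.
From mathcomp Require Import all_classical all_reals all_analysis.

Set Implicit Arguments.
Unset Strict Implicit.
Unset Printing Implicit Defensive.

Import Order.TTheory GRing.Theory Num.Theory.
Import numFieldNormedType.Exports.

Local Open Scope classical_set_scope.
Local Open Scope ring_scope.

(* Vectors of R^d and Z^d are row vectors. The coordinates are numbered from 0,
   so that the coordinate set {1, ..., d} is 'I_d and a finite set of
   coordinates is a {fset nat}. *)

Section Cube.
Variable R : realType.

(* The real line with the sigma-algebra that carries [lebesgue_measure]. *)
Local Notation RB := (measurableTypeR R).

Definition cube_glue (d : nat) (p : (RB * d.-tuple RB)%type) : d.+1.-tuple RB :=
  [the d.+1.-tuple RB of p.1 :: p.2].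

Lemma measurable_cube_glue (d : nat) :
  measurable_fun [set: (RB * d.-tuple RB)%type] (@cube_glue d).
Proof. by apply: measurable_cons; [exact: measurable_fst|exact: measurable_snd]. Qed.

HB.instance Definition _ (d : nat) :=
  isMeasurableFun.Build _ _ _ _ (@cube_glue d) (@measurable_cube_glue d).

(* Lebesgue measure on [0,1]^d, as the d-fold product of the uniform
   probability on [0,1]. *)
Fixpoint cube (d : nat) : probability (d.-tuple RB) R :=
  match d with
  | 0 => dirac [tuple]
  | d'.+1 =>
      distribution (uniform_prob (@ltr01 R) \x cube d')%E (@cube_glue d')
  end.

Definition row_of_tuple (d : nat) (x : d.-tuple RB) : 'rV[R]_d :=
  \row_j tnth x j.

Definition cube_integral (d : nat) (F : 'rV[R]_d -> \bar R) : \bar R :=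
  (\int[cube d]_x F (row_of_tuple x))%E.

Definition cube_Cintegral (d : nat) (F : 'rV[R]_d -> R[i]) : R[i] :=
  Complex (\int[cube d]_x complex.Re (F (row_of_tuple x)))
          (\int[cube d]_x complex.Im (F (row_of_tuple x))).

End Cube.

Section Korobov.
Variables (R : realType) (d : nat).
Implicit Types (k : 'rV[int]_d) (x : 'rV[R]_d) (f : 'rV[R]_d -> R[i]).

Definition cexp_char k x : R[i] :=
  let theta := 2 * pi * \sum_j (k ord0 j)%:~R * x ord0 j in
  Complex (cos theta) (sin theta).

Definition fourier f k : R[i] :=
  cube_Cintegral (fun x => f x * cexp_char (- k) x).

Definition supp k : {set 'I_d} := [set j | k ord0 j != 0]%SET.

Definition coords (u : {set 'I_d}) : {fset nat} := [fset val j | j in u]%fset.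

Variables (alpha : R) (gamma : {fset nat} -> R).

Definition korobov_r k : \bar R :=
  if gamma (coords (supp k)) == 0 then +oo%E
  else ((gamma (coords (supp k)))^-1 *
        \prod_(j in supp k) `|k ord0 j|%:~R `^ alpha)%:E.

Definition korobov_norm f : \bar R :=
  ((\esum_(k in [set k | gamma (coords (supp k)) != 0%R])
      (korobov_r k ^+ 2 * (Normc.normc (fourier f k) ^+ 2)%:E)) `^ 2^-1%R)%E.

(* Functions on [0,1]^d that are 1-periodic in each variable are identified
   with periodic functions on R^d. *)
Definition korobov_space : set ('rV[R]_d -> R[i]) :=
  [set f | [/\ continuous (f : 'rV[R]_d -> R[i]^o),
               forall x j, f (x + delta_mx ord0 j) = f x,
               forall k, gamma (coords (supp k)) = 0 -> fourier f k = 0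
             & (korobov_norm f < +oo)%E]].

(* This set is finite when 0 < alpha, so [fset_set] does not degenerate. *)
Definition korobov_index (M : R) : {fset 'rV[int]_d} :=
  fset_set [set k | (korobov_r k <= M%:E)%E].

End Korobov.

Section Lattice.
Variables (R : realType) (d : nat).

(* A pair (n, g): number of points and generating vector. *)
Definition lattice : Type := (nat * 'rV[int]_d)%type.

Implicit Types (A : {fset 'rV[int]_d}) (l : lattice) (ls : seq lattice).

Definition dotz (k g : 'rV[int]_d) : int := \sum_j k ord0 j * g ord0 j.

Definition aliasing_free A l (k : 'rV[int]_d) : bool :=
  all (fun m => dotz m l.2 != dotz k l.2 %[mod l.1%:Z])%Z (A `\ k)%fset.

(* xi(k); U_t(k) is the Boolean [aliasing_free A l k] read as 0 or 1. *)
Definition xi A ls (k : 'rV[int]_d) : nat :=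
  \sum_(l <- ls) (aliasing_free A l k : nat).

Definition total_points ls : nat := \sum_(l <- ls) l.1.

Definition frac_part (x : R) : R := x - (Num.floor x)%:~R.

Definition lattice_point l (i : nat) : 'rV[R]_d :=
  \row_j frac_part ((i%:Z * l.2 ord0 j)%:~R / l.1%:R).

Definition shifted_point l (Delta : 'rV[R]_d) (i : nat) : 'rV[R]_d :=
  map_mx frac_part (lattice_point l i + Delta).

Definition fourier_mult A ls (Delta : 'rV[R]_d) (f : 'rV[R]_d -> R[i])
    (k : 'rV[int]_d) : R[i] :=
  (xi A ls k)%:R^-1 *
  \sum_(l <- ls) (aliasing_free A l k)%:R / l.1%:R *
    \sum_(i < l.1) f (shifted_point l Delta i) *
                   cexp_char (- k) (shifted_point l Delta i).

Definition approx_mult A ls (Delta : 'rV[R]_d) (f : 'rV[R]_d -> R[i])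
    (x : 'rV[R]_d) : R[i] :=
  \sum_(k <- A) fourier_mult A ls Delta f k * cexp_char k x.

Definition well_defined A ls : Prop := forall k, k \in A -> (1 <= xi A ls k)%N.

Definition err2_rand (alpha : R) (gamma : {fset nat} -> R) A ls : \bar R :=
  ereal_sup
    [set (cube_integral (fun Delta => cube_integral (fun x =>
            (Normc.normc (f x - approx_mult A ls Delta f x) ^+ 2)%:E))
          `^ 2^-1%R)%E
    | f in [set f | korobov_space alpha gamma f /\
                    (korobov_norm alpha gamma f <= 1)%E]].

End Lattice.

Section AlgorithmLC.
Variables (R : realType) (d : nat) (A : {fset 'rV[int]_d}) (c delta : R).

Definition Lmax : nat :=
  `|Num.ceil ((c / (c - 1)) ^+ 2 *
              ((ln (#|` A|%:R) - ln delta) / 2))|%N.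

Definition lc_eta : R := c * (#|` A|%:R - 1).

(* N_A: the initial value of the inner maximum and minimum is an element of A
   (if A is nonempty), hence does not affect them. *)
Definition freq_spread : int :=
  let k0 := head 0 (enum_fset A) in
  \big[Num.max/0]_(j < d)
    (\big[Num.max/k0 ord0 j]_(k <- A) k ord0 j -
     \big[Num.min/k0 ord0 j]_(h <- A) h ord0 j).

Definition separating_prime (n : nat) : bool :=
  prime n && uniq [seq map_mx (fun z => (z %% n%:Z)%Z) k | k <- enum_fset A].

Definition lc_candidate (n : nat) : bool :=
  separating_prime n && (lc_eta < n%:R).

(* The candidate with exactly t smaller candidates: this is p_(t+1). It exists,
   since every prime that is large enough is a candidate. *)
Definition lc_prime (t : nat) : nat :=
  xget 0%N [set n | lc_candidate n /\ count lc_candidate (iota 0 n) = t].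

(* The lattices accepted so far and the set B of covered frequencies. *)
Definition lc_state : Type := (seq (lattice d) * {fset 'rV[int]_d})%type.

Definition lc_running (s : lc_state) : bool :=
  (#|` s.2| < #|` A|)%N && (size s.1 < Lmax)%N.

Definition lc_next_n (s : lc_state) : nat := lc_prime (size s.1).

Definition lc_step (s : lc_state) (g : 'rV[int]_d) : lc_state :=
  let l := (lc_next_n s, g) in
  let At := [fset k in A | aliasing_free A l k]%fset in
  if (At `<=` s.2)%fset then s else (rcons s.1 l, (s.2 `|` At)%fset).

(* State after the first m draws; [g i] is the vector drawn at the i-th draw,
   rejected draws included. *)
Fixpoint lc_run (g : nat -> 'rV[int]_d) (m : nat) : lc_state :=
  match m with
  | 0 => ([::], fset0)
  | m'.+1 => let s := lc_run g m' in
             if lc_running s then lc_step s (g m') else s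
  end.

Definition lc_output (g : nat -> 'rV[int]_d) (ls : seq (lattice d)) : Prop :=
  exists m, ~~ lc_running (lc_run g m) /\ (lc_run g m).1 = ls.

Definition in_box (n : nat) (v : 'rV[int]_d) : Prop :=
  forall j, 1 <= v ord0 j <= n%:Z.

(* As long as the loop is running, the next draw is, conditionally on the
   previous draws, uniform on {1, ..., n}^d, with n the current prime. Nothing
   is required of the (unused) draws after termination. *)
Definition lc_draws (disp : measure_display) (Omega : measurableType disp)
    (P : probability Omega R) (G : nat -> Omega -> 'rV[int]_d) : Prop :=
  (forall m v, measurable [set w | G m w = v]) /\
  forall (m : nat) (h : nat -> 'rV[int]_d) (v : 'rV[int]_d),
    let past := [set w | forall i, (i < m)%N -> G i w = h i] in
    let n := lc_next_n (lc_run h m) in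
    lc_running (lc_run h m) -> in_box n v ->
    P (past `&` [set w | G m w = v]) = (P past * ((n%:R ^+ d)^-1)%:E)%E.

End AlgorithmLC.

Definition zeta (R : realType) (s : R) : R :=
  limn (series (fun n : nat => n.+1%:R `^ (- s))).

Definition weight_sum (R : realType) (d : nat) (gamma : {fset nat} -> R)
    (alpha lambda : R) : R :=
  \sum_(u : {set 'I_d})
    gamma (coords u) `^ lambda * (2 * zeta (alpha * lambda)) ^+ #|u|.

Definition rate (R : realType) (lambda beta : R) : R :=
  (1 - lambda * beta) / (lambda * (1 + beta)).

(* Main.v *)
Require Import Defs.
From HB Require Import structures.
From mathcomp Require Import all_boot all_order all_algebra finmap.
From mathcomp Require Import complex ring lra zify.
From mathcomp Require Import all_classical all_reals all_analysis.
From mathcomp Require Import measurable_realfun.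

Import Order.TTheory GRing.Theory Num.Theory.
Import numFieldNormedType.Exports.

Local Open Scope classical_set_scope.
Local Open Scope ring_scope.
Set Implicit Arguments.
Unset Strict Implicit.
Unset Printing Implicit Defensive.

(* Let a = |A|.
   (1) Error. For a trigonometric polynomial f the error can be computed by
   Parseval's identity, first in x and then in the shift: a frequency h outside
   A is aliased, on each of the L lattices, to at most one aliasing-free k in A,
   and an aliasing-free k receives nothing from A. Hence the squared error is at
   most (1 + L) times the l2-mass of the coefficients outside A, where r > M,
   that is (1 + L) / M^2 on the unit ball. A general f is the uniform limit of
   its Fejer sums, whose coefficients are dominated by those of f, and Fatou's
   lemma transfers the bound.
   (2) Cardinality. Summing (M / r(k))^lambda >= 1 over A gives a <= M^lambda W,
   with W the weight sum of the statement.
   (3) Success. In one draw, accepted or rejected, a fixed k is aliased with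
   probability at most 1/c, so that the sum over the uncovered k of
   c^-(Lmax - t) is a supermartingale. At the end it is at least 1 if some k is
   uncovered, and at the start it is a c^-Lmax <= delta, since
   ln c >= 2 (1 - 1/c)^2. A second potential b^(Lmax - t), whose expectation
   shrinks geometrically as long as the loop runs, shows that it terminates
   almost surely.
   (4) Size. All primes above max(eta, N_A) are candidates, and the central
   binomial coefficient yields enough of them, so that 1 + L <= C a^(beta/2) and
   n_t <= C a^(1 + beta/2), whence N <= C^2 a^(1 + beta). *)

(** * Lower bound on the number of primes *)

(** The algorithm samples f at points, so f has to be approximated pointwise. Fejer sums do this for
    every continuous periodic f, without knowing that its Fourier series converges or determines f.
    For a fixed x and a fixed shift the error involves finitely many values of f, so it passes to
    the limit. The obstacle in the random construction is that rejected draws do not count towards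
    Lmax: a draw of (n, ..., n) aliases everything and is rejected, so no fixed number of draws is
    certain to end the loop. Moreover only the law of a draw given the past is known. The failure
    probability after m draws is therefore bounded by summing over finite histories, and m is left
    free until the end. Every logarithm, in Lmax and in the density of primes, is traded for a small
    power of a. This is why Chebyshev's elementary bound suffices and why the constants depend on
    beta. The factor sqrt(1 + L) then costs only a^(beta/4), well within the loss a^beta that the
    rate allows. *)

Section PrimeCount.
Local Open Scope nat_scope.

(** By Legendre's formula the valuation is the sum over k of floor(2n/p^k) - 2 floor(n/p^k); each
    term is 0 or 1 and vanishes once p^k > 2n. Hence the [p]-part of the binomial coefficient is at
    most 2n. *)
Lemma logn_bin_le (p n : nat) : prime p -> 0 < n ->
  logn p 'C(n.*2, n) <= trunc_log p n.*2.
Proof.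
move=> pp n0.
have e : logn p (n.*2)`! = logn p 'C(n.*2, n) + (logn p n`!).*2.
  have := bin_fact (leq_addr n n); rewrite addnK addnn => <-.
  by rewrite !lognM ?muln_gt0 ?fact_gt0 ?bin_gt0 -?addnn ?leq_addr.
(* Legendre's formula with one cut-off for all m <= 2n, so that the two sums can be compared term by
   term. *)
have E m : m <= n.*2 -> logn p m`! = \sum_(1 <= k < (trunc_log p n.*2).+1) m %/ p ^ k.
  move=> mn; rewrite logn_fact//.
  have tail a b : 0 < a -> a <= b -> (forall k, a <= k -> m %/ p ^ k = 0) ->
      \sum_(1 <= k < a) m %/ p ^ k = \sum_(1 <= k < b) m %/ p ^ k.
    move=> a0 ab h; rewrite [in RHS](big_cat_nat (n := a))//=.
    rewrite [X in _ = _ + X](_ : _ = 0) ?addn0// big_nat.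
    by apply: big1 => i /andP[/h].
  have [t|t] := leqP m (trunc_log p n.*2).
    apply: tail => // i mi; rewrite divn_small//.
    by rewrite (leq_trans mi)// ltnW// ltn_expl// prime_gt1.
  apply/esym/tail => // [|i mi]; first by rewrite ltnW// ltnS.
  rewrite divn_small// (leq_ltn_trans mn)// (leq_trans (trunc_log_ltn _ (prime_gt1 pp)))//.
  by rewrite leq_exp2l// prime_gt1.
have := e; rewrite !E//; last by rewrite -addnn leq_addr.
set T := trunc_log p n.*2 => h.
have : \sum_(1 <= k < T.+1) n.*2 %/ p ^ k <= T + (\sum_(1 <= k < T.+1) n %/ p ^ k).*2.
  have -> : (\sum_(1 <= k < T.+1) n %/ p ^ k).*2 = \sum_(1 <= k < T.+1) (n %/ p ^ k).*2.
    by rewrite -[LHS]muln2 big_distrl /=; apply: eq_bigr => k _; rewrite muln2.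
  have TE : T = \sum_(1 <= k < T.+1) 1 by rewrite sum_nat_const_nat muln1 subn1.
  rewrite [X in X + _]TE.
  rewrite -big_split /=; apply: leq_sum => k _.
  have q0 : 0 < p ^ k by rewrite expn_gt0 prime_gt0.
  rewrite -ltnS ltn_divLR//.
  have := ltn_ceil n q0; move: (n %/ p ^ k) (p ^ k) => a b; nia.
by rewrite h leq_add2r.
Qed.

Lemma prime_dvd_fact (p m : nat) : prime p -> p %| m`! -> p <= m.
Proof.
move=> pp; elim: m => [|m ih]; first by rewrite dvdn1 => /eqP p1; rewrite p1 in pp.
by rewrite factS Euclid_dvdM// => /orP[/dvdn_leq->//|/ih/leqW].
Qed.

(** Pascal's rule and symmetry give C(2n+2, n+1) = 2 C(2n+1, n+1) >= 2 C(2n, n). *)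
Lemma bin2n_ge (n : nat) : 2 ^ n <= 'C(n.*2, n).
Proof.
elim: n => [//|n ih].
have h : 'C(n.*2.+1, n) = 'C(n.*2.+1, n.+1).
  by rewrite -bin_sub; [congr 'C(_, _)|]; rewrite -addnn; lia.
have g : 'C(n.*2, n) <= 'C(n.*2.+1, n.+1) by rewrite binS leq_addl.
rewrite expnS doubleS binS h addnn -mul2n leq_pmul2l//.
exact: leq_trans ih g.
Qed.

(** Chebyshev's argument: every prime in the factorization is at most 2n, and so is every prime
    power. *)
Lemma bin_le_pi (n : nat) : 0 < n ->
  'C(n.*2, n) <= n.*2 ^ count prime (iota 0 n.*2.+1).
Proof.
move=> n0.
have b0 : 0 < 'C(n.*2, n) by rewrite bin_gt0 -addnn leq_addr.
rewrite [X in X <= _](prod_prime_decomp b0) prime_decompE big_map /=.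
apply: (@leq_trans (\prod_(p <- primes 'C(n.*2, n)) n.*2)).
  rewrite big_seq [X in _ <= X]big_seq; apply: leq_prod => p.
  rewrite mem_primes => /and3P[pp _ _].
  rewrite (leq_trans (leq_pexp2l (prime_gt0 pp) (logn_bin_le pp n0)))//.
  by rewrite trunc_logP ?prime_gt1// double_gt0.
rewrite big_const_seq count_predT iter_muln_1 leq_pexp2l ?double_gt0//.
rewrite -size_filter; apply: uniq_leq_size; first exact: primes_uniq.
move=> p; rewrite mem_primes mem_filter mem_iota => /and3P[pp _ pd].
rewrite pp prime_gt0//= add1n ltnS.
have : p %| n.*2`!.
  have := bin_fact (leq_addr n n); rewrite addnn => <-.
  exact: dvdn_mulr.
exact: prime_dvd_fact.
Qed.
End PrimeCount.

(** * Integrals of characters over the cube *)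

Section BoundedMeasurable.
Context {d : measure_display} {T : measurableType d} {R : realType}.
Implicit Types (f g : T -> R).

(** A class stable under sums and products and integrable for every probability, which settles all
    integrability side conditions at once. *)
Definition bmeas f := measurable_fun setT f /\ exists B : R, forall x, `|f x| <= B.

Lemma eq_bmeas f g : f =1 g -> bmeas f -> bmeas g.
Proof. by move=> /funext ->. Qed.

Lemma bmeas_cst c : bmeas (fun=> c).
Proof. by split => //; exists `|c|. Qed.

Lemma bmeasD f g : bmeas f -> bmeas g -> bmeas (fun x => f x + g x).
Proof.
move=> [mf [B hB]] [mg [C hC]]; split; first exact: measurable_funD.
by exists (B + C) => x; rewrite (le_trans (ler_normD _ _))// lerD.
Qed.

Lemma bmeasM f g : bmeas f -> bmeas g -> bmeas (fun x => f x * g x).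
Proof.
move=> [mf [B hB]] [mg [C hC]]; split; first exact: measurable_funM.
by exists (B * C) => x; rewrite normrM ler_pM.
Qed.

Lemma bmeasN f : bmeas f -> bmeas (fun x => - f x).
Proof.
move=> [mf [B hB]]; split; first exact: measurableT_comp.
by exists B => x; rewrite normrN.
Qed.

Lemma bmeas_sum (I : Type) (s : seq I) (F : I -> T -> R) :
  (forall i, bmeas (F i)) -> bmeas (fun x => \sum_(i <- s) F i x).
Proof.
move=> h; elim: s => [|i s ih].
  by under eq_fun do rewrite big_nil; exact: bmeas_cst.
by under eq_fun do rewrite big_cons; exact: bmeasD.
Qed.

Variable mu : probability T R.

Lemma bmeas_integrable f : bmeas f -> mu.-integrable setT (EFin \o f).
Proof.
move=> [mf [B hB]]; apply: measurable_bounded_integrable => //.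
  by rewrite (le_lt_trans _ (ltry 1))// -(probability_setT mu).
exists B; split; first exact: num_real.
by move=> M BM x _ /=; rewrite (le_trans (hB x))// ltW.
Qed.

Lemma expect_cst c : \int[mu]_x (fun=> c) x = c.
Proof. have h : fine (mu setT) = 1 by rewrite (probability_setT mu).
by rewrite -[RHS]mulr1 -h; exact: Rintegral_cst. Qed.

Lemma expectD f g : bmeas f -> bmeas g ->
  \int[mu]_x (f x + g x) = \int[mu]_x f x + \int[mu]_x g x.
Proof. by move=> bf bg; apply: RintegralD => //; exact: bmeas_integrable. Qed.

Lemma expectZ c f : bmeas f -> \int[mu]_x (c * f x) = c * \int[mu]_x f x.
Proof. by move=> bf; apply: RintegralZl => //; exact: bmeas_integrable. Qed.

Lemma expectN f : bmeas f -> \int[mu]_x (- f x) = - \int[mu]_x f x.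
Proof.
by move=> bf; under eq_Rintegral do rewrite -mulN1r; rewrite expectZ// mulN1r.
Qed.

Lemma expect_sum (I : Type) (s : seq I) (F : I -> T -> R) :
  (forall i, bmeas (F i)) ->
  \int[mu]_x (\sum_(i <- s) F i x) = \sum_(i <- s) \int[mu]_x F i x.
Proof.
move=> h; elim: s => [|i s ih].
  by under eq_Rintegral do rewrite big_nil; rewrite big_nil expect_cst.
under eq_Rintegral do rewrite big_cons.
by rewrite big_cons expectD ?ih//; exact: bmeas_sum.
Qed.

Lemma expect_le f g : bmeas f -> bmeas g -> (forall x, f x <= g x) ->
  \int[mu]_x f x <= \int[mu]_x g x.
Proof. by move=> bf bg fg; apply: le_Rintegral => //; exact: bmeas_integrable. Qed.

Lemma expect_abs f : bmeas f -> `|\int[mu]_x f x| <= \int[mu]_x `|f x|.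
Proof. by move=> bf; apply: le_normr_Rintegral => //; exact: bmeas_integrable. Qed.

Lemma EFin_expect f : bmeas f ->
  (\int[mu]_x (f x)%:E)%E = (\int[mu]_x f x)%:E.
Proof.
move=> bf; rewrite /Rintegral fineK//.
by apply: integrable_fin_num => //; exact: bmeas_integrable.
Qed.

End BoundedMeasurable.

Lemma bmeas_comp {d d'} {T : measurableType d} {U : measurableType d'} {R : realType}
  (phi : T -> U) (f : U -> R) :
  measurable_fun setT phi -> bmeas f -> bmeas (f \o phi).
Proof.
by move=> mphi [mf [B hB]]; split; [exact: measurableT_comp|exists B => x; exact: hB].
Qed.

Section ProductExpectation.
Context {d1 d2 : measure_display} {T1 : measurableType d1} {T2 : measurableType d2}.
Context {R : realType} (P : probability T1 R) (Q : probability T2 R).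

Lemma expect_prodM (f : T1 -> R) (g : T2 -> R) : bmeas f -> bmeas g ->
  (\int[P \x Q]_z ((f z.1 * g z.2)%:E))%E = (\int[P]_x f x * \int[Q]_y g y)%:E.
Proof.
move=> bf bg.
have bfg : bmeas (fun z : T1 * T2 => f z.1 * g z.2).
  apply: bmeasM.
    exact: (bmeas_comp measurable_fst bf).
  exact: (bmeas_comp measurable_snd bg).
rewrite -integral12_prod_meas1; last first.
  by have /= := bmeas_integrable (P \x Q)%E bfg.
rewrite /fubini_F /= (eq_integral (fun x => (\int[Q]_y g y * f x)%:E)); last first.
  move=> x _; rewrite EFin_expect ?expectZ 1?mulrC//.
  by apply: bmeasM => //; exact: bmeas_cst.
by rewrite EFin_expect ?expectZ 1?mulrC//; apply: bmeasM => //; exact: bmeas_cst.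
Qed.

End ProductExpectation.

Section OneDim.
Context {R : realType}.
Local Notation RB := (measurableTypeR R).
Local Notation U := (uniform_prob (@ltr01 R)).

Lemma measurable_trig (k : R) : measurable_fun setT (fun x : RB => cos (k * x))
  /\ measurable_fun setT (fun x : RB => sin (k * x)).
Proof.
split; apply: continuous_measurable_fun => x.
  apply: continuous_comp; first exact: mulrl_continuous.
  exact: continuous_cos.
apply: continuous_comp; first exact: mulrl_continuous.
exact: continuous_sin.
Qed.

Lemma bmeas_cos (k : R) : bmeas (fun x : RB => cos (k * x)).
Proof.
split; first exact: (measurable_trig k).1.
by exists 1 => x; rewrite ler_norml cos_geN1 cos_le1.
Qed.

Lemma bmeas_sin (k : R) : bmeas (fun x : RB => sin (k * x)).
Proof.
split; first exact: (measurable_trig k).2.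
by exists 1 => x; rewrite ler_norml sin_geN1 sin_le1.
Qed.

Lemma cos_sin_int (k : int) : cos (2 * pi * k%:~R) = 1 :> R /\ sin (2 * pi * k%:~R) = 0 :> R.
Proof.
have h (n : nat) : cos (2 * pi * n%:R) = 1 :> R /\ sin (2 * pi * n%:R) = 0 :> R.
  elim: n => [|n [ihc ihs]]; first by rewrite mulr0 cos0 sin0.
  have -> : 2 * pi * n.+1%:R = 2 * pi * n%:R + pi *+ 2 :> R.
    by rewrite -[n.+1%:R]natr1 mulrDr mulr1 mulr_natl.
  have [c2 s2] : cos (pi *+ 2) = 1 :> R /\ sin (pi *+ 2) = 0 :> R.
    by rewrite cos2pi sin2pi.
  rewrite cosD (sinD (2 * pi * n%:R)) ihc ihs c2 s2.
  by rewrite !mulr1 mul0r mulr0 subr0 addr0.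
case: k => n; first by have := h n.
by rewrite NegzE mulrNz mulrN cosN sinN; have [-> ->] := h n.+1; rewrite oppr0.
Qed.

Lemma is_derive_mulcomp (g : R -> R) (dg : R -> R) (w x : R) :
  (forall y : R, is_derive y 1 g (dg y)) ->
  is_derive x 1 (fun y => g (w * y)) (w * dg (w * x)).
Proof.
move=> h.
have H1 : is_derive x 1 ( *%R w) w.
  have := @is_deriveZ R R^o R^o id w x 1 1 (is_derive_id _ _).
  by rewrite /GRing.scale /= mulr1.
have := @is_derive1_comp R g ( *%R w) x _ _ (h (w * x)) H1.
by rewrite mulrC.
Qed.

(** The passage from the uniform law to the Lebesgue integral is made for nonnegative integrands;
    cosine and sine are therefore integrated as 1 + cos and 1 + sin. *)
Lemma expect_FTC (g G : R -> R) : (forall x : R, is_derive x 1 G (g x)) ->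
  continuous g -> (forall x, 0 <= g x) ->
  \int[U]_x g x = G 1 - G 0.
Proof.
move=> dG cg g0.
rewrite /Rintegral integral_uniform//; last first.
- apply/measurable_EFinP; exact: continuous_measurable_fun.
rewrite subr0 invr1 mul1e (@continuous_FTC2 _ _ G)//.
- exact: continuous_subspaceT.
- have cG : continuous G.
    by move=> x; apply: differentiable_continuous; apply/derivable1_diffP; exact: ex_derive.
  split.
  + by move=> x _; exact: ex_derive.
  + exact: cvg_at_right_filter (cG _).
  + exact: cvg_at_left_filter (cG _).
- by move=> x _; rewrite derive1E; exact: derive_val.
Qed.

Lemma expect_cos1 (k : int) : k != 0 -> \int[U]_x cos (2 * pi * k%:~R * x) = 0.
Proof.
move=> k0; set w : R := 2 * pi * k%:~R.
have w0 : w != 0 by rewrite !mulf_neq0 ?intr_eq0// gt_eqF// pi_gt0.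
have dG1 (x : R) : is_derive x 1 (fun y : R => y + w^-1 * sin (w * y)) (1 + cos (w * x)).
  have -> : 1 + cos (w * x) = 1 + w^-1 * (w * cos (w * x)) by rewrite mulKf.
  apply: is_deriveD.
  by apply: is_deriveZ; exact: is_derive_mulcomp.
have : \int[U]_x (1 + cos (w * x)) = 1.
  rewrite (@expect_FTC _ (fun x => x + w^-1 * sin (w * x)) dG1).
  - rewrite /= mulr1 mulr0 (cos_sin_int k).2 sin0; lra.
  - move=> x; apply: continuousD; first exact: cvg_cst.
    apply: continuous_comp; first exact: mulrl_continuous.
    exact: continuous_cos.
  - by move=> x; rewrite -lerBlDl sub0r cos_geN1.
rewrite expectD ?expect_cst; [lra|exact: bmeas_cst|exact: bmeas_cos].
Qed.

Lemma expect_sin1 (k : int) : \int[U]_x sin (2 * pi * k%:~R * x) = 0.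
Proof.
have [->|k0] := eqVneq k 0.
  by under eq_Rintegral do rewrite mulr0 mul0r sin0; rewrite expect_cst.
set w : R := 2 * pi * k%:~R.
have w0 : w != 0 by rewrite !mulf_neq0 ?intr_eq0// gt_eqF// pi_gt0.
have dG1 (x : R) : is_derive x 1 (fun y : R => y + - w^-1 * cos (w * y)) (1 + sin (w * x)).
  have -> : 1 + sin (w * x) = 1 + - w^-1 * (w * - sin (w * x)) by rewrite mulNr mulKf ?opprK.
  apply: is_deriveD.
  by apply: is_deriveZ; exact: is_derive_mulcomp.
have : \int[U]_x (1 + sin (w * x)) = 1.
  rewrite (@expect_FTC _ (fun x => x + - w^-1 * cos (w * x)) dG1).
  - rewrite /= mulr1 mulr0 (cos_sin_int k).1 cos0; lra.
  - move=> x; apply: continuousD; first exact: cvg_cst.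
    apply: continuous_comp; first exact: mulrl_continuous.
    exact: continuous_sin.
  - by move=> x; rewrite -lerBlDl sub0r sin_geN1.
rewrite expectD ?expect_cst; [lra|exact: bmeas_cst|exact: bmeas_sin].
Qed.
End OneDim.

Lemma complexM (R : rcfType) (z w : R[i]) : z * w =
  Complex (complex.Re z * complex.Re w - complex.Im z * complex.Im w)
          (complex.Re z * complex.Im w + complex.Im z * complex.Re w).
Proof. by case: z w => [a b] [c d]. Qed.

(** * Complex expectations and orthogonality of characters *)

Section CharExpectation.
Context {R : realType}.
Local Notation RB := (measurableTypeR R).
Local Notation U := (uniform_prob (@ltr01 R)).

Definition cbmeas {disp} {T : measurableType disp} (F : T -> R[i]) :=
  bmeas (fun x => complex.Re (F x)) /\ bmeas (fun x => complex.Im (F x)).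

(** For [mu := cube R d] this is convertible to [cube_Cintegral], so that [fourier] is such an
    expectation. *)
Definition Cexpect {disp} {T : measurableType disp} (mu : probability T R) (F : T -> R[i]) : R[i] :=
  Complex (\int[mu]_x complex.Re (F x)) (\int[mu]_x complex.Im (F x)).

Section Lin.
Context {disp : measure_display} {T : measurableType disp} (mu : probability T R).
Implicit Types (F G : T -> R[i]).

Lemma cbmeasD F G : cbmeas F -> cbmeas G -> cbmeas (fun x => F x + G x).
Proof.
move=> [rF iF] [rG iG]; split.
- by apply: eq_bmeas (bmeasD rF rG) => x /=; case: (F x); case: (G x).
- by apply: eq_bmeas (bmeasD iF iG) => x /=; case: (F x); case: (G x).
Qed.

Lemma cbmeasM F G : cbmeas F -> cbmeas G -> cbmeas (fun x => F x * G x).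
Proof.
move=> [rF iF] [rG iG]; split.
- apply: eq_bmeas (bmeasD (bmeasM rF rG) (bmeasN (bmeasM iF iG))) => x /=.
  by case: (F x); case: (G x).
- apply: eq_bmeas (bmeasD (bmeasM rF iG) (bmeasM iF rG)) => x /=.
  by case: (F x); case: (G x).
Qed.

Lemma cbmeas_cst c : cbmeas (fun _ : T => c).
Proof. by split; exact: bmeas_cst. Qed.

Lemma cbmeasJ F : cbmeas F -> cbmeas (fun x => (F x)^*%C).
Proof.
move=> [rF iF]; split.
- by apply: eq_bmeas rF => x; case: (F x).
- by apply: eq_bmeas (bmeasN iF) => x; case: (F x).
Qed.

Lemma cbmeas_sum (I : Type) (s : seq I) (F : I -> T -> R[i]) :
  (forall i, cbmeas (F i)) -> cbmeas (fun x => \sum_(i <- s) F i x).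
Proof.
move=> h; elim: s => [|i s ih].
  by under eq_fun do rewrite big_nil; exact: cbmeas_cst.
by under eq_fun do rewrite big_cons; exact: cbmeasD.
Qed.

Lemma Cexpect_cst c : Cexpect mu (fun=> c) = c.
Proof. by rewrite /Cexpect !expect_cst; case: c. Qed.

Lemma eq_Cexpect F G : F =1 G -> Cexpect mu F = Cexpect mu G.
Proof. by move=> FG; congr Cexpect; exact/funext. Qed.

Lemma CexpectD F G : cbmeas F -> cbmeas G ->
  Cexpect mu (fun x => F x + G x) = Cexpect mu F + Cexpect mu G.
Proof.
move=> [rF iF] [rG iG]; rewrite /Cexpect /GRing.add /=; congr Complex.
- by rewrite -expectD//; congr Rintegral; apply/funext => x; case: (F x); case: (G x).
- by rewrite -expectD//; congr Rintegral; apply/funext => x; case: (F x); case: (G x).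
Qed.

Lemma CexpectZ c F : cbmeas F -> Cexpect mu (fun x => c * F x) = c * Cexpect mu F.
Proof.
move=> [rF iF]; rewrite (complexM c); congr Complex.
- rewrite -!expectZ// -expectN; last by apply: bmeasM => //; exact: bmeas_cst.
  rewrite -expectD; last 2 first.
  + by apply: bmeasM => //; exact: bmeas_cst.
  + by apply/bmeasN/bmeasM => //; exact: bmeas_cst.
  by congr Rintegral; apply/funext => x; rewrite complexM.
- rewrite -!expectZ// -expectD.
  + by congr Rintegral; apply/funext => x; rewrite complexM.
  + by apply: bmeasM => //; exact: bmeas_cst.
  + by apply: bmeasM => //; exact: bmeas_cst.
Qed.

Lemma Cexpect_sum (I : Type) (s : seq I) (F : I -> T -> R[i]) :
  (forall i, cbmeas (F i)) ->
  Cexpect mu (fun x => \sum_(i <- s) F i x) = \sum_(i <- s) Cexpect mu (F i).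
Proof.
move=> h; elim: s => [|i s ih].
  by under eq_Cexpect do rewrite big_nil; rewrite big_nil Cexpect_cst.
under eq_Cexpect do rewrite big_cons.
by rewrite big_cons CexpectD ?ih//; exact: cbmeas_sum.
Qed.

End Lin.

Section ProdC.
Context {d1 d2 : measure_display} {T1 : measurableType d1} {T2 : measurableType d2}.
Context (P : probability T1 R) (Q : probability T2 R).

(** The real and the imaginary part of a product of two complex functions of separate variables have
    this form. *)
Lemma integral_prod_sum (f1 f2 : T1 -> R) (g1 g2 : T2 -> R) :
  bmeas f1 -> bmeas f2 -> bmeas g1 -> bmeas g2 ->
  (\int[P \x Q]_z ((f1 z.1 * g1 z.2 + f2 z.1 * g2 z.2)%:E))%E =
  (\int[P]_x f1 x * \int[Q]_y g1 y + \int[P]_x f2 x * \int[Q]_y g2 y)%:E.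
Proof.
move=> bf1 bf2 bg1 bg2.
have bM (f : T1 -> R) (g : T2 -> R) : bmeas f -> bmeas g -> bmeas (fun z : T1 * T2 => f z.1 * g z.2).
  by move=> bf bg; apply: bmeasM; [exact: (bmeas_comp measurable_fst bf)|exact: (bmeas_comp measurable_snd bg)].
under eq_integral do rewrite EFinD.
rewrite integralD//; last 2 first.
- by have /= := bmeas_integrable (P \x Q)%E (bM _ _ bf1 bg1).
- by have /= := bmeas_integrable (P \x Q)%E (bM _ _ bf2 bg2).
by rewrite EFinD !expect_prodM.
Qed.

End ProdC.

Definition expi (t : R) : R[i] := Complex (cos t) (sin t).

Lemma expiD s t : expi (s + t) = expi s * expi t.
Proof. by rewrite complexM /= /expi cosD sinD (addrC (cos s * sin t)). Qed.

Lemma cexpD d (k l : 'rV[int]_d) (x : 'rV[R]_d) :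
  cexp_char (k + l) x = cexp_char k x * cexp_char l x.
Proof.
rewrite /cexp_char -!/(expi _) -expiD -mulrDr.
have -> : \sum_j ((k + l) ord0 j)%:~R * x ord0 j =
          \sum_j (k ord0 j)%:~R * x ord0 j + \sum_j (l ord0 j)%:~R * x ord0 j :> R.
  by rewrite -big_split; apply: eq_bigr => j _; rewrite mxE intrD mulrDl.
by [].
Qed.

Lemma cexpN d (k : 'rV[int]_d) (x : 'rV[R]_d) :
  cexp_char (- k) x = (cexp_char k x)^*%C.
Proof.
rewrite /cexp_char /=.
have -> : \sum_j ((- k) ord0 j)%:~R * x ord0 j = - \sum_j (k ord0 j)%:~R * x ord0 j :> R.
  by rewrite -sumrN; apply: eq_bigr => j _; rewrite mxE mulrNz mulNr.
by rewrite mulrN cosN sinN.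
Qed.

Lemma cexp0 d (x : 'rV[R]_d) : cexp_char 0 x = 1.
Proof.
rewrite /cexp_char big1; first by rewrite mulr0 cos0 sin0.
by move=> j _; rewrite mxE mul0r.
Qed.

Lemma cexpDx d (k : 'rV[int]_d) (x y : 'rV[R]_d) :
  cexp_char k (x + y) = cexp_char k x * cexp_char k y.
Proof.
rewrite /cexp_char -!/(expi _) -expiD -mulrDr.
have -> : \sum_j (k ord0 j)%:~R * (x + y) ord0 j =
          \sum_j (k ord0 j)%:~R * x ord0 j + \sum_j (k ord0 j)%:~R * y ord0 j :> R.
  by rewrite -big_split; apply: eq_bigr => j _; rewrite mxE mulrDr.
by [].
Qed.

Lemma cexpNx d (k : 'rV[int]_d) (x : 'rV[R]_d) : cexp_char k (- x) = cexp_char (- k) x.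
Proof.
rewrite /cexp_char.
suff -> : \sum_j (k ord0 j)%:~R * (- x) ord0 j = \sum_j ((- k) ord0 j)%:~R * x ord0 j :> R by [].
by apply: eq_bigr => j _; rewrite !mxE mulrNz mulNr mulrN.
Qed.

Lemma cexp_int d (k : 'rV[int]_d) (z : 'rV[int]_d) :
  cexp_char k (map_mx intr z : 'rV[R]_d) = 1.
Proof.
rewrite /cexp_char.
have -> : \sum_j (k ord0 j)%:~R * (map_mx intr z : 'rV[R]_d) ord0 j =
          (\sum_j k ord0 j * z ord0 j)%:~R :> R.
  by rewrite raddf_sum; apply: eq_bigr => j _; rewrite mxE /= intrM.
by have [-> ->] := @cos_sin_int R (\sum_j k ord0 j * z ord0 j).
Qed.

Lemma row_of_tuple_cons d (p : RB * d.-tuple RB) (k : 'rV[int]_d.+1) :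
  cexp_char k (row_of_tuple (cube_glue p)) =
  Complex (cos (2 * pi * (k ord0 ord0)%:~R * p.1)) (sin (2 * pi * (k ord0 ord0)%:~R * p.1)) *
  cexp_char (\row_j k ord0 (lift ord0 j)) (row_of_tuple p.2).
Proof.
rewrite /cexp_char -!/(expi _) -expiD -[X in expi (X + _)]mulrA -mulrDr.
rewrite big_ord_recl; congr (expi (_ * (_ + _))); first by rewrite mxE.
by apply: eq_bigr => j _; rewrite !mxE tnthS.
Qed.

Lemma cbmeas_char d (k : 'rV[int]_d) :
  cbmeas (fun x : d.-tuple RB => cexp_char k (row_of_tuple x)).
Proof.
have m : measurable_fun setT (fun x : d.-tuple RB =>
    \sum_j (k ord0 j)%:~R * row_of_tuple x ord0 j : RB).
  apply: measurable_sum => j; apply: measurable_funM; first exact: measurable_cst.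
  by under eq_fun do rewrite mxE; exact: measurable_tnth.
by split; [exact: (bmeas_comp m (bmeas_cos (2 * pi)))|exact: (bmeas_comp m (bmeas_sin (2 * pi)))].
Qed.

Lemma cube_pushforward d (f : d.+1.-tuple RB -> R) : bmeas f ->
  (\int[cube R d.+1]_x (f x)%:E =
   \int[(U \x cube R d)]_p (f (cube_glue p))%:E)%E.
Proof.
move=> bf.
have bg := bmeas_comp (@measurable_cube_glue R d) bf.
rewrite /= /distribution integral_pushforward//=.
- by apply/measurable_EFinP; exact: bf.1.
- by have /= := bmeas_integrable (U \x cube R d)%E bg.
Qed.

(** Induction on the dimension: a character is a product of one in the first coordinate and one in
    the others, and Fubini's theorem multiplies the expectations. *)
Lemma Cexpect_char d (k : 'rV[int]_d) :
  Cexpect (cube R d) (fun x => cexp_char k (row_of_tuple x)) = (k == 0)%:R.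
Proof.
elim: d k => [|d ih] k.
  have -> : k = 0 by apply/rowP => -[].
  by rewrite eqxx (@eq_Cexpect _ _ _ _ (fun=> 1)) ?Cexpect_cst// => x; rewrite cexp0.
have [bR bI] := cbmeas_char k.
pose k' : 'rV[int]_d := \row_j k ord0 (lift ord0 j).
have [bR' bI'] := cbmeas_char k'.
set w : R := 2 * pi * (k ord0 ord0)%:~R.
have bC := bmeas_cos w; have bS := bmeas_sin w.
have bSN := bmeasN bS.
have -> : Cexpect (cube R d.+1) (fun x => cexp_char k (row_of_tuple x)) =
  Cexpect U (fun x => Complex (cos (w * x)) (sin (w * x))) *
  Cexpect (cube R d) (fun x => cexp_char k' (row_of_tuple x)).
  rewrite [RHS]complexM; congr Complex; rewrite /Rintegral cube_pushforward//.
    transitivity (fine (\int[U \x cube R d]_z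
        (cos (w * z.1) * complex.Re (cexp_char k' (row_of_tuple z.2)) +
        (- sin (w * z.1)) * complex.Im (cexp_char k' (row_of_tuple z.2)))%:E)%E).
      by congr fine; apply: eq_integral => z _; rewrite row_of_tuple_cons complexM -mulNr.
    by rewrite (integral_prod_sum _ _ bC bSN bR' bI') expectN// mulNr.
  transitivity (fine (\int[U \x cube R d]_z
        (cos (w * z.1) * complex.Im (cexp_char k' (row_of_tuple z.2)) +
        (sin (w * z.1)) * complex.Re (cexp_char k' (row_of_tuple z.2)))%:E)%E).
    by congr fine; apply: eq_integral => z _; rewrite row_of_tuple_cons complexM.
  by rewrite (integral_prod_sum _ _ bC bS bI' bR').
rewrite ih.
have -> : Cexpect U (fun x => Complex (cos (w * x)) (sin (w * x))) = (k ord0 ord0 == 0)%:R.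
  rewrite /Cexpect expect_sin1.
  have [k0|k0] := eqVneq; last by rewrite expect_cos1.
  rewrite /w k0; under eq_Rintegral do rewrite mulr0 mul0r cos0.
  by rewrite expect_cst.
rewrite -natrM mulnb; congr (_%:R); congr nat_of_bool.
apply/andP/eqP => [[/eqP k0 /eqP k'0]|k0].
  apply/rowP => j; rewrite mxE; have [j' ->|->//] := unliftP ord0 j.
  by move/rowP/(_ j') : k'0; rewrite !mxE.
by rewrite k0 mxE; split=> //; apply/eqP/rowP => j; rewrite /k' k0 !mxE.
Qed.

End CharExpectation.

(** * The error on trigonometric polynomials *)

Section Parseval.
Context {R : realType} {d : nat}.
Local Notation RB := (measurableTypeR R).
Local Notation row := (@row_of_tuple R d).
Implicit Types (k h : 'rV[int]_d).

Definition sqnorm (z : R[i]) : R := Normc.normc z ^+ 2.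

Lemma sqnormE z : sqnorm z = complex.Re z ^+ 2 + complex.Im z ^+ 2.
Proof. by case: z => a b; rewrite /sqnorm /= sqr_sqrtr// addr_ge0// sqr_ge0. Qed.

Lemma sqnorm_Re z : sqnorm z = complex.Re (z * z^*%C).
Proof. by rewrite sqnormE; case: z => a b /=; ring. Qed.

Lemma sqnorm_ge0 z : 0 <= sqnorm z.
Proof. exact: sqr_ge0. Qed.

Lemma sqnormM z w : sqnorm (z * w) = sqnorm z * sqnorm w.
Proof. by rewrite /sqnorm Normc.normcM exprMn. Qed.

Lemma sqnormN z : sqnorm (- z) = sqnorm z.
Proof. by rewrite !sqnormE; case: z => a b /=; rewrite !sqrrN. Qed.

Lemma sqnormR (a : R) : sqnorm a%:C%C = a ^+ 2.
Proof. by rewrite sqnormE /= expr0n addr0. Qed.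

Lemma sqnorm_char k (x : 'rV[R]_d) : sqnorm (cexp_char k x) = 1.
Proof. by rewrite sqnormE /= cos2Dsin2. Qed.

Lemma cbmeas_sqnorm {disp} {T : measurableType disp} (F : T -> R[i]) :
  cbmeas F -> bmeas (fun x => sqnorm (F x)).
Proof.
move=> bF; apply: eq_bmeas (cbmeasM bF (cbmeasJ bF)).1 => x /=.
by rewrite sqnorm_Re.
Qed.

Lemma cbmeas_trig (I : Type) (s : seq I) (k : I -> 'rV[int]_d) (a : I -> R[i]) :
  cbmeas (fun x => \sum_(i <- s) a i * cexp_char (k i) (row x)).
Proof.
by apply: cbmeas_sum => i; apply: cbmeasM; [exact: cbmeas_cst|exact: cbmeas_char].
Qed.

(** The squared modulus is a sum over pairs of frequencies, of which only the diagonal survives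
    integration. *)
Lemma parseval (s : seq 'rV[int]_d) (a : 'rV[int]_d -> R[i]) : uniq s ->
  \int[cube R d]_x sqnorm (\sum_(k <- s) a k * cexp_char k (row x)) =
  \sum_(k <- s) sqnorm (a k).
Proof.
move=> us.
have E x : (\sum_(k <- s) a k * cexp_char k (row x)) *
   (\sum_(k <- s) a k * cexp_char k (row x))^*%C =
   \sum_(p <- [seq (k, l) | k <- s, l <- s]) (a p.1 * (a p.2)^*%C) * cexp_char (p.1 - p.2) (row x).
  rewrite rmorph_sum /= big_distrl big_allpairs_dep /=; apply: eq_bigr => k _.
  rewrite big_distrr; apply: eq_bigr => l _.
  by rewrite cexpD cexpN rmorphM /= mulrACA.
transitivity (complex.Re (Cexpect (cube R d) (fun x =>
    \sum_(p <- [seq (k, l) | k <- s, l <- s]) (a p.1 * (a p.2)^*%C) * cexp_char (p.1 - p.2) (row x)))).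
  by apply: eq_Rintegral => x _; rewrite sqnorm_Re E.
rewrite Cexpect_sum; last first.
  by move=> i; apply: cbmeasM; [exact: cbmeas_cst|exact: cbmeas_char].
transitivity (complex.Re (\sum_(k <- s) (a k * (a k)^*%C))).
  congr complex.Re; rewrite big_allpairs_dep; apply: eq_big_seq => k ks /=.
  rewrite (bigD1_seq k)//= big1 ?addr0 => [|l lk]; rewrite CexpectZ; try exact: cbmeas_char.
  - by rewrite Cexpect_char subrr eqxx mulr1.
  - by rewrite Cexpect_char subr_eq0 eq_sym (negbTE lk) mulr0.
elim: s {us E} => [|k s ih]; first by rewrite !big_nil.
by rewrite !big_cons -ih sqnorm_Re; case: (a k * _) => u v; case: (\sum_(_ <- _) _).
Qed.

End Parseval.

(** * Aliasing of characters on rank-1 lattices *)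

Section Lattice.
Context {R : realType} {d : nat}.
Local Notation row := (@row_of_tuple R d).
Implicit Types (k h m : 'rV[int]_d) (x y D : 'rV[R]_d) (l : lattice d) (A : {fset 'rV[int]_d}).

Lemma cexp_frac k x : cexp_char k (map_mx (@frac_part R) x) = cexp_char k x.
Proof.
have {2}-> : x = map_mx (@frac_part R) x + map_mx intr (map_mx (fun r => Num.floor r) x).
  by apply/matrixP => i j; rewrite !mxE /frac_part subrK.
by rewrite cexpDx cexp_int mulr1.
Qed.

Lemma expiX (t : R) (i : nat) : expi (i%:R * t) = expi t ^+ i.
Proof.
elim: i => [|i ih]; first by rewrite mul0r expr0 /expi cos0 sin0.
by rewrite -[i.+1%:R]natr1 mulrDl mul1r expiD ih exprSr.
Qed.

Lemma expi_int (q : int) : expi (2 * pi * q%:~R) = 1 :> R[i].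
Proof. by rewrite /expi; have [-> ->] := @cos_sin_int R q. Qed.

(** Reduction modulo 1 is invisible to an integer frequency, so that along the lattice a character
    is a geometric progression. *)
Lemma cexp_lattice_point m l (i : nat) :
  cexp_char m (lattice_point R l i) = expi (2 * pi * ((dotz m l.2)%:~R / l.1%:R)) ^+ i.
Proof.
have -> : lattice_point R l i = map_mx (@frac_part R) (\row_j ((i%:Z * l.2 ord0 j)%:~R / l.1%:R)).
  by apply/matrixP => a j; rewrite !mxE.
rewrite cexp_frac -[LHS]/(expi _).
have -> : \sum_j (m ord0 j)%:~R * (\row_j0 ((i%:Z * l.2 ord0 j0)%:~R / l.1%:R)) ord0 j =
   i%:R * ((dotz m l.2)%:~R / l.1%:R) :> R.
  rewrite /dotz rmorph_sum /= big_distrl big_distrr; apply: eq_bigr => j _ /=.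
  by rewrite mxE !intrM; ring.
by rewrite -expiX mulrCA.
Qed.

Lemma expi_ratio1 (q : int) (n : nat) : (0 < n)%N ->
  (expi (2 * pi * (q%:~R / n%:R)) == 1 :> R[i]) = (n%:Z %| q)%Z.
Proof.
move=> n0; have n0' : n%:R != 0 :> R by rewrite pnatr_eq0 -lt0n.
have n0z : n%:Z != 0 by rewrite eqz_nat -lt0n.
have E : expi (2 * pi * (q%:~R / n%:R)) = expi (2 * pi * ((q %% n%:Z)%Z%:~R / n%:R)) :> R[i].
  have -> : q%:~R / n%:R = (q %/ n%:Z)%Z%:~R + (q %% n%:Z)%Z%:~R / n%:R :> R.
    by rewrite {1}(divz_eq q n%:Z) intrD intrM -pmulrn; field.
  by rewrite mulrDr expiD expi_int mul1r.
rewrite E (sameP dvdz_mod0P eqP).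
have : 0 <= (q %% n%:Z)%Z < n%:Z by rewrite modz_ge0// ltz_mod.
case/andP; case: (q %% n%:Z)%Z => // r _ rn; apply/eqP/eqP => [|->]; last first.
  by rewrite mul0r mulr0 /expi cos0 sin0.
have [->//|r0] := eqVneq r 0%N.
move=> [+ _].
(* For 0 < r < n the angle is 2t with 0 < t < pi, and sin t > 0 contradicts cos (2t) = 1. *)
set t := pi * (r%:R / n%:R) : R.
have -> : 2 * pi * (r%:~R / n%:R) = t *+ 2 by rewrite -[RHS]mulr_natl /t -pmulrn mulrA.
rewrite cos_mulr2n => c1.
have : 0 < sin t.
  apply: sin_gt0_pi; rewrite mulr_gt0 ?pi_gt0 ?divr_gt0 ?ltr0n// ?lt0n//=.
  by rewrite gtr_pMr ?pi_gt0// ltr_pdivrMr ?ltr0n// mul1r ltr_nat.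
move=> s0; exfalso; have := cos2Dsin2 t; have := mulr_gt0 s0 s0; rewrite -expr2; lra.
Qed.

(** A geometric sum whose ratio w satisfies w^n = 1: it is n if w = 1 and 0 otherwise. The shift
    factors out. *)
Lemma sum_lattice m l D : (0 < l.1)%N ->
  \sum_(i < l.1) cexp_char m (shifted_point l D i) =
  cexp_char m D * (if (l.1%:Z %| dotz m l.2)%Z then l.1%:R else 0).
Proof.
move=> n0.
under eq_bigr do rewrite cexp_frac cexpDx cexp_lattice_point mulrC.
rewrite -big_distrr /=; congr (_ * _).
rewrite -expi_ratio1//; set w := expi _ : R[i].
case: eqVneq => [->|w1].
  by under eq_bigr do rewrite expr1n; rewrite sumr_const card_ord.
have : (w - 1) * \sum_(i < l.1) w ^+ i = 0.
  rewrite -subrX1 -expiX.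
  have -> : l.1%:R * (2 * pi * ((dotz m l.2)%:~R / l.1%:R)) = 2 * pi * (dotz m l.2)%:~R :> R.
    by field; rewrite pnatr_eq0 -lt0n.
  by rewrite expi_int subrr.
by move/eqP; rewrite mulf_eq0 subr_eq0 (negbTE w1) => /eqP.
Qed.

Lemma fourier_mult_sum (I : Type) (s : seq I) (F : I -> 'rV[R]_d -> R[i]) A (ls : seq (lattice d)) D k :
  fourier_mult A ls D (fun x => \sum_(i <- s) F i x) k =
  \sum_(i <- s) fourier_mult A ls D (F i) k.
Proof.
rewrite /fourier_mult -big_distrr /=; congr (_ * _).
rewrite exchange_big /=; apply: eq_bigr => l _.
rewrite -big_distrr /=; congr (_ * _).
rewrite exchange_big /=; apply: eq_bigr => i _.
by rewrite big_distrl.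
Qed.

Lemma fourier_multZ (c : R[i]) (F : 'rV[R]_d -> R[i]) A (ls : seq (lattice d)) D k :
  fourier_mult A ls D (fun x => c * F x) k = c * fourier_mult A ls D F k.
Proof.
rewrite /fourier_mult mulrCA; congr (_ * _); rewrite big_distrr /=; apply: eq_bigr => l _.
rewrite mulrCA; congr (_ * _); rewrite big_distrr /=; apply: eq_bigr => i _.
by rewrite mulrA.
Qed.

(** The share of the frequency [h] that the algorithm attributes to [k]. By [fourier_mult_char] the
    shift enters only through a character, so that averaging over the shift decouples the different
    [h]. *)
Definition alias_coef A (ls : seq (lattice d)) h k : R :=
  (xi A ls k)%:R^-1 *
  \sum_(l <- ls) (aliasing_free A l k && (l.1%:Z %| dotz (h - k) l.2)%Z)%:R.

Lemma fourier_mult_char A (ls : seq (lattice d)) D h k :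
  all (fun l => 0 < l.1)%N ls ->
  fourier_mult A ls D (cexp_char h) k =
  (alias_coef A ls h k)%:C%C * cexp_char (h - k) D.
Proof.
move=> /allP ls0; rewrite /fourier_mult /alias_coef rmorphM fmorphV rmorph_nat -mulrA.
congr (_ * _); rewrite rmorph_sum big_distrl /=; apply: eq_big_seq => l /ls0 l0.
under eq_bigr do rewrite -cexpD.
rewrite sum_lattice// rmorph_nat.
have nz : l.1%:R != 0 :> R[i] by rewrite pnatr_eq0 -lt0n.
by case: ifP => _; case: aliasing_free; rewrite /= ?mul0r ?mulr0// mul1r mulrCA mulVf ?mulr1 ?mul1r.
Qed.

Lemma dotzBl h k (g : 'rV[int]_d) : dotz (h - k) g = dotz h g - dotz k g.
Proof.
by rewrite /dotz -sumrB; apply: eq_bigr => j _; rewrite !mxE mulrBl.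
Qed.

Lemma dvdz_dotzB l h k :
  (l.1%:Z %| dotz (h - k) l.2)%Z = (dotz h l.2 == dotz k l.2 %[mod l.1%:Z])%Z.
Proof. by rewrite dotzBl eqz_mod_dvd. Qed.

(** On a lattice where [k] is aliasing-free no other element of [A] is congruent to [k], while [k]
    itself is counted on exactly [xi A ls k] lattices, which the prefactor cancels. *)
Lemma alias_coef_in A (ls : seq (lattice d)) h k :
  well_defined A ls -> h \in A -> k \in A -> alias_coef A ls h k = (h == k)%:R.
Proof.
move=> wd hA kA; rewrite /alias_coef; have [<-|hk] := eqVneq.
  rewrite subrr.
  rewrite (_ : \sum_(l <- ls) _ = (xi A ls h)%:R).
    by rewrite mulVf// pnatr_eq0 -lt0n; exact: wd.
  rewrite /xi natr_sum; apply: eq_bigr => l _.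
  suff -> : dotz (0 : 'rV[int]_d) l.2 = 0 by rewrite dvdz0 andbT.
  by rewrite /dotz big1// => j _; rewrite mxE mul0r.
rewrite big1 ?mulr0// => l _; case: (boolP (aliasing_free A l k)) => //= /allP/(_ h).
rewrite in_fsetD1 hk hA => /(_ isT).
by rewrite dvdz_dotzB => /negbTE ->.
Qed.

Lemma alias_coef_ge0 A (ls : seq (lattice d)) h k : 0 <= alias_coef A ls h k.
Proof. by rewrite mulr_ge0 ?invr_ge0// sumr_ge0. Qed.

Lemma alias_coef_le1 A (ls : seq (lattice d)) h k : alias_coef A ls h k <= 1.
Proof.
rewrite /alias_coef; have [->|x0] := eqVneq (xi A ls k) 0%N; first by rewrite invr0 mul0r.
rewrite mulrC ler_pdivrMr ?ltr0n ?lt0n// mul1r /xi natr_sum ler_sum// => l _.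
by case: aliasing_free => //=; rewrite ler_nat leq_b1.
Qed.

(** A number in [0,1] dominates its square. On one lattice, two aliasing-free elements of [A]
    congruent to [h] would be congruent to each other, so each lattice contributes at most 1. *)
Lemma alias_coef_sum A (ls : seq (lattice d)) h :
  \sum_(k <- A) alias_coef A ls h k ^+ 2 <= (size ls)%:R.
Proof.
apply: (@le_trans _ _ (\sum_(k <- A) \sum_(l <- ls)
    (aliasing_free A l k && (l.1%:Z %| dotz (h - k) l.2)%Z)%:R)).
  apply: ler_sum => k _.
  apply: (@le_trans _ _ (alias_coef A ls h k)).
    by rewrite expr2 ler_piMr ?alias_coef_ge0 ?alias_coef_le1.
  rewrite /alias_coef; have [->|x0] := eqVneq (xi A ls k) 0%N.
    by rewrite invr0 mul0r sumr_ge0.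
  by rewrite ler_piMl ?sumr_ge0// invf_le1 ?ltr0n ?lt0n// ler1n lt0n.
rewrite exchange_big /= -sum1_size natr_sum; apply: ler_sum => l _.
rewrite -natr_sum ler_nat -big_mkcond /= sum1_count -size_filter.
set s := [seq _ <- _ | _].
have us : uniq s by apply: filter_uniq; exact: fset_uniq.
case E : s us => [//|k1 [//|k2 s']] /= /andP[]; rewrite inE negb_or => /andP[k12 _] _.
have : k1 \in s by rewrite E mem_head.
have : k2 \in s by rewrite E !inE eqxx orbT.
rewrite !mem_filter => /andP[/andP[_ d2] k2A] /andP[/andP[/allP/(_ k2) U1 d1] k1A].
move: U1; rewrite in_fsetD1 eq_sym k12 k2A => /(_ isT).
move: d1 d2; rewrite !dvdz_dotzB => /eqP <- /eqP ->.
by rewrite eqxx.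
Qed.

End Lattice.

(** * Mean square error of a trigonometric polynomial *)

Section TrigError.
Context {R : realType} {d : nat}.
Local Notation row := (@row_of_tuple R d).
Variables (A : {fset 'rV[int]_d}) (ls : seq (lattice d)).
Hypothesis ls0 : all (fun l => 0 < l.1)%N ls.
Hypothesis wd : well_defined A ls.
Variables (K : seq 'rV[int]_d) (a : 'rV[int]_d -> R[i]).
Hypothesis uK : uniq K.

Let T x := \sum_(h <- K) a h * cexp_char h x : R[i].
Let K' := [seq h <- K | h \notin A].
(** Fourier coefficients of the error for the shift [D]: frequencies outside [A] are lost, and those
    in [A] are polluted only by frequencies outside [A]. *)
Let b D k := if k \in A then - \sum_(h <- K') (a h * (alias_coef A ls h k)%:C%C) * cexp_char (h - k) D
  else a k.

Lemma trig_errorE D x :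
  T x - approx_mult A ls D T x = \sum_(k <- K' ++ A) b D k * cexp_char k x.
Proof.
pose c h k := a h * (alias_coef A ls h k)%:C%C * cexp_char (h - k) D.
have E k : fourier_mult A ls D T k = \sum_(h <- K | h \in A) c h k + \sum_(h <- K') c h k.
  rewrite fourier_mult_sum (bigID [pred h | h \in A])/= -big_filter.
  rewrite -[X in _ + X]big_filter -!/K' big_filter; congr (_ + _).
    by apply: eq_bigr => h _; rewrite fourier_multZ fourier_mult_char// mulrA.
  by apply: eq_bigr => h _; rewrite fourier_multZ fourier_mult_char// mulrA.
have S1 : \sum_(k <- A) (\sum_(h <- K | h \in A) c h k) * cexp_char k x =
    \sum_(h <- K | h \in A) a h * cexp_char h x.
  under eq_bigr do rewrite big_distrl /=.
  rewrite exchange_big /=; apply: eq_bigr => h hA.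
  transitivity (\sum_(k <- A) a h * ((h == k)%:R : R)%:C%C * cexp_char (h - k) D * cexp_char k x).
    by apply: eq_big_seq => k kA; rewrite /c alias_coef_in.
  rewrite (bigD1_seq h)//= ?fset_uniq// big1 => [|k /negbTE kh].
    by rewrite eqxx mulr1 subrr cexp0 mulr1 addr0.
  by rewrite eq_sym kh mulr0 !mul0r.
rewrite /approx_mult; under eq_bigr do rewrite E mulrDl.
rewrite big_split /= S1 /T (bigID [pred h | h \in A])/= addrC opprD addrA addrK.
rewrite -big_filter -/K' big_cat /=; congr (_ + _).
  apply: eq_big_seq => k; rewrite mem_filter => /andP[kA _].
  by rewrite /b (negbTE kA).
rewrite -sumrN; apply: eq_big_seq => k kA.
by rewrite /b kA mulNr.
Qed.

Let uKA : uniq (K' ++ A).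
Proof.
rewrite cat_uniq filter_uniq// fset_uniq andbT /=; apply/hasPn => k kA.
by rewrite mem_filter kA.
Qed.

Lemma trig_error_inner D :
  \int[cube R d]_x sqnorm (T (row x) - approx_mult A ls D T (row x)) =
  \sum_(h <- K') sqnorm (a h) + \sum_(k <- A) sqnorm (\sum_(h <- K') (a h * (alias_coef A ls h k)%:C%C) * cexp_char h D).
Proof.
under eq_Rintegral do rewrite trig_errorE.
rewrite parseval// big_cat /=; congr (_ + _).
  by apply: eq_big_seq => k; rewrite mem_filter /b => /andP[/negbTE ->].
apply: eq_big_seq => k kA; rewrite /b kA sqnormN.
(* The phase at [- k] is common to all [h] and has modulus 1. Dropping it leaves a trigonometric
   polynomial in the shift, ready for the second use of Parseval's identity. *)
rewrite (eq_bigr (fun h => a h * (alias_coef A ls h k)%:C%C * cexp_char h D * cexp_char (- k) D)); last first.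
  by move=> h _; rewrite cexpD mulrA.
by rewrite -big_distrl sqnormM sqnorm_char mulr1.
Qed.

Lemma bmeas_trig_error D :
  bmeas (fun x => sqnorm (T (row x) - approx_mult A ls D T (row x))).
Proof.
under eq_fun do rewrite trig_errorE.
exact/cbmeas_sqnorm/cbmeas_trig.
Qed.

Lemma bmeas_trig_error_inner :
  bmeas (fun D => \sum_(h <- K') sqnorm (a h) +
    \sum_(k <- A) sqnorm (\sum_(h <- K') (a h * (alias_coef A ls h k)%:C%C) * cexp_char h (row D))).
Proof.
apply: bmeasD; first exact: bmeas_cst.
by apply: bmeas_sum => k; exact/cbmeas_sqnorm/cbmeas_trig.
Qed.

Lemma trig_error_le :
  \int[cube R d]_D (\sum_(h <- K') sqnorm (a h) +
    \sum_(k <- A) sqnorm (\sum_(h <- K') (a h * (alias_coef A ls h k)%:C%C) * cexp_char h (row D)))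
  <= (1 + (size ls)%:R) * \sum_(h <- K') sqnorm (a h).
Proof.
have bk k := cbmeas_sqnorm (cbmeas_trig K' id (fun h => a h * (alias_coef A ls h k)%:C%C)).
rewrite expectD; [|exact: bmeas_cst|exact: bmeas_sum].
rewrite expect_cst expect_sum// mulrDl mul1r lerD2l.
have -> : \sum_(k <- A) \int[cube R d]_D sqnorm (\sum_(h <- K') (a h * (alias_coef A ls h k)%:C%C) * cexp_char h (row D))
    = \sum_(k <- A) \sum_(h <- K') sqnorm (a h) * alias_coef A ls h k ^+ 2.
  apply: eq_bigr => k _; rewrite parseval ?filter_uniq//.
  by apply: eq_bigr => h _; rewrite sqnormM sqnormR.
rewrite exchange_big mulr_sumr; apply: ler_sum => h _.
by rewrite -mulr_sumr mulrC ler_wpM2r ?sqnorm_ge0// alias_coef_sum.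
Qed.

End TrigError.

(** * Uniform approximation by Fejer sums *)

Section ContinuousRow.
Context {R : realType} {d : nat}.
Local Notation RB := (measurableTypeR R).
Local Notation row := (@row_of_tuple R d).
Implicit Types (u : 'rV[R]_d -> R) (e r : R).

Lemma rV_continuous_eps u (x : 'rV[R]_d) (e : R) : continuous u -> 0 < e ->
  exists2 r, 0 < r & forall y : 'rV[R]_d, (forall j, `|x ord0 j - y ord0 j| < r) -> `|u x - u y| < e.
Proof.
move=> cu e0.
have /(cu x)/nbhs_ballP[r /= r0 h] : nbhs (u x) (ball (u x) e) by exact: nbhsx_ballx.
exists r => // y hy.
suff : ball x r y by move=> /h; rewrite /= -ball_normE.
by split => // i j; rewrite (ord1 i) -ball_normE /=.
Qed.

(** The floor vector has countably many values, and each cell is a finite intersection of half-open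
    slabs; hence [H] can be arbitrary. *)
Lemma measurable_floor_row (c : R) (H : 'rV[int]_d -> R) :
  measurable_fun setT (fun t : d.-tuple RB => H (map_mx (fun r => Num.floor (c * r)) (row t))).
Proof.
move=> _ Y mY; rewrite setTI.
pose F (z : 'rV[int]_d) := [set t : d.-tuple RB | H z \in Y /\ forall j, Num.floor (c * tnth t j) = z ord0 j].
have -> : (fun t : d.-tuple RB => H (map_mx (fun r => Num.floor (c * r)) (row t))) @^-1` Y =
    \bigcup_z F z.
  apply/seteqP; split => t /=.
    move=> Yt; exists (map_mx (fun r => Num.floor (c * r)) (row t)) => //; split; first by rewrite inE.
    by move=> j; rewrite !mxE.
  move=> [z _ [+ hz]]; rewrite inE.
  suff -> : map_mx (fun r => Num.floor (c * r)) (row t) = z by [].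
  by apply/rowP => j; rewrite !mxE hz.
apply: (countable_bigcupT_measurable (countableP _)) => z.
have [Hz|Hz] := boolP (H z \in Y); last first.
  by rewrite (_ : F z = set0) //; apply/seteqP; split => // t [] /=; rewrite (negbTE Hz).
rewrite (_ : F z = \bigcap_(j in [set: 'I_d]) ((fun t : d.-tuple RB => c * tnth t j) @^-1`
    `[(z ord0 j)%:~R, (z ord0 j + 1)%:~R[)).
  apply: fin_bigcap_measurable; first exact: finite_finset.
  move=> j _; rewrite -[X in measurable X]setTI.
  have : measurable_fun setT (fun t : d.-tuple RB => c * tnth t j : RB).
    by apply: measurable_funM; [exact: measurable_cst|exact: measurable_tnth].
  apply => //.
apply/seteqP; split => t.
  move=> [_ h] j _ /=; rewrite in_itv /= -floor_eq; exact/eqP/h.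
move=> h; split => // j; apply/eqP; rewrite floor_eq.
by have := h j I; rewrite /= in_itv.
Qed.

(** The sigma-algebra on tuples is generated by the coordinates, so a continuous function is written
    as the pointwise limit of its step functions on grids of mesh 1/(n+1). *)
Lemma measurable_continuous_row u : continuous u ->
  measurable_fun setT (fun t : d.-tuple RB => u (row t)).
Proof.
move=> cu.
pose s (n : nat) (t : d.-tuple RB) : R :=
  u (\row_j (((map_mx (fun r => Num.floor (n.+1%:R * r)) (row t)) ord0 j)%:~R / n.+1%:R)).
apply: (@measurable_fun_cvg _ _ _ _ s) => // [n|t _].
  exact: (@measurable_floor_row n.+1%:R (fun z => u (\row_j ((z ord0 j)%:~R / n.+1%:R)))).
apply/cvgrPdist_lt => e e0.
have [r r0 h] := rV_continuous_eps (row t) cu e0.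
near=> n; apply: h => j; rewrite !mxE.
set y := tnth t j.
have n0 : 0 < n.+1%:R :> R by rewrite ltr0n.
have -> : y - (Num.floor (n.+1%:R * y))%:~R / n.+1%:R =
  (n.+1%:R * y - (Num.floor (n.+1%:R * y))%:~R) / n.+1%:R by field.
rewrite normrM normfV (gtr0_norm n0) ltr_pdivrMr//.
have /andP[f1 f2] := floor_itv (n.+1%:R * y); rewrite intrD in f2.
rewrite ger0_norm ?subr_ge0//.
apply: (@le_lt_trans _ _ 1); first lra.
rewrite -ltr_pdivrMr// div1r.
by near: n; exact: (near_infty_natSinv_lt (PosNum r0)).
Unshelve. all: by end_near. Qed.

End ContinuousRow.

(** * Periodic continuous functions and Korovkin's inequality *)

Section Periodic.
Context {R : realType} {d : nat}.
Local Notation RB := (measurableTypeR R).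
Local Notation row := (@row_of_tuple R d).

Definition periodic_row {T : Type} (g : 'rV[R]_d -> T) :=
  forall x j, g (x + delta_mx ord0 j) = g x.

Lemma periodic_int {T : Type} (g : 'rV[R]_d -> T) x (z : 'rV[int]_d) :
  periodic_row g -> g (x + map_mx intr z) = g x.
Proof.
move=> pg.
have pn j (n : nat) y : g (y + n%:R *: delta_mx ord0 j) = g y.
  elim: n y => [|n ih] y; first by rewrite scale0r addr0.
  by rewrite -natr1 scalerDl scale1r addrA pg ih.
have pz j (m : int) y : g (y + m%:~R *: delta_mx ord0 j) = g y.
  case: m => n; first exact: pn.
  rewrite NegzE mulrNz scaleNr -[LHS](pn j n.+1).
  by rewrite subrK.
have -> : map_mx intr z = \sum_j (z ord0 j)%:~R *: delta_mx ord0 j :> 'rV[R]_d.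
  rewrite [LHS]matrix_sum_delta big_ord1; apply: eq_bigr => j _.
  by rewrite mxE.
elim: (index_enum _) x => [|j s ih] x; first by rewrite big_nil addr0.
by rewrite big_cons addrA ih pz.
Qed.

Variable u : 'rV[R]_d -> R.
Hypothesis cu : continuous u.
Hypothesis pu : periodic_row u.

(** An integer translation moves any point into the compact cube [0,1]^d. *)
Lemma periodic_bounded : exists B : R, forall x, `|u x| <= B.
Proof.
pose K := [set v : 'rV[R]_d | forall i, `[0:R, 1]%classic (v ord0 i)].
have cK : compact K .
  have := @rV_compact _ _ _ (fun _ : 'I_d => @segment_compact R 0 1).
  exact.
have /compact_bounded[B [_ hB]] : compact (u @` K).
  by apply: continuous_compact => //; exact: continuous_subspaceT.
exists (B + 1) => x.
pose z : 'rV[int]_d := map_mx (fun r => - Num.floor r) x.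
rewrite -(periodic_int x z pu).
apply: (hB (B + 1)); first by rewrite ltrDl.
exists (x + map_mx intr z) => // i; rewrite /= in_itv /= !mxE mulrNz.
by have /andP[] := floor_itv (x ord0 i); rewrite intrD; lra.
Qed.

Lemma floor_half_dist (w : R) : `|w - (Num.floor (w + 2^-1))%:~R| <= 2^-1.
Proof.
have /andP[] := floor_itv (w + 2^-1); rewrite intrD ler_norml.
move: (Num.floor _)%:~R => f; lra.
Qed.

(* Korovkin's argument: away from x modulo 1 some 1 - cos is bounded below. *)
Lemma korovkin_bound x (e : R) : 0 < e -> exists2 C : R, 0 <= C &
  forall y, `|u y - u x| <= e + C * \sum_j (1 - cos (2 * pi * (x ord0 j - y ord0 j))).
Proof.
move=> e0.
have [B hB] := periodic_bounded.
have B0 : 0 <= B by exact: le_trans (normr_ge0 _) (hB 0).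
have [r0 r00 h] := rV_continuous_eps x cu e0.
(* The cap 1/2 keeps 2 pi r in [0, pi], where the cosine decreases. *)
pose r := Num.min r0 2^-1.
have rr0 : r <= r0 by rewrite ge_min lexx.
have r2 : r <= 2^-1 by rewrite ge_min lexx orbT.
have rp : 0 < r by rewrite lt_min r00 invr_gt0 ltr0n.
have ipi : 0 < pi :> R := pi_gt0 R.
have c1 : cos (2 * pi * r) < 1.
  rewrite -[X in _ < X]cos0 ltr_cos ?in_itv/= ?lexx ?pi_ge0//.
  - by rewrite !mulr_gt0.
  - by apply/andP; split; nra.
have c0 : 0 < 1 - cos (2 * pi * r) by rewrite subr_gt0.
have ge0 y : 0 <= \sum_j (1 - cos (2 * pi * (x ord0 j - y ord0 j))).
  by apply: sumr_ge0 => j _; rewrite subr_ge0 cos_le1.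
(* If some coordinates of x and y are at distance at least r modulo 1, then |u y - u x| <= 2B, while
   the sum is at least 1 - cos (2 pi r). *)
exists (2 * B / (1 - cos (2 * pi * r))); first by rewrite divr_ge0 ?mulr_ge0// ltW.
move=> y.
(* Rounding to the nearest integer: after translating [y] by [z] all differences [t j] lie in
   [-1/2, 1/2]. *)
pose z : 'rV[int]_d := \row_j Num.floor (x ord0 j - y ord0 j + 2^-1).
pose t j := x ord0 j - (y + map_mx intr z) ord0 j.
have tE j : t j = x ord0 j - y ord0 j - (z ord0 j)%:~R by rewrite /t !mxE opprD addrA.
have t2 j : `|t j| <= 2^-1.
  by rewrite tE mxE floor_half_dist.
have ct j : cos (2 * pi * (x ord0 j - y ord0 j)) = cos (2 * pi * `|t j|).
  have -> : x ord0 j - y ord0 j = t j + (z ord0 j)%:~R by rewrite tE subrK.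
  rewrite mulrDr cosD; have [-> ->] := @cos_sin_int R (z ord0 j).
  rewrite mulr1 mulr0 subr0 -[LHS]cos_norm normrM ger0_norm// mulr_ge0 ?pi_ge0//.
have [hr|] := boolP [forall j, `|t j| < r].
  rewrite -(periodic_int y z pu) distrC.
  apply: (@le_trans _ _ e); last by rewrite lerDl mulr_ge0// divr_ge0 ?mulr_ge0// ltW.
  by apply/ltW/h => j; exact: lt_le_trans (forallP hr j) rr0.
rewrite negb_forall => /existsP[j]; rewrite -leNgt => rj.
apply: (@le_trans _ _ (2 * B)).
  by rewrite (le_trans (ler_normB _ _))// mulr_natl mulr2n lerD.
rewrite -[leLHS]add0r lerD//; first exact: ltW.
rewrite mulrAC ler_pdivlMr// ler_wpM2l ?mulr_ge0//.
rewrite (bigD1 j)//= ct.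
apply: (@le_trans _ _ (1 - cos (2 * pi * `|t j|))).
  rewrite lerD2l lerN2.
  have [->//|ne] := eqVneq r `|t j|.
  have lt : r < `|t j| by rewrite lt_neqAle ne.
  have := t2 j => tj2.
  apply: ltW; rewrite ltr_cos ?in_itv /=; [|apply/andP; split; nra|apply/andP; split; nra].
  by rewrite ltr_pM2l// mulr_gt0.
by rewrite lerDl sumr_ge0// => i _; rewrite subr_ge0 cos_le1.
Qed.

End Periodic.

(** * The Fejer kernel and its Fourier weights *)

Section Fejer.
Context {R : realType} {d : nat}.
Local Notation RB := (measurableTypeR R).
Local Notation row := (@row_of_tuple R d).
Variable n : nat.
Local Notation idx := {ffun 'I_d -> 'I_n.+1}.

Let v (a : idx) : 'rV[int]_d := \row_j (a j : nat)%:Z.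

(* The kernel is the squared modulus of the Dirichlet sum over {0, ..., n}^d,
   expanded as a sum over pairs of frequencies. *)
Definition fejer_freq (p : idx * idx) : 'rV[int]_d := v p.1 - v p.2.
Local Notation q := fejer_freq.

(** Equal to the product over j of max(0, 1 - |k_j|/(n+1)). Written as a count of pairs, its bounds
    become comparisons of cardinalities. *)
Definition fejer_weight (k : 'rV[int]_d) : R :=
  #|[set p | q p == k]%SET|%:R / (n.+1 ^ d)%:R.
Local Notation weight := fejer_weight.

Let nd0 : (n.+1 ^ d)%:R != 0 :> R.
Proof. by rewrite pnatr_eq0 -lt0n expn_gt0. Qed.

Let v_inj : injective v.
Proof.
move=> a b /rowP ab; apply/ffunP => j; apply/val_inj.
by have := ab j; rewrite !mxE => -[].
Qed.

Lemma fejer_weight_ge0 k : 0 <= weight k.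
Proof. by rewrite divr_ge0. Qed.

(** A pair with prescribed difference is determined by its first component. *)
Lemma fejer_weight_le1 k : weight k <= 1.
Proof.
rewrite ler_pdivrMr ?lt0r ?nd0//= mul1r ler_nat.
rewrite -(card_in_imset (f := fst)) => [|[a b] [a' b']]; last first.
  rewrite !inE /fejer_freq /= => /eqP h /eqP h' aa'; rewrite -aa' in h' *.
  by congr pair; apply: v_inj; apply: oppr_inj; apply: (addrI (v a)); rewrite h h'.
by rewrite (leq_trans (max_card _))// card_ffun !card_ord.
Qed.

Lemma fejer_weight0 : weight 0 = 1.
Proof.
apply/eqP; rewrite eq_le fejer_weight_le1 /=.
rewrite ler_pdivlMr ?lt0r ?nd0//= mul1r ler_nat.
rewrite -[X in (X ^ d)%N]card_ord -[X in (_ ^ X)%N]card_ord -card_ffun.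
rewrite -cardsT -(card_imset (f := fun a : idx => (a, a))); last by move=> a b [].
apply: subset_leq_card; apply/fintype.subsetP => p /imsetP[a _ ->].
by rewrite inE /fejer_freq subrr.
Qed.

(** The pairs (a, a + e_j) exist for all a except those with a_j = n, which are at most a fraction
    1/(n+1) of the box. *)
Lemma fejer_weight_delta (j : 'I_d) :
  1 - n.+1%:R^-1 <= weight (- delta_mx ord0 j).
Proof.
pose S := [set p | q p == - delta_mx ord0 j]%SET.
pose top := [set a : idx | a j == ord_max]%SET.
have cT : #|[set: idx]%SET| = (n.+1 ^ d)%N by rewrite cardsT card_ffun !card_ord.
have c1 : (#|~: top| <= #|S|)%N.
  pose inc (a : idx) : idx := [ffun t => if t == j then inord (a t).+1 else a t].
  rewrite -(card_imset (f := fun a : idx => (a, inc a))); last by move=> a b [].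
  apply: subset_leq_card; apply/fintype.subsetP => p /imsetP[a]; rewrite !inE => aj ->.
  apply/eqP/rowP => t; rewrite !mxE !ffunE /=.
  case: (eqVneq t j) => [->|_]; last by rewrite subrr oppr0.
  have lt : ((a j).+1 < n.+1)%N by rewrite ltn_neqAle ltn_ord andbT; apply: contra aj => /eqP[e]; apply/eqP/val_inj.
  by rewrite inordK// -(addn1 (a j)) PoszD opprD addrA subrr add0r.
have c2 : (#|top| * n.+1 <= n.+1 ^ d)%N.
  have -> : (#|top| * n.+1)%N = #|finset.setX top [set: 'I_n.+1]%SET| by rewrite cardsX cardsT card_ord.
  rewrite -cT.
  pose sub (p : idx * 'I_n.+1) : idx := [ffun t => if t == j then p.2 else p.1 t].
  rewrite -(card_in_imset (f := sub)); first exact: subset_leq_card (finset.subsetT _).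
  move=> [a i] [b i'] /=; rewrite !inE /= !andbT => /eqP aj /eqP bj /ffunP ab.
  have := ab j; rewrite !ffunE eqxx /= => ->; congr pair.
  apply/ffunP => t; have := ab t; rewrite !ffunE /=; case: eqVneq => [->|_]//.
  by rewrite aj bj.
have c3 : (n.+1 ^ d = #|top| + #|~: top|)%N by rewrite -cT cardsT -(cardsC top).
rewrite ler_pdivlMr ?lt0r ?nd0//= mulrBl mul1r lerBlDr.
apply: (@le_trans _ _ (#|S| + #|top|)%N%:R); first by rewrite ler_nat c3 addnC leq_add2r.
rewrite natrD lerD2l mulrC ler_pdivlMr ?ltr0n// -natrM ler_nat //.
Qed.

(** Grouping pairs by their difference gives a list without repetition, as Parseval's identity
    requires; the multiplicities become weights. *)
Lemma sum_fejer_freq (V : nmodType) (g : 'rV[int]_d -> V) :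
  \sum_p g (q p) = \sum_(k <- undup [seq q p | p <- enum {: idx * idx}]) g k *+ #|[set p | q p == k]%SET|.
Proof.
set K := undup _.
have qK p : q p \in K by rewrite mem_undup map_f// mem_enum.
transitivity (\sum_p \sum_(k <- K) if q p == k then g k else 0).
  apply: eq_bigr => p _; rewrite (bigD1_seq (q p)) ?undup_uniq//= eqxx big1 ?addr0//.
  by move=> k; rewrite eq_sym => /negbTE ->.
rewrite exchange_big /=; apply: eq_bigr => k _.
rewrite -big_mkcond /= sumr_const; congr (_ *+ _).
by apply: eq_card => p; rewrite !inE.
Qed.

Definition fejer_kernel (z : 'rV[R]_d) : R :=
  sqnorm (\sum_(a : idx) cexp_char (v a) z) / (n.+1 ^ d)%:R.
Local Notation ker := fejer_kernel.

Lemma fejer_kernel_ge0 z : 0 <= ker z.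
Proof. by rewrite divr_ge0 ?sqnorm_ge0. Qed.

Lemma fejer_kernelE z : (ker z)%:C%C = ((n.+1 ^ d)%:R^-1 : R)%:C%C * \sum_p cexp_char (q p) z.
Proof.
rewrite /ker rmorphM mulrC; congr (_ * _).
set w := \sum_a _.
have -> : \sum_p cexp_char (q p) z = w * w^*%C.
  rewrite rmorph_sum /= big_distrl /=.
  under [RHS]eq_bigr do rewrite big_distrr /=.
  rewrite pair_bigA /=; apply: eq_bigr => p _.
  by rewrite /fejer_freq cexpD cexpN.
by rewrite -sqr_normc sqnormE -add_Re2_Im2.
Qed.

Let cbmeas_shift (m : 'rV[int]_d) (x : 'rV[R]_d) : cbmeas (fun y : d.-tuple RB => cexp_char m (x - row y)).
Proof.
under eq_fun do rewrite cexpDx cexpNx.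
by apply: cbmeasM; [exact: cbmeas_cst|exact: cbmeas_char].
Qed.

Lemma cbmeas_fejer_kernel (x : 'rV[R]_d) : cbmeas (fun y : d.-tuple RB => (ker (x - row y))%:C%C).
Proof.
under eq_fun do rewrite fejer_kernelE.
by apply: cbmeasM; [exact: cbmeas_cst|apply: cbmeas_sum => p; exact: cbmeas_shift].
Qed.

Lemma Cexpect_shift (m : 'rV[int]_d) (x : 'rV[R]_d) :
  Cexpect (cube R d) (fun y => cexp_char m (x - row y)) = (m == 0)%:R.
Proof.
under eq_Cexpect do rewrite cexpDx cexpNx.
rewrite CexpectZ; last exact: cbmeas_char.
rewrite Cexpect_char oppr_eq0; case: eqVneq => [->|_]; last by rewrite mulr0.
by rewrite cexp0 mulr1.
Qed.

(** Used for two frequencies: 0 gives the total mass 1, and a unit vector gives the cosine moment of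
    Korovkin's argument. *)
Lemma Cexpect_fejer_kernel (k : 'rV[int]_d) (x : 'rV[R]_d) :
  Cexpect (cube R d) (fun y => (ker (x - row y))%:C%C * cexp_char k (x - row y)) = (weight (- k))%:C%C.
Proof.
rewrite (@eq_Cexpect _ _ _ _ _ (fun y => ((n.+1 ^ d)%:R^-1 : R)%:C%C * \sum_p cexp_char (q p + k) (x - row y))); last first.
  move=> y; rewrite fejer_kernelE -mulrA big_distrl /=; congr (_ * _).
  by apply: eq_bigr => p _; rewrite cexpD.
rewrite CexpectZ; last by apply: cbmeas_sum => p; exact: cbmeas_shift.
rewrite Cexpect_sum; last by move=> p; exact: cbmeas_shift.
under eq_bigr do rewrite Cexpect_shift addr_eq0.
rewrite /fejer_weight mulrC rmorphM; congr (_ * _).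
rewrite -natr_sum rmorph_nat; congr (_%:R).
by rewrite -big_mkcond sum1_card cardsE.
Qed.

Definition fejer (f : 'rV[R]_d -> R[i]) (x : 'rV[R]_d) : R[i] :=
  \sum_(k <- undup [seq q p | p <- enum {: idx * idx}]) ((weight k)%:C%C * fourier f k) * cexp_char k x.

(** The convolution form, which yields convergence; the definition exhibits the coefficients
    instead, as Parseval's identity needs them. *)
Lemma fejerE (f : 'rV[R]_d -> R[i]) (x : 'rV[R]_d) : cbmeas (fun y => f (row y)) ->
  fejer f x = Cexpect (cube R d) (fun y => f (row y) * (ker (x - row y))%:C%C).
Proof.
move=> bf.
have bk k : cbmeas (fun y : d.-tuple RB => f (row y) * cexp_char k (x - row y)).
  by apply: cbmeasM => //; exact: cbmeas_shift.
rewrite (@eq_Cexpect _ _ _ _ _ (fun y => ((n.+1 ^ d)%:R^-1 : R)%:C%C * \sum_p (f (row y) * cexp_char (q p) (x - row y)))); last first.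
  by move=> y; rewrite fejer_kernelE mulrCA -big_distrr.
rewrite CexpectZ; last by apply: cbmeas_sum => p; exact: bk.
rewrite Cexpect_sum; last by move=> p; exact: bk.
pose g k := fourier f k * cexp_char k x.
transitivity (((n.+1 ^ d)%:R^-1 : R)%:C%C * \sum_p g (q p)).
  rewrite sum_fejer_freq big_distrr; apply: eq_bigr => k _ /=.
  rewrite /g /fejer_weight rmorphM rmorph_nat /= -mulr_natl; ring.
congr (_ * _); apply: eq_bigr => p _; rewrite /g mulrC.
rewrite -CexpectZ; last by apply: cbmeasM => //; exact: cbmeas_char.
apply: eq_Cexpect => y; rewrite cexpDx cexpNx; ring.
Qed.

Lemma bmeas_fejer_kernel (x : 'rV[R]_d) : bmeas (fun y : d.-tuple RB => ker (x - row y)).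
Proof. exact: (cbmeas_fejer_kernel x).1. Qed.

Lemma expect_fejer_kernel (x : 'rV[R]_d) : \int[cube R d]_y ker (x - row y) = 1.
Proof.
have /(congr1 (@complex.Re R)) := Cexpect_fejer_kernel 0 x.
rewrite oppr0 fejer_weight0 => h; transitivity (complex.Re (1 : R)%:C%C) => //.
by rewrite -h; apply: eq_Rintegral => y _; rewrite cexp0 mulr1.
Qed.

Lemma cexp_delta (j : 'I_d) (z : 'rV[R]_d) : cexp_char (delta_mx ord0 j) z = expi (2 * pi * z ord0 j).
Proof.
rewrite -[LHS]/(expi _); congr (expi (_ * _)).
rewrite (bigD1 j)//= big1 ?addr0; first by rewrite mxE !eqxx mul1r.
by move=> i /negbTE ij; rewrite mxE ij mul0r.
Qed.

Lemma bmeas_cos_shift (x : 'rV[R]_d) (j : 'I_d) :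
  bmeas (fun y : d.-tuple RB => cos (2 * pi * (x ord0 j - row y ord0 j))).
Proof.
apply: eq_bmeas (cbmeas_shift (delta_mx ord0 j) x).1 => y.
by rewrite cexp_delta /= !mxE.
Qed.

Lemma expect_fejer_kernel_cos (x : 'rV[R]_d) (j : 'I_d) :
  1 - n.+1%:R^-1 <= \int[cube R d]_y (ker (x - row y) * cos (2 * pi * (x ord0 j - row y ord0 j))).
Proof.
have /(congr1 (@complex.Re R)) := Cexpect_fejer_kernel (delta_mx ord0 j) x.
move=> h; apply: (le_trans (fejer_weight_delta j)).
rewrite [leLHS](_ : _ = complex.Re (weight (- delta_mx ord0 j))%:C%C)// -h le_eqVlt; apply/orP; left; apply/eqP.
by apply: eq_Rintegral => y _; rewrite complexM cexp_delta /= mul0r subr0 !mxE.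
Qed.

End Fejer.

(** * Pointwise convergence of Fejer sums *)

Section FejerConvergence.
Context {R : realType} {d : nat}.
Local Notation RB := (measurableTypeR R).
Local Notation row := (@row_of_tuple R d).

(** Korovkin's inequality is integrated against the kernel: the mass is 1 and each 1 - cos has
    integral at most 1/(n+1), whence a factor d. The constant may depend on [x]. *)
Lemma fejer_close (u : 'rV[R]_d -> R) x (e : R) : continuous u -> periodic_row u -> 0 < e ->
  exists2 C : R, 0 <= C & forall n,
    `|\int[cube R d]_y (u (row y) * fejer_kernel n (x - row y)) - u x| <= e + C / n.+1%:R.
Proof.
move=> cu pu e0.
have [C C0 hC] := korovkin_bound cu pu x e0.
have [B hB] := periodic_bounded cu pu.
have bu : bmeas (fun y : d.-tuple RB => u (row y)).
  by split; [exact: measurable_continuous_row|exists B => y].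
exists (C * d%:R) => [|n]; first by rewrite mulr_ge0.
have bk := bmeas_fejer_kernel n x.
set ker := fun y : d.-tuple RB => fejer_kernel n (x - row y) in bk *.
have ker0 y : 0 <= ker y by exact: fejer_kernel_ge0.
have buk : bmeas (fun y => u (row y) * ker y) by exact: bmeasM.
have bcst c : bmeas (fun _ : d.-tuple RB => c : R) := bmeas_cst c.
pose D j (y : d.-tuple RB) := 1 - cos (2 * pi * (x ord0 j - row y ord0 j)).
have bD j : bmeas (D j) by apply: bmeasD => //; exact/bmeasN/bmeas_cos_shift.
have bkD j : bmeas (fun y => ker y * D j y) by exact: bmeasM.
have -> : \int[cube R d]_y (u (row y) * ker y) - u x = \int[cube R d]_y (u (row y) * ker y + (- u x) * ker y).
  rewrite expectD//; last exact: bmeasM.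
  by rewrite expectZ// expect_fejer_kernel mulr1.
have bd : bmeas (fun y => u (row y) * ker y + - u x * ker y) by apply: bmeasD => //; exact: bmeasM.
apply: (le_trans (expect_abs _ bd)).
apply: (@le_trans _ _ (\int[cube R d]_y (e * ker y + C * \sum_j ker y * D j y))).
  apply: expect_le.
  - split; first exact: measurableT_comp bd.1.
    by have [B' hB'] := bd.2; exists B' => y; rewrite normr_id.
  - by apply: bmeasD; apply: bmeasM => //; apply: bmeas_sum.
  - move=> y; rewrite -mulrDl normrM (ger0_norm (ker0 y)) -big_distrr /= (mulrCA C) (mulrC e) -mulrDr mulrC.
    by rewrite ler_wpM2l.
rewrite expectD; [|exact: bmeasM|by apply: bmeasM => //; exact: bmeas_sum].
rewrite !expectZ//; last exact: bmeas_sum.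
rewrite expect_fejer_kernel mulr1 lerD2l expect_sum// -mulrA ler_wpM2l//.
rewrite mulr_natl -[in leRHS](card_ord d) -sumr_const; apply: ler_sum => j _.
have -> : \int[cube R d]_y (ker y * D j y) = \int[cube R d]_y ker y - \int[cube R d]_y (ker y * cos (2 * pi * (x ord0 j - row y ord0 j))).
  rewrite -expectN; last by apply: bmeasM => //; exact: bmeas_cos_shift.
  rewrite -expectD//; last by apply/bmeasN/bmeasM => //; exact: bmeas_cos_shift.
  by congr Rintegral; apply/funext => y; rewrite mulrBr mulr1.
rewrite expect_fejer_kernel lerBlDr -lerBlDl.
exact: expect_fejer_kernel_cos.
Qed.

Lemma fejer_close_cvg (u : 'rV[R]_d -> R) x : continuous u -> periodic_row u ->
  (fun n => \int[cube R d]_y (u (row y) * fejer_kernel n (x - row y))) @ \oo --> u x.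
Proof.
move=> cu pu; apply/cvgrPdist_le => e e0.
have e20 : 0 < e / 2 by rewrite divr_gt0.
have [C C0 hC] := fejer_close x cu pu e20.
have eC0 : 0 < e / 2 / (C + 1) by rewrite divr_gt0// ltr_wpDl.
near=> n.
rewrite distrC (le_trans (hC n))// [leRHS](splitr e) lerD2l.
have : n.+1%:R^-1 < e / 2 / (C + 1).
  by near: n; exact: (near_infty_natSinv_lt (PosNum eC0)).
rewrite ltr_pdivlMr ?ltr_wpDl// => /ltW; apply: le_trans.
by rewrite mulrC ler_wpM2l ?invr_ge0// lerDl.
Unshelve. all: by end_near. Qed.

(** Continuity of [f] refers to the complex norm, for which both parts are 1-Lipschitz. *)
Lemma continuous_ReIm (f : 'rV[R]_d -> R[i]) : continuous (f : 'rV[R]_d -> R[i]^o) ->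
  continuous (fun x => complex.Re (f x)) /\ continuous (fun x => complex.Im (f x)).
Proof.
move=> cf.
have h (p : R[i] -> R) : (forall z w, `|p z - p w| <= Normc.normc (z - w)) ->
    continuous (fun x => p (f x)).
  move=> hp x; apply/(@cvgrPdist_lt _ _ _ _ (nbhs_filter (x : 'rV[R]_d))) => e e0.
  have e0' : 0 < e%:C%C :> R[i] by rewrite ltcR.
  have /(@cvgrPdist_lt _ _ _ _ (nbhs_filter (x : 'rV[R]_d)))/(_ _ e0') := cf x.
  apply: filterS => y; rewrite normc_def ltcR => /(le_lt_trans _); apply.
  by have := hp (f x) (f y); case: (f x - f y).
split; apply: h => -[a b] [a' b'] /=.
  by rewrite -sqrtr_sqr ler_wsqrtr// lerDl sqr_ge0.
by rewrite -sqrtr_sqr ler_wsqrtr// lerDr sqr_ge0.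
Qed.

Variable f : 'rV[R]_d -> R[i].
Hypothesis cf : continuous (f : 'rV[R]_d -> R[i]^o).
Hypothesis pf : periodic_row f.

Lemma cbmeas_continuous : cbmeas (fun y : d.-tuple RB => f (row y)).
Proof.
have [cR cI] := continuous_ReIm cf.
have [BR hR] := periodic_bounded cR (fun x j => congr1 (@complex.Re R) (pf x j)).
have [BI hI] := periodic_bounded cI (fun x j => congr1 (@complex.Im R) (pf x j)).
split; split.
- exact: (measurable_continuous_row cR).
- by exists BR => y.
- exact: (measurable_continuous_row cI).
- by exists BI => y.
Qed.

Lemma fejer_cvg x :
  (fun n => complex.Re (fejer n f x)) @ \oo --> complex.Re (f x) /\
  (fun n => complex.Im (fejer n f x)) @ \oo --> complex.Im (f x).
Proof.
have [cR cI] := continuous_ReIm cf.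
have E n := @fejerE R d n f x cbmeas_continuous.
split.
- rewrite (_ : (fun n => _) = (fun n => \int[cube R d]_y (complex.Re (f (row y)) * fejer_kernel n (x - row y)))).
    exact: (@fejer_close_cvg (fun x => complex.Re (f x)) x cR (fun x j => congr1 (@complex.Re R) (pf x j))).
  apply/funext => n; rewrite E; apply: eq_Rintegral => y _.
  by rewrite complexM /= mulr0 subr0.
- rewrite (_ : (fun n => _) = (fun n => \int[cube R d]_y (complex.Im (f (row y)) * fejer_kernel n (x - row y)))).
    exact: (@fejer_close_cvg (fun x => complex.Im (f x)) x cI (fun x j => congr1 (@complex.Im R) (pf x j))).
  apply/funext => n; rewrite E; apply: eq_Rintegral => y _.
  by rewrite complexM /= mulr0 add0r.
Qed.

End FejerConvergence.

(** * The worst-case error *)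

Section NonnegIntegral.
Context {disp : measure_display} {T : measurableType disp} {R : realType}.
Variable mu : {measure set T -> \bar R}.
Local Open Scope ereal_scope.

(* The integral of a nonnegative function is a supremum over simple functions,
   so that monotonicity does not require measurability. *)
Lemma ge0_integral_mono (f g : T -> \bar R) :
  (forall x, 0 <= f x) -> (forall x, f x <= g x) -> \int[mu]_x f x <= \int[mu]_x g x.
Proof.
move=> f0 fg; have g0 x : 0 <= g x := le_trans (f0 x) (fg x).
rewrite !ge0_integralTE//; apply: ereal_sup_le => _ [h hf <-].
exists h => // x; exact: le_trans (hf x) (fg x).
Qed.

Lemma limn_einf_le (u : (\bar R)^nat) (c : \bar R) :
  (forall n, u n <= c) -> limn_einf u <= c.
Proof.
move=> uc; rewrite limn_einf_lim; apply: lime_le; first exact: is_cvg_einfs.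
near=> n; apply: le_trans (uc n); apply: ereal_inf_lbound; exists n => //=.
Unshelve. all: by end_near. Qed.

End NonnegIntegral.

(** * Fourier coefficients outside the index set *)

Section IndexSet.
Context {R : realType} {d : nat}.
Variables (alpha : R) (gamma : {fset nat} -> R) (M : R).
Local Notation A := (korobov_index d alpha gamma M).

(** [fset_set] of an infinite set is empty, so a nonempty index set certifies that the defining set
    is finite. *)
Lemma mem_korobov_index (k : 'rV[int]_d) : (0 < #|` A|)%N ->
  (k \in A) = (korobov_r alpha gamma k <= M%:E)%E.
Proof.
rewrite /korobov_index => cA.
have fS : finite_set [set k : 'rV[int]_d | (korobov_r alpha gamma k <= M%:E)%E].
  apply: contrapT => nf; move: cA; rewrite /fset_set.
  by case: pselect => // _; rewrite cardfs0.
by rewrite in_fset_set// mem_setE.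
Qed.

Hypothesis g0 : forall u, 0 <= gamma u.

Lemma korobov_r_ge0 (k : 'rV[int]_d) : (0 <= korobov_r alpha gamma k)%E.
Proof.
rewrite /korobov_r; case: ifP => // _; rewrite lee_fin mulr_ge0 ?invr_ge0//.
by apply: prodr_ge0 => j _; rewrite powR_ge0.
Qed.

(** Outside the index set r > M, so M^2 times the sum is at most the squared norm. Frequencies of
    weight 0 do not occur in the norm and are first discarded, their coefficients being 0. *)
Lemma korobov_tail (f : 'rV[R]_d -> R[i]) (s : seq 'rV[int]_d) :
  0 < M -> (0 < #|` A|)%N -> uniq s ->
  (forall k, k \in s -> k \notin A) ->
  (forall k, gamma (coords (supp k)) = 0 -> fourier f k = 0) ->
  (korobov_norm alpha gamma f <= 1)%E ->
  \sum_(k <- s) sqnorm (fourier f k) <= M ^- 2.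
Proof.
move=> M0 cA us sA f0 nf.
pose S := [set k : 'rV[int]_d | gamma (coords (supp k)) != 0].
pose t (k : 'rV[int]_d) := (korobov_r alpha gamma k ^+ 2 * (sqnorm (fourier f k))%:E)%E.
have t0 k : (0 <= t k)%E.
  by rewrite mule_ge0 ?expe_ge0 ?korobov_r_ge0// lee_fin sqnorm_ge0.
have E1 : (\esum_(k in S) t k <= 1)%E.
  have e0 : (0 <= \esum_(k in S) t k)%E by apply: esum_ge0 => k _.
  move: nf; rewrite /korobov_norm -/S poweR12_sqrt// -[X in (_ <= X)%E](_ : sqrte 1 = 1)%E.
    by rewrite lee_sqrt.
  by rewrite /= sqrtr1.
pose s' := [seq k <- s | gamma (coords (supp k)) != 0].
have -> : \sum_(k <- s) sqnorm (fourier f k) = \sum_(k <- s') sqnorm (fourier f k).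
  rewrite big_filter [LHS](bigID [pred k | gamma (coords (supp k)) != 0]) /= [X in _ + X]big1 ?addr0//.
  by move=> k; rewrite negbK => /eqP/f0 ->; rewrite sqnormE /= expr0n addr0.
have E2 : (\sum_(k <- s') t k <= 1)%E.
  apply: le_trans E1; apply: esum_ge.
  exists [set` s'] => //; last by rewrite fsbig_seq// filter_uniq.
  split; first exact: finite_seq.
  by move=> k /=; rewrite mem_filter => /andP[].
rewrite -[leRHS]mul1r ler_pdivlMr ?exprn_gt0// -lee_fin (le_trans _ E2)//.
rewrite mulr_suml -sumEFin big_seq [leRHS]big_seq.
apply: lee_sum => k; rewrite mem_filter => /andP[gk ks].
have := sA _ ks; rewrite mem_korobov_index// -ltNge => Mr.
rewrite /t mulrC EFinM lee_wpmul2r ?lee_fin ?sqnorm_ge0//.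
move: Mr; rewrite /korobov_r (negbTE gk) lte_fin => Mr.
by rewrite -EFin_expe lee_fin ler_pXn2r ?nnegrE ?ltW// (lt_trans M0).
Qed.

End IndexSet.

(** * From trigonometric polynomials to the unit ball *)

Section WorstCaseError.
Context {R : realType} {d : nat}.
Variables (alpha : R) (gamma : {fset nat} -> R) (M : R) (ls : seq (lattice d)).
Local Notation A := (korobov_index d alpha gamma M).
Local Notation row := (@row_of_tuple R d).
Hypotheses (g0 : forall u, 0 <= gamma u) (M0 : 0 < M) (cA : (0 < #|` A|)%N).
Hypothesis ls0 : all (fun l => 0 < l.1)%N ls.
Hypothesis wd : well_defined A ls.

Let ccvg (z : nat -> R[i]) (w : R[i]) :=
  (fun n => complex.Re (z n)) @ \oo --> complex.Re w /\
  (fun n => complex.Im (z n)) @ \oo --> complex.Im w.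

Let ccvg_cst (w : R[i]) : ccvg (fun=> w) w.
Proof. by split; exact: cvg_cst. Qed.

Let ccvgD z1 z2 w1 w2 : ccvg z1 w1 -> ccvg z2 w2 -> ccvg (fun n => z1 n + z2 n) (w1 + w2).
Proof.
have ReD (z w : R[i]) : complex.Re (z + w) = complex.Re z + complex.Re w by case: z; case: w.
have ImD (z w : R[i]) : complex.Im (z + w) = complex.Im z + complex.Im w by case: z; case: w.
move=> [r1 i1] [r2 i2]; split.
- by rewrite ReD; under eq_fun do rewrite ReD; exact: cvgD.
- by rewrite ImD; under eq_fun do rewrite ImD; exact: cvgD.
Qed.

Let ccvgM z1 z2 w1 w2 : ccvg z1 w1 -> ccvg z2 w2 -> ccvg (fun n => z1 n * z2 n) (w1 * w2).
Proof.
move=> [r1 i1] [r2 i2]; rewrite complexM; split => /=.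
- under eq_fun do rewrite complexM /=.
  by apply: cvgB; apply: cvgM.
- under eq_fun do rewrite complexM /=.
  by apply: cvgD; apply: cvgM.
Qed.

Let ccvg_sum (I : Type) (s : seq I) (z : I -> nat -> R[i]) w :
  (forall i, ccvg (z i) (w i)) -> ccvg (fun n => \sum_(i <- s) z i n) (\sum_(i <- s) w i).
Proof.
move=> h; elim: s => [|i s ih].
  by under eq_fun do rewrite big_nil; rewrite big_nil; exact: ccvg_cst.
by under eq_fun do rewrite big_cons; rewrite big_cons; exact: ccvgD.
Qed.

Let ccvg_sqnorm z w : ccvg z w -> (fun n => sqnorm (z n)) @ \oo --> sqnorm w.
Proof.
move=> [r i]; rewrite sqnormE; under eq_fun do rewrite sqnormE.
by apply: cvgD; under eq_fun do rewrite expr2; rewrite expr2; apply: cvgM.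
Qed.

Variable f : 'rV[R]_d -> R[i].
Hypothesis fH : korobov_space alpha gamma f.
Hypothesis nf : (korobov_norm alpha gamma f <= 1)%E.

Let T n := fejer n f.

(** For fixed [D] and [x] the error is a polynomial expression in finitely many values of [f]. *)
Let err_cvg D x : (fun n => sqnorm (T n x - approx_mult A ls D (T n) x)) @ \oo -->
  sqnorm (f x - approx_mult A ls D f x).
Proof.
have [cf pf _ _] := fH.
have Tc y : ccvg (fun n => T n y) (f y) by exact: fejer_cvg.
apply: ccvg_sqnorm; apply: ccvgD => //.
have c1 : ccvg (fun n => approx_mult A ls D (T n) x) (approx_mult A ls D f x).
  apply: ccvg_sum => k; apply: ccvgM; last exact: ccvg_cst.
  apply: ccvgM; first exact: ccvg_cst.
  apply: ccvg_sum => l; apply: ccvgM; first exact: ccvg_cst.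
  by apply: ccvg_sum => i; apply: ccvgM => //; exact: ccvg_cst.
have := ccvgM (ccvg_cst (-1)) c1; rewrite mulN1r.
by under eq_fun do rewrite mulN1r.
Qed.

Let c (n : nat) k : R[i] := (@fejer_weight R d n k)%:C%C * fourier f k.
Let K n := undup [seq fejer_freq p | p <- enum {: {ffun 'I_d -> 'I_n.+1} * {ffun 'I_d -> 'I_n.+1}}].
Let K' n := [seq h <- K n | h \notin A].
Let G n (D : 'rV[R]_d) : R := \sum_(h <- K' n) sqnorm (c n h) +
    \sum_(k <- A) sqnorm (\sum_(h <- K' n) (c n h * (alias_coef A ls h k)%:C%C) * cexp_char h D).

Let coef_le n : \sum_(h <- K' n) sqnorm (c n h) <= M ^- 2.
Proof.
have [_ _ f0 _] := fH.
apply: (@le_trans _ _ (\sum_(h <- K' n) sqnorm (fourier f h))).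
  apply: ler_sum => h _; rewrite sqnormM sqnormR ler_piMl ?sqnorm_ge0//.
  by rewrite expr_le1 ?fejer_weight_ge0 ?fejer_weight_le1.
have KA k : k \in K' n -> k \notin A by rewrite mem_filter => /andP[].
exact: (korobov_tail g0 M0 cA (filter_uniq _ (undup_uniq _)) KA f0 nf).
Qed.

(** Fatou's lemma in [x] bounds the inner integral by the lower limit of the explicit functions
    [G n]. These are measurable in the shift, so that it applies once more. *)
Lemma mean_sq_error_le :
  (cube_integral (fun D => cube_integral (fun x =>
     (Normc.normc (f x - approx_mult A ls D f x) ^+ 2)%:E)) <=
   ((1 + (size ls)%:R) * M ^- 2)%:E)%E.
Proof.
have uK n : uniq (K n) by exact: undup_uniq.
have bG n : bmeas (fun D : d.-tuple (measurableTypeR R) => G n (row D)).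
  exact: (@bmeas_trig_error_inner R d A ls (K n) (c n)).
have G0 n D : 0 <= G n D.
  by apply: addr_ge0; apply: sumr_ge0 => k _; exact: sqnorm_ge0.
have inner D : (cube_integral (fun x =>
     (Normc.normc (f x - approx_mult A ls D f x) ^+ 2)%:E) <= limn_einf (fun n => (G n D)%:E))%E.
  have bE n : bmeas (fun x => sqnorm (T n (row x) - approx_mult A ls D (T n) (row x))).
    exact: (@bmeas_trig_error R d A ls ls0 wd (K n) (c n) D).
  have mE n : measurable_fun setT (fun x => (sqnorm (T n (row x) - approx_mult A ls D (T n) (row x)))%:E).
    by apply/measurable_EFinP; exact: (bE n).1.
  have E0 n x : setT x -> (0 <= (sqnorm (T n (row x) - approx_mult A ls D (T n) (row x)))%:E)%E.
    by move=> _; rewrite lee_fin sqnorm_ge0.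
  have := fatou (cube R d) measurableT mE E0.
  have -> : (fun n => \int[cube R d]_x (sqnorm (T n (row x) - approx_mult A ls D (T n) (row x)))%:E)%E
      = (fun n => (G n D)%:E).
    apply/funext => n; rewrite EFin_expect//; congr EFin.
    exact: (@trig_error_inner R d A ls ls0 wd (K n) (c n) (uK n) D).
  apply: le_trans.
  apply: ge0_integral_mono => x; first by rewrite lee_fin sqr_ge0.
  rewrite le_eqVlt; apply/orP; left; apply/eqP/esym.
  apply: (cvg_limn_einf_sup _).1.
  by apply: cvg_EFin; [near=> n|exact: err_cvg].
apply: (@le_trans _ _ (\int[cube R d]_D limn_einf (fun n => (G n (row D))%:E))%E).
  apply: ge0_integral_mono => D; last exact: inner.
  by apply: integral_ge0 => x _; rewrite lee_fin sqr_ge0.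
apply: le_trans (fatou (cube R d) measurableT _ _) _.
- by move=> n; apply/measurable_EFinP; exact: (bG n).1.
- by move=> n x _; rewrite lee_fin.
apply: limn_einf_le => n; rewrite EFin_expect// lee_fin.
apply: (le_trans (@trig_error_le R d A ls (K n) (c n) (uK n))).
by rewrite ler_wpM2l ?addr_ge0// coef_le.
Unshelve. all: by end_near. Qed.

End WorstCaseError.

Lemma err2_rand_le {R : realType} {d : nat} (alpha : R) (gamma : {fset nat} -> R) (M : R)
    (ls : seq (lattice d)) : let A := korobov_index d alpha gamma M in
  (forall u, 0 <= gamma u) -> 0 < M -> (0 < #|` A|)%N ->
  all (fun l => 0 < l.1)%N ls -> well_defined A ls ->
  (err2_rand alpha gamma A ls <= (Num.sqrt (1 + (size ls)%:R) / M)%:E)%E.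
Proof.
move=> A g0 M0 cA ls0 wd; apply: ub_ereal_sup => _ [f [fH nf] <-].
have h := mean_sq_error_le g0 M0 cA ls0 wd fH nf.
rewrite poweR12_sqrt; last first.
  by apply: integral_ge0 => D _; apply: integral_ge0 => x _; rewrite lee_fin sqr_ge0.
apply: (le_trans (_ : _ <= sqrte ((1 + (size ls)%:R) * M ^- 2)%:E)%E).
  by rewrite lee_sqrt// lee_fin mulr_ge0 ?addr_ge0// invr_ge0 exprn_ge0 ?ltW.
by rewrite /= lee_fin sqrtrM ?addr_ge0// -exprVn sqrtr_sqr ger0_norm// invr_ge0 ltW.
Qed.

(** * The success probability of the random construction *)

Lemma uniq_map_inj (T1 T2 : eqType) (f : T1 -> T2) (s : seq T1) :
  uniq (map f s) -> {in s &, injective f}.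
Proof.
elim: s => [//|x s ih] /= /andP[fx us] y z.
rewrite !inE => /orP[/eqP ->|ys] /orP[/eqP ->|zs] // e; last exact: ih.
- by case/negP: fx; rewrite e map_f.
- by case/negP: fx; rewrite -e map_f.
Qed.

(** * Counting the generating vectors that alias a given frequency *)

Section LinearFormCount.
Variable (d n : nat).
Hypothesis pn : prime n.

(** The successor turns {0, ..., n-1} into the range {1, ..., n} of the draws. *)
Definition box_vec (b : {ffun 'I_d -> 'I_n}) : 'rV[int]_d := \row_j (b j).+1%:Z.

Lemma box_vec_inj : injective box_vec.
Proof.
move=> b b' /rowP e; apply/ffunP => j; apply/val_inj.
by have := e j; rewrite !mxE => -[].
Qed.

Lemma in_boxP (v : 'rV[int]_d) : in_box n v <-> exists b, v = box_vec b.
Proof.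
split=> [h|[b ->] j]; last by rewrite mxE /= !lez_nat ltn_ord.
have hj j : (`|v ord0 j|.-1 < n)%N.
  have := h j; case: (v ord0 j) => // m; rewrite !lez_nat => /andP[m0 mn].
  by rewrite absz_nat prednK.
exists [ffun j => Ordinal (hj j)]; apply/rowP => j; rewrite !mxE ffunE /=.
have := h j; case: (v ord0 j) => // m; rewrite !lez_nat => /andP[m0 mn].
by rewrite absz_nat prednK.
Qed.

(** Modulo the prime n the coefficient at [j] is invertible, so a solution is determined by its
    other coordinates. Overwriting coordinate [j] by any of n values is thus injective on pairs of a
    solution and a value. *)
Lemma linear_form_count (a : 'rV[int]_d) (j : 'I_d) : ~~ (n%:Z %| a ord0 j)%Z ->
  (#|[set b : {ffun 'I_d -> 'I_n} | (n%:Z %| dotz a (box_vec b))%Z]%SET| * n <= n ^ d)%N.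
Proof.
move=> aj; set S := [set b | _]%SET.
have -> : (#|S| * n)%N = #|finset.setX S [set: 'I_n]%SET| by rewrite cardsX cardsT card_ord.
have <- : #|[set: {ffun 'I_d -> 'I_n}]%SET| = (n ^ d)%N by rewrite cardsT card_ffun !card_ord.
pose sub (p : {ffun 'I_d -> 'I_n} * 'I_n) : {ffun 'I_d -> 'I_n} := [ffun t => if t == j then p.2 else p.1 t].
rewrite -(card_in_imset (f := sub)); first exact: subset_leq_card (finset.subsetT _).
move=> [b i] [b' i'] /=; rewrite !inE /= !andbT => hb hb' /ffunP e.
have := e j; rewrite !ffunE eqxx /= => ->; congr pair.
have off t : t != j -> b t = b' t.
  by move=> /negbTE tj; have := e t; rewrite !ffunE tj.
suff bj : b j = b' j by apply/ffunP => t; have [->//|/off] := eqVneq t j.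
have : (n%:Z %| dotz a (box_vec b) - dotz a (box_vec b'))%Z by rewrite rpredB.
rewrite /dotz -sumrB (bigD1 j)//= big1 ?addr0; last first.
  by move=> t tj; rewrite !mxE off// subrr.
rewrite -mulrBr !mxE dvdzE abszM Euclid_dvdM//.
have /negbTE -> /= : ~~ (n %| `|a ord0 j|)%N by apply: contra aj; rewrite dvdzE.
(* Two coordinates in {1, ..., n} differ by less than n, so divisibility of the difference by n
   forces equality. *)
have lt : (`|(b j).+1%:Z - (b' j).+1%:Z| < n)%N.
  by have := ltn_ord (b j); have := ltn_ord (b' j); lia.
rewrite /dvdn modn_small// absz_eq0 subr_eq0 => /eqP[e']; exact/val_inj.
Qed.

(** Union bound over the other m in [A]: as m and [k] differ modulo n, some coordinate of m - k is
    not divisible by n. *)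
Lemma aliased_count (A : {fset 'rV[int]_d}) (k : 'rV[int]_d) : k \in A ->
  uniq [seq map_mx (fun z => (z %% n%:Z)%Z) k | k <- enum_fset A] ->
  (#|[set b : {ffun 'I_d -> 'I_n} | ~~ aliasing_free A (n, box_vec b) k]%SET| * n <= (#|` A|.-1) * n ^ d)%N.
Proof.
move=> kA uA; set S := [set b | _]%SET.
pose Sm m := [set b : {ffun 'I_d -> 'I_n} | (n%:Z %| dotz (m - k) (box_vec b))%Z]%SET.
have sub : S \subset \bigcup_(m <- enum_fset (A `\ k)%fset) Sm m.
  apply/fintype.subsetP => b; rewrite inE -has_predC => /hasP[m mA] /=.
  rewrite negbK => e; rewrite (big_rem m)//= inE; apply/orP; left.
  rewrite inE; suff -> : dotz (m - k) (box_vec b) = dotz m (box_vec b) - dotz k (box_vec b).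
    by rewrite -eqz_mod_dvd.
  by rewrite /dotz -sumrB; apply: eq_bigr => j _; rewrite !mxE mulrBl.
have c1 : (#|S| <= \sum_(m <- enum_fset (A `\ k)%fset) #|Sm m|)%N.
  apply: (leq_trans (subset_leq_card sub)).
  elim: (enum_fset _) => [|m s ih]; first by rewrite !big_nil cards0.
  by rewrite !big_cons (leq_trans (leq_card_setU _ _))// leq_add2l.
apply: (@leq_trans (\sum_(m <- enum_fset (A `\ k)%fset) n ^ d)).
  apply: (leq_trans (leq_mul c1 (leqnn n))); rewrite big_distrl /=.
  rewrite big_seq [leqRHS]big_seq; apply: leq_sum => m; rewrite in_fsetD1 => /andP[mk mA].
  have : ~~ [forall j, (n%:Z %| (m - k) ord0 j)%Z].
    apply: contra mk => /forallP h; apply/eqP.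
    apply: (uniq_map_inj uA mA kA); apply/rowP => j; rewrite !mxE.
    by apply/eqP; rewrite eqz_mod_dvd; have := h j; rewrite !mxE.
  by rewrite negb_forall => /existsP[j /linear_form_count].
rewrite big_const_seq count_predT iter_addn_0 mulnC leq_mul2r.
by rewrite [#|` A|](cardfsD1 k) kA add1n /= leqnn orbT.
Qed.

End LinearFormCount.

(** * One pass through the loop *)

Section Run.
Context {R : realType} {d : nat}.
Variables (A : {fset 'rV[int]_d}) (c delta : R).
Local Notation run := (lc_run A c delta).
Local Notation running := (lc_running A c delta).
Local Notation step := (lc_step A c).

Lemma lc_run_ext (g h : nat -> 'rV[int]_d) m : (forall i, (i < m)%N -> g i = h i) -> run g m = run h m.
Proof.
elim: m => [//|m ih] e /=; rewrite ih ?e// => i im.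
by apply: e; rewrite ltnS ltnW.
Qed.

Lemma lc_run_stop (g : nat -> 'rV[int]_d) m j : ~~ running (run g m) -> run g (m + j) = run g m.
Proof.
move=> nr; elim: j => [|j ih]; first by rewrite addn0.
by rewrite addnS /= ih (negbTE nr).
Qed.

(** What the final estimate needs of a reachable state; the last clause carries the bound on the
    number of points. *)
Definition lc_inv (s : lc_state d) := [/\ (s.2 `<=` A)%fset, (size s.1 <= Lmax A c delta)%N &
  forall k, k \in s.2 -> (0 < xi A s.1 k)%N] /\
  forall l, l \in s.1 -> exists2 t, (t < Lmax A c delta)%N & l.1 = lc_prime A c t.

Lemma lc_inv0 : lc_inv ([::], fset0).
Proof. by split => //; split => //; exact: fsub0set. Qed.

Lemma lc_inv_step s g : running s -> lc_inv s -> lc_inv (step s g).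
Proof.
move=> /andP[_ sL] [[sA sz cov] pr]; rewrite /lc_step; case: ifP => // _.
set At := [fset k in A | _]%fset; split; [split|] => /=.
- rewrite fsubUset sA /=; apply/fsubsetP => k; rewrite !inE /=.
  by case/andP.
- by rewrite size_rcons.
- move=> k; rewrite in_fsetU /xi big_rcons /= => /orP[/cov|].
    by move=> h; rewrite (leq_trans h)// leq_addr.
  by rewrite !inE /= => /andP[_ ->]; rewrite addnC.
- move=> l; rewrite mem_rcons inE => /orP[/eqP ->|/pr//].
  by exists (size s.1).
Qed.

Lemma lc_inv_run g m : lc_inv (run g m).
Proof.
elim: m => [|m ih]; first exact: lc_inv0.
by rewrite /=; case: ifP => // r; exact: lc_inv_step.
Qed.

Lemma lc_inv_final s : lc_inv s -> ~~ running s -> (A `<=` s.2)%fset \/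
  ((exists2 k, k \in A & k \notin s.2) /\ size s.1 = Lmax A c delta).
Proof.
move=> [[sA sz _] _]; rewrite negb_and -!leqNgt => h.
have [As|nAs] := boolP (A `<=` s.2)%fset; [by left|right].
split; first by apply/fsubsetPn; exact: nAs.
apply/eqP; rewrite eqn_leq sz /=; case/orP: h => // le.
have /eqP e : s.2 == A by rewrite eqEfcard sA.
by rewrite e fsubset_refl in nAs.
Qed.

Hypotheses (c1 : 1 < c).
Hypothesis cand : forall t, (t < Lmax A c delta)%N -> lc_candidate A c (lc_prime A c t).

Let q := c^-1.
Let q0 : 0 < q. Proof. by rewrite invr_gt0 (lt_trans ltr01). Qed.
Let q1 : q < 1. Proof. by rewrite invf_lt1// (lt_trans ltr01). Qed.
Let L := Lmax A c delta.

Section Step.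
Variable s : lc_state d.
Hypotheses (rs : running s).
Let n := lc_next_n A c s.
Let B := {ffun 'I_d -> 'I_n}.
Let af k (b : B) := aliasing_free A (n, box_vec b) k.

Let ncand : lc_candidate A c n.
Proof. by case/andP: rs => _ sL; exact: cand. Qed.

Let n0 : 0 < n%:R :> R.
Proof. by case/andP: ncand => /andP[/prime_gt0 n0 _] _; rewrite ltr0n. Qed.

Let nd0 : 0 < (n ^ d)%:R :> R.
Proof. by rewrite natrX exprn_gt0. Qed.

(** The proportion of bad vectors is at most (|A| - 1)/n, and n > c (|A| - 1). *)
Lemma step_aliased k : k \in A -> (#|[set b | ~~ af k b]%SET|)%:R <= q * (n ^ d)%:R.
Proof.
move=> kA; case/andP: ncand => /andP[pn un] eta.
have := aliased_count pn kA un; rewrite -(@ler_nat R) !natrM => h.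
rewrite -(ler_pM2r n0) (le_trans h)// -mulrA (mulrC _ n%:R) mulrA.
rewrite (ler_pM2r nd0) ler_pdivlMl ?(lt_trans ltr01)//.
apply: ltW; apply: le_lt_trans eta; rewrite /lc_eta ler_wpM2l ?(ltW (lt_trans _ c1))//.
by rewrite -subn1 natrB ?cardfs_gt0//; apply/fset0Pn; exists k.
Qed.

Definition uncovered (s : lc_state d) := [seq k <- enum_fset A | k \notin s.2].

Definition cover_potential (s : lc_state d) : R :=
  \sum_(k <- uncovered s) q ^+ (L - size s.1).

Lemma step_rejected k (b : B) : k \in A -> k \notin s.2 -> step s (box_vec b) = s -> ~~ af k b.
Proof.
move=> kA ks; rewrite /lc_step; case: ifP => [sub _|_ /(congr1 (fun s => size s.1))]; last first.
  by rewrite size_rcons => /eqP; rewrite eqn_leq ltnn.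
apply: contra ks => h; apply: (fsubsetP sub); rewrite !inE kA /=.
exact: h.
Qed.

(** Whether the draw is accepted or rejected, an uncovered k stays uncovered only if it is aliased,
    and its term is then at most q^(L-t-1), t being the current number of lattices. The probability
    of aliasing, at most q, restores the exponent L - t. *)
Lemma cover_potential_step : \sum_(b : B) cover_potential (step s (box_vec b)) <=
  (n ^ d)%:R * cover_potential s.
Proof.
have sL : (size s.1 < L)%N by case/andP: rs.
apply: (@le_trans _ _ (\sum_(b : B) \sum_(k <- uncovered s) (~~ af k b)%:R * q ^+ (L - (size s.1).+1))).
  apply: ler_sum => b _; rewrite /cover_potential.
  have [e|ne] := eqVneq (step s (box_vec b)) s.
    rewrite e; rewrite big_seq [leRHS]big_seq; apply: ler_sum => k; rewrite mem_filter => /andP[ks kA].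
    by rewrite step_rejected// mul1r ler_wiXn2l// ?(ltW q0) ?(ltW q1)// leq_sub2l.
  have [e1 e2] : size (step s (box_vec b)).1 = (size s.1).+1 /\
     forall k, (k \notin (step s (box_vec b)).2) = (k \notin s.2) && ~~ ((k \in A) && af k b).
    move: ne; rewrite /lc_step; case: ifP => [_|_ _]; first by rewrite eqxx.
    by rewrite size_rcons; split => // k; rewrite in_fsetU negb_or !inE.
  rewrite e1 /uncovered (eq_in_filter (a2 := fun k => (k \notin s.2) && ~~ af k b)); last first.
    by move=> k kA; rewrite e2 kA.
  rewrite big_filter big_mkcondr /= [leRHS]big_filter; apply: ler_sum => k _.
  by case: af; rewrite ?mul0r ?mul1r.
rewrite exchange_big /= /cover_potential mulr_sumr big_seq [leRHS]big_seq; apply: ler_sum => k.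
rewrite mem_filter => /andP[ks kA].
rewrite -mulr_suml (_ : (L - size s.1 = (L - (size s.1).+1).+1)%N); last by rewrite subnSK.
rewrite exprS mulrA ler_wpM2r ?exprn_ge0 ?(ltW q0)// mulrC.
apply: le_trans (step_aliased kA); rewrite -natr_sum ler_nat.
by rewrite -big_mkcond sum1_card cardsE.
Qed.

Variable a : R.
Hypothesis a1 : 1 < a.

(* Accepted draws decrease the exponent, and rejected draws are rare while some
   k is uncovered: only termination depends on this potential. *)
Definition run_potential (s : lc_state d) : R := a ^+ (L - size s.1).

(** A rejected draw leaves the potential unchanged but aliases k, which has probability at most [q];
    an accepted draw divides the potential by [a]. *)
Lemma run_potential_step : (exists2 k, k \in A & k \notin s.2) ->
  \sum_(b : B) run_potential (step s (box_vec b)) <= (n ^ d)%:R * ((q + a^-1) * run_potential s).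
Proof.
move=> [k kA ks]; have sL : (size s.1 < L)%N by case/andP: rs.
have a0 : 0 < a by rewrite (lt_trans ltr01).
have aL : a ^+ (L - (size s.1).+1) = a^-1 * run_potential s.
  by rewrite /run_potential -[in RHS](subnSK sL) exprS mulKf// gt_eqF.
apply: (@le_trans _ _ (\sum_(b : B) ((~~ af k b)%:R * run_potential s + a^-1 * run_potential s))).
  apply: ler_sum => b _.
  have [e|ne] := eqVneq (step s (box_vec b)) s.
    rewrite e step_rejected// mul1r lerDl mulr_ge0 ?invr_ge0 ?exprn_ge0 ?(ltW a0)//.
  rewrite /run_potential -aL.
  have -> : size (step s (box_vec b)).1 = (size s.1).+1.
    by move: ne; rewrite /lc_step; case: ifP => [_|_ _]; rewrite ?eqxx ?size_rcons.
  by rewrite lerDr mulr_ge0// exprn_ge0 ?(ltW a0).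
rewrite big_split /= -mulr_suml sumr_const card_ffun !card_ord mulrA mulrDr mulrDl lerD//.
  rewrite ler_wpM2r ?exprn_ge0 ?(ltW a0)// mulrC.
  apply: le_trans (step_aliased kA); rewrite -natr_sum ler_nat.
  by rewrite -big_mkcond sum1_card cardsE.
by rewrite -[leLHS]mulr_natl mulrA.
Qed.

End Step.

End Run.

(** * Probabilities of finite histories and of runs *)

Section DrawProbability.
Context {R : realType} {disp : measure_display} {Omega : measurableType disp}.
Variable P : probability Omega R.

Definition pr (S : set Omega) : R := fine (P S).

Lemma prE S : measurable S -> P S = (pr S)%:E.
Proof. by move=> mS; rewrite /pr fineK// fin_num_measure. Qed.

Lemma pr_ge0 S : 0 <= pr S.
Proof. by rewrite /pr fine_ge0. Qed.

Lemma pr_le S S' : measurable S -> measurable S' -> S `<=` S' -> pr S <= pr S'.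
Proof.
by move=> mS mS' h; rewrite -lee_fin -!prE// le_measure// inE.
Qed.

Lemma pr0 : pr set0 = 0.
Proof. by rewrite /pr measure0. Qed.

Lemma prT : pr setT = 1.
Proof. by rewrite /pr probability_setT. Qed.

Lemma prU S S' : measurable S -> measurable S' -> S `&` S' = set0 -> pr (S `|` S') = pr S + pr S'.
Proof.
move=> mS mS' h.
by apply: EFin_inj; rewrite EFinD -!prE ?measureU//; exact: measurableU.
Qed.

Lemma pr_split (T : eqType) (X : Omega -> T) (s : seq T) (S : set Omega) :
  (forall v, measurable [set w | X w = v]) -> measurable S -> uniq s ->
  pr S = \sum_(v <- s) pr (S `&` [set w | X w = v]) + pr (S `&` [set w | X w \notin s]) /\
  measurable (S `&` [set w | X w \notin s]).
Proof.
move=> mX mS; elim: s => [|v s ih] /=.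
  move=> _; rewrite big_nil add0r.
  suff -> : S `&` [set w | X w \notin [::]] = S by [].
  by apply/seteqP; split => w; [case|].
move=> /andP[vs us]; have [e m] := ih us.
have E : S `&` [set w | X w \notin s] = (S `&` [set w | X w = v]) `|` (S `&` [set w | X w \notin v :: s]).
  apply/seteqP; split => w /=.
    move=> [Sw Xs]; have [e'|ne] := eqVneq (X w) v; [by left|right].
    by rewrite inE negb_or ne.
  move=> [[Sw ->]|[Sw]]; first by rewrite vs.
  by rewrite inE negb_or => /andP[].
have m2 : measurable (S `&` [set w | X w \notin v :: s]).
  have -> : S `&` [set w | X w \notin v :: s] = (S `&` [set w | X w \notin s]) `\` [set w | X w = v].
    apply/seteqP; split => w /=.
      by move=> [Sw]; rewrite inE negb_or => /andP[/eqP ne h].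
    by move=> [[Sw h] ne]; rewrite inE negb_or h andbT; split => //; apply/eqP.
  exact: measurableD.
split => //.
have m1 : measurable (S `&` [set w | X w = v]) by exact: measurableI.
rewrite e big_cons E prU//; first by rewrite addrCA addrA.
apply/seteqP; split => // w [[_ /= ->] [_]].
by rewrite inE eqxx.
Qed.

End DrawProbability.

Section RunProbability.
Context {R : realType} {d : nat}.
Variables (A : {fset 'rV[int]_d}) (c delta : R).
Local Notation run := (lc_run A c delta).
Local Notation running := (lc_running A c delta).
Local Notation step := (lc_step A c).
Context {disp : measure_display} {Omega : measurableType disp}.
Variables (P : probability Omega R) (G : nat -> Omega -> 'rV[int]_d).
Hypothesis HG : lc_draws A c delta P G.
Local Notation p := (pr P).

(** The draws take countably many values, so [Q] can be arbitrary. It is generalized in the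
    induction because it absorbs the last pass. *)
Lemma measurable_run m (Q : lc_state d -> Prop) :
  measurable [set w | Q (run (fun i => G i w) m)].
Proof.
elim: m Q => [|m ih] Q /=.
  by have [q|q] := pselect (Q ([::], fset0)); [rewrite (_ : [set _ | _] = setT)|rewrite (_ : [set _ | _] = set0)] => //;
    apply/seteqP; split.
pose nxt s v := if running s then step s v else s.
have -> : [set w | Q (if running (run (fun i => G i w) m) then step (run (fun i => G i w) m) (G m w) else run (fun i => G i w) m)] =
   \bigcup_v ([set w | G m w = v] `&` [set w | Q (nxt (run (fun i => G i w) m) v)]).
  apply/seteqP; split => w /=; first by move=> h; exists (G m w).
  by move=> [v _ [/= -> h]].
apply: (countable_bigcupT_measurable (countableP _)) => v.
by apply: measurableI; [exact: HG.1|exact: (ih (fun s => Q (nxt s v)))].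
Qed.

(** [V j s] is to bound the probability of a bad state after [j] more draws from [s]: it is at least
    1 on bad states when no draw is left or the loop has stopped, and its mean does not increase
    along a running loop. *)
Variable V : nat -> lc_state d -> R.
Variable Bad : lc_state d -> Prop.
Hypothesis V0 : forall j s, 0 <= V j s.
Hypothesis Bad0 : forall s, lc_inv A c delta s -> Bad s -> 1 <= V 0 s.
Hypothesis BadV : forall j s, lc_inv A c delta s -> ~~ running s -> Bad s -> 1 <= V j s.
Hypothesis pos_n : forall s, running s -> (0 < lc_next_n A c s)%N.
Hypothesis VS : forall j s, lc_inv A c delta s -> running s ->
  \sum_(b : {ffun 'I_d -> 'I_(lc_next_n A c s)}) V j (step s (box_vec b)) <=
    ((lc_next_n A c s) ^ d)%:R * V j.+1 s.

Let past m (h : nat -> 'rV[int]_d) := [set w | forall i, (i < m)%N -> G i w = h i].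

Let measurable_past m h : measurable (past m h).
Proof.
rewrite (_ : past m h = \bigcap_(i in [set i | (i < m)%N]) [set w | G i w = h i]); last first.
  by apply/seteqP; split => w /=.
by apply: fin_bigcap_measurable => [|i _]; [exact: finite_II|exact: HG.1].
Qed.

Let run_past m h w : past m h w -> run (fun i => G i w) m = run h m.
Proof. exact: lc_run_ext. Qed.

Let bad m := [set w | Bad (run (fun i => G i w) m)].

(** Induction on the number of remaining draws with a prescribed history. Conditional expectations
    become finite sums over the next draw, which is the form in which the law of the draws is
    given. *)
Lemma run_bad_le j m h : p (past m h `&` bad (m + j)) <= p (past m h) * V j (run h m).
Proof.
elim: j m h => [|j ih] m h.
  rewrite addn0; have [b|b] := pselect (Bad (run h m)).
    apply: (@le_trans _ _ (p (past m h))).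
      apply: pr_le; [|exact: measurable_past|by move=> w []].
      by apply: measurableI => //; exact: measurable_run.
    by rewrite ler_peMr ?pr_ge0// Bad0//; exact: lc_inv_run.
  rewrite (_ : past m h `&` bad m = set0) ?pr0 ?mulr_ge0 ?pr_ge0//.
  by apply/seteqP; split => // w [pw]; rewrite /bad /= (run_past pw).
have mB : measurable (past m h `&` bad (m + j.+1)).
  by apply: measurableI => //; exact: measurable_run.
have [r|nr] := boolP (running (run h m)); last first.
  have [b|b] := pselect (Bad (run h m)).
    apply: (@le_trans _ _ (p (past m h))); first by apply: pr_le => // w [].
    by rewrite ler_peMr ?pr_ge0// BadV//; exact: lc_inv_run.
  rewrite (_ : _ `&` _ = set0) ?pr0 ?mulr_ge0 ?pr_ge0//.
  apply/seteqP; split => // w [pw]; rewrite /bad /= lc_run_stop ?(run_past pw)//.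
set s := run h m in r *; set n := lc_next_n A c s.
have n0 : 0 < (n ^ d)%:R :> R by rewrite ltr0n expn_gt0 pos_n.
pose box := [seq box_vec b | b <- enum {: {ffun 'I_d -> 'I_n}}].
have ubox : uniq box by rewrite map_inj_uniq ?enum_uniq//; exact: box_vec_inj.
have big_box (F : 'rV[int]_d -> R) : \sum_(v <- box) F v = \sum_(b : {ffun 'I_d -> 'I_n}) F (box_vec b).
  by rewrite big_map big_enum.
have Pbox v : v \in box -> p (past m h `&` [set w | G m w = v]) = p (past m h) * (n ^ d)%:R^-1.
  move=> /mapP[b _ ->]; apply: EFin_inj; rewrite EFinM -!prE//; last first.
    by apply: measurableI => //; exact: HG.1.
  by rewrite natrX HG.2//; apply/in_boxP; exists b.
(* The n^d vectors of the box already carry the whole probability of the past, so all other values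
   of the draw are negligible. *)
have out0 : p (past m h `&` [set w | G m w \notin box]) = 0.
  have [e _] := pr_split P (HG.1 m) (measurable_past m h) ubox.
  move: e; rewrite (eq_big_seq (fun=> p (past m h) * (n ^ d)%:R^-1)) //.
  rewrite big_box sumr_const card_ffun !card_ord -[X in _ = X + _]mulr_natr -mulrA mulVf ?gt_eqF// mulr1.
  by move/eqP; rewrite -subr_eq0 opprD addNKr oppr_eq0 => /eqP.
have [-> mo] := pr_split P (HG.1 m) mB ubox.
have -> : p (past m h `&` bad (m + j.+1) `&` [set w | G m w \notin box]) = 0.
  apply/eqP; rewrite eq_le pr_ge0 andbT -out0; apply: pr_le => //.
    by have [] := pr_split P (HG.1 m) (measurable_past m h) ubox.
  by move=> w [[]].
rewrite addr0.
apply: (@le_trans _ _ (\sum_(v <- box) p (past m h) * (n ^ d)%:R^-1 * V j (step s v))).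
  rewrite big_seq [leRHS]big_seq; apply: ler_sum => v vb.
  pose hv i := if i == m then v else h i.
  have pv : past m h `&` [set w | G m w = v] = past m.+1 hv.
    apply/seteqP; split => w /=.
      move=> [pw gw] i; rewrite ltnS leq_eqVlt => /orP[/eqP ->|im]; first by rewrite /hv eqxx.
      by rewrite /hv ltn_eqF// pw.
    move=> pw; split; last by have := pw m (ltnSn m); rewrite /hv eqxx.
    by move=> i im; have := pw i (ltnW im); rewrite /hv ltn_eqF.
  have rv : run hv m.+1 = step s v.
    rewrite /= (_ : run hv m = s); first by rewrite r /hv eqxx.
    by apply: lc_run_ext => i im; rewrite /hv ltn_eqF.
  have := ih m.+1 hv; rewrite rv -pv Pbox// addSnnS; apply: le_trans.
  by rewrite setIAC.
rewrite big_box -mulr_sumr -mulrA ler_wpM2l ?pr_ge0// ler_pdivrMl//.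
by apply: VS => //; exact: lc_inv_run.
Qed.

Lemma run_bad0_le j : p (bad j) <= V j ([::], fset0).
Proof.
have := run_bad_le j 0 (fun=> 0); rewrite add0n.
rewrite (_ : past 0 _ = setT); last by apply/seteqP; split.
by rewrite setTI prT mul1r.
Qed.

End RunProbability.

(** * Failure bound and almost sure termination *)

Section SuccessProbability.
Context {R : realType}.

(* With t = ln c, the derivative of t - 2 (1 - exp (-t))^2 is (1 - 2 exp (-t))^2. *)
Lemma ln_ge_quadratic (c : R) : 1 < c -> 2 * (1 - c^-1) ^+ 2 <= ln c.
Proof.
move=> c1; have c0 : 0 < c := lt_trans ltr01 c1.
pose h (t : R) := t + (- 2) * ((1 - expR (- 1 * t)) * (1 - expR (- 1 * t))).
have du (t : R) : is_derive t 1 (fun y : R => 1 - expR (- 1 * y)) (0 - (- 1 * expR (- 1 * t))).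
  by apply: is_deriveB; exact: is_derive_mulcomp.
have dh (t : R) : is_derive t 1 h ((1 - 2 * expR (- 1 * t)) ^+ 2).
  have -> : (1 - 2 * expR (- 1 * t)) ^+ 2 = 1 + (- 2) *
     ((1 - expR (- 1 * t)) *: (0 - (- 1 * expR (- 1 * t))) + (1 - expR (- 1 * t)) *: (0 - (- 1 * expR (- 1 * t)))).
    by rewrite /GRing.scale /=; ring.
  by apply: is_deriveD; apply: is_deriveZ; apply: is_deriveM; exact: du.
have ch : continuous h.
  by move=> x; apply: differentiable_continuous; apply/derivable1_diffP; exact: ex_derive.
have t0 : 0 < ln c by rewrite ln_gt0.
have : h 0 <= h (ln c).
  apply: (@ger0_derive1_ndecr _ h 0 (ln c)).
  - by move=> x _; exact: ex_derive.
  - by move=> x _; rewrite derive1E; have [_ ->] := dh x; exact: sqr_ge0.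
  - exact: continuous_subspaceT.
  - exact: lexx.
  - exact: ltW.
  - exact: lexx.
rewrite /h mulr0 expR0 subrr !mulr0 addr0 mulN1r expRN lnK ?posrE//.
by rewrite mulNr subr_ge0 expr2.
Qed.

(** In logarithms: ln |A| - ln delta <= Lmax ln c. The factor (c/(c-1))^2 / 2 in [Lmax] is the
    inverse of 2 (1 - 1/c)^2, which is at most ln c. *)
Lemma Lmax_failure (d : nat) (A : {fset 'rV[int]_d}) (c delta : R) :
  1 < c -> 0 < delta < 1 -> (0 < #|` A|)%N ->
  #|` A|%:R * c^-1 ^+ Lmax A c delta <= delta.
Proof.
move=> c1 /andP[d0 d1] A0.
have c0 : 0 < c := lt_trans ltr01 c1.
have A0' : 0 < #|` A|%:R :> R by rewrite ltr0n.
set y := ln #|` A|%:R - ln delta.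
have y0 : 0 <= y.
  rewrite subr_ge0 (le_trans (ln_le0 (ltW d1)))// ln_ge0// ler1n//.
have x0 : 0 < (1 - c^-1) by rewrite subr_gt0 invf_lt1.
have LT : y / (2 * (1 - c^-1) ^+ 2) <= (Lmax A c delta)%:R.
  rewrite /Lmax -/y.
  have -> : (c / (c - 1)) ^+ 2 * (y / 2) = y / (2 * (1 - c^-1) ^+ 2).
    by field; rewrite gt_eqF//= subr_eq0 gt_eqF.
  set T := y / _.
  apply: (le_trans (ceil_ge T)).
  by rewrite natr_absz ler_int ler_norm.
have h : y <= (Lmax A c delta)%:R * ln c.
  rewrite ler_pdivrMr ?mulr_gt0 ?exprn_gt0// in LT.
  by apply: (le_trans LT); rewrite ler_wpM2l// ln_ge_quadratic.
have -> : c^-1 ^+ Lmax A c delta = expR (- ((Lmax A c delta)%:R * ln c)).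
  by rewrite expRN expRM_natl lnK ?posrE// exprVn.
rewrite -{1}[#|` A|%:R]lnK ?posrE// -expRD -[leRHS]lnK ?posrE// ler_expR.
by rewrite lerBlDr -lerBlDl.
Qed.

Context {d : nat} {disp : measure_display} {Omega : measurableType disp}.
Variables (A : {fset 'rV[int]_d}) (c delta : R).
Variables (P : probability Omega R) (G : nat -> Omega -> 'rV[int]_d).
Hypotheses (c1 : 1 < c) (d01 : 0 < delta < 1) (A0 : (0 < #|` A|)%N).
Hypothesis cand : forall t, (t < Lmax A c delta)%N -> lc_candidate A c (lc_prime A c t).
Hypothesis HG : lc_draws A c delta P G.
Local Notation run := (lc_run A c delta).
Local Notation running := (lc_running A c delta).

(** The loss [e] pays for the runs that are still active after m draws. *)
Lemma lc_success (e : R) : 0 < e -> exists m,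
  1 - delta - e <= pr P [set w | ~~ running (run (fun i => G i w) m) /\
                               (A `<=` (run (fun i => G i w) m).2)%fset].
Proof.
move=> e0.
have c0 : 0 < c := lt_trans ltr01 c1.
(* This [a] makes [rho] the midpoint of 1/c and 1. *)
pose a := 2 * c / (c - 1); pose rho := c^-1 + a^-1.
have cm1 : 0 < c - 1 by rewrite subr_gt0.
have a1 : 1 < a by rewrite /a ltr_pdivlMr// mul1r; lra.
have a0 : 0 < a := lt_trans ltr01 a1.
have rhoE : rho = (c + 1) / (2 * c) by rewrite /rho /a; field; rewrite !gt_eqF.
have rho0 : 0 < rho by rewrite addr_gt0 ?invr_gt0.
have rho1 : rho < 1 by rewrite rhoE ltr_pdivrMr ?mulr_gt0// mul1r; lra.
(* The first term is at least 1 when the loop has stopped with an uncovered frequency, the second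
   when it is still running with no draw left. *)
pose V j (s : lc_state d) := cover_potential A c delta s + rho ^+ j * run_potential A c delta a s.
pose Bad (s : lc_state d) := running s \/ ~~ (A `<=` s.2)%fset.
have cp0 s : 0 <= cover_potential A c delta s.
  by apply: sumr_ge0 => k _; rewrite exprn_ge0// invr_ge0 ltW.
have rp0 s : 0 <= run_potential A c delta a s by rewrite exprn_ge0// ltW.
have V0 j s : 0 <= V j s by rewrite addr_ge0// mulr_ge0// exprn_ge0// ltW.
have BadV j s : lc_inv A c delta s -> ~~ running s -> Bad s -> 1 <= V j s.
  move=> inv nr [|nAs]; first by rewrite (negbTE nr).
  have [|[[k kA ks] sz]] := lc_inv_final inv nr; first by rewrite (negbTE nAs).
  rewrite (@le_trans _ _ (cover_potential A c delta s))//; last first.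
    by rewrite lerDl mulr_ge0// exprn_ge0// ltW.
  rewrite /cover_potential sz subnn (bigD1_seq k)//=; last 2 first.
  - by rewrite mem_filter ks.
  - by rewrite filter_uniq.
  by rewrite expr0 lerDl sumr_ge0.
have Bad0 s : lc_inv A c delta s -> Bad s -> 1 <= V 0 s.
  move=> inv; have [r _|nr] := boolP (running s); last exact: BadV.
  by rewrite /V expr0 mul1r -[leLHS]add0r lerD// exprn_ege1// ltW.
have pos_n s : running s -> (0 < lc_next_n A c s)%N.
  by case/andP => _ /cand/andP[/andP[/prime_gt0]].
have VS j s : lc_inv A c delta s -> running s ->
    \sum_(b : {ffun 'I_d -> 'I_(lc_next_n A c s)}) V j (lc_step A c s (box_vec b)) <=
    ((lc_next_n A c s) ^ d)%:R * V j.+1 s.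
  move=> inv r; rewrite big_split /= mulrDr lerD//; first exact: cover_potential_step.
  have ex : exists2 k, k \in A & k \notin s.2.
    apply/fsubsetPn; apply/negP => sub; case/andP: r => + _.
    by rewrite ltnNge fsubset_leq_card.
  rewrite -mulr_sumr exprSr -mulrA mulrCA ler_wpM2l ?exprn_ge0 ?(ltW rho0)//.
  exact: run_potential_step.
have : exists j, rho ^+ j * a ^+ Lmax A c delta <= e.
  have aL : 0 < a ^+ Lmax A c delta by rewrite exprn_gt0.
  have eL : 0 < e / a ^+ Lmax A c delta by rewrite divr_gt0.
  have : (fun j => rho ^+ j) @ \oo --> (0 : R) by apply: cvg_expr; rewrite ger0_norm// ltW.
  move=> /cvgrPdist_lt/(_ _ eL)[N _ hN]; exists N.
  have := hN N (leqnn N); rewrite sub0r normrN ger0_norm ?exprn_ge0 ?(ltW rho0)//.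
  by rewrite ltr_pdivlMr// => /ltW.
move=> [j hj]; exists j.
have := run_bad0_le HG V0 Bad0 BadV pos_n VS j.
set S := [set w | Bad _]; set S' := [set w | _ /\ _] => hS.
have mS : measurable S by exact: (measurable_run HG j Bad).
have S'E : S' = ~` S.
  apply/seteqP; split => w; rewrite /S /S' /Bad /=.
    by move=> [nr As] [|]; [rewrite (negbTE nr)|rewrite As].
  by move=> h; split; [apply/negP => r; apply: h; left|apply/negPn/negP => r; apply: h; right].
have : pr P S + pr P S' = 1.
  rewrite -prU ?S'E ?setUCr ?prT ?setICr//; exact: measurableC.
have Vinit : V j ([::], fset0) <= delta + e.
  rewrite /V lerD//; last by rewrite /run_potential subn0.
  rewrite /cover_potential /uncovered /= subn0 (eq_filter (a2 := predT)); last by move=> k; rewrite inE.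
  rewrite filter_predT big_const_seq count_predT iter_addr_0 -mulr_natl.
  exact: Lmax_failure.
move=> <-; rewrite -addrA -opprD lerBlDl lerD2r; exact: le_trans hS Vinit.
Qed.

End SuccessProbability.

(** * The cardinality of the index set *)

Section ZetaPartialSums.
Context {R : realType}.
Variable s : R.
Hypothesis s1 : 1 < s.
Let u (n : nat) : R := n.+1%:R `^ (- s).

Let u0 n : 0 <= u n. Proof. exact: powR_ge0. Qed.

Let S n := \sum_(0 <= k < n) u k.

(* (2k)^-s = 2^-s k^-s dominates (2k+1)^-s. *)
Let S_step n : S n.*2.+1 <= 1 + 2 `^ (1 - s) * S n.
Proof.
elim: n => [|n ih].
  by rewrite /S big_nat1 big_geq// mulr0 addr0 /u powR1.
rewrite doubleS /S big_nat_recr//= [X in X + _]big_nat_recr//= -/(S n.*2.+1).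
rewrite [in leRHS]big_nat_recr//= -/(S n) mulrDr addrA -addrA lerD//.
have pos m : (0 : R) < m.+1%:R by rewrite ltr0n.
have -> : 2 `^ (1 - s) * u n = u n.*2.+1 + u n.*2.+1.
  rewrite /u -[in RHS]doubleS -mul2n natrM powRM// -mulr2n -[RHS]mulr_natl mulrA.
  by rewrite powRD ?powRr1// pnatr_eq0 implybT.
rewrite lerD2l /u !powRN lef_pV2 ?posrE ?powR_gt0//.
by rewrite ge0_ler_powR ?nnegrE ?ler_nat// ltW// (lt_trans ltr01).
Qed.

(** [zeta] is a [limn], so convergence has to be shown. As S_n <= S_(2n+1), the recursion gives S_n
    <= 1/(1 - 2^(1-s)), and the partial sums are monotone. *)
Lemma zeta_partial_le n : \sum_(k < n) u k <= zeta s.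
Proof.
have nd : nondecreasing_seq S.
  by apply/nondecreasing_seqP => m; rewrite /S big_nat_recr//= lerDl.
have q1 : 2 `^ (1 - s) < 1 :> R.
  rewrite -[X in _ < X](powRr0 2) /powR pnatr_eq0 /= ltr_expR mul0r.
  by rewrite pmulr_llt0 ?subr_lt0// ln_gt0// ltr1n.
have ub m : S m <= (1 - 2 `^ (1 - s))^-1.
  rewrite -[leRHS]mul1r ler_pdivlMr ?subr_gt0// mulrBr mulr1 lerBlDr mulrC.
  apply: le_trans (S_step m); apply: nd.
  by rewrite -addnn -addnS leq_addr.
have cv : cvgn S.
  apply: nondecreasing_is_cvgn => //.
  by exists (1 - 2 `^ (1 - s))^-1 => _ [m _ <-].
rewrite -(big_mkord xpredT) -/(S n) /zeta.
have -> : series (fun n : nat => n.+1%:R `^ (- s)) = S.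
  by apply/funext => m; rewrite /series /=.
exact: nondecreasing_cvgn_le.
Qed.

End ZetaPartialSums.

Lemma ler_sum_subset {R : numDomainType} {T : eqType} (s1 s2 : seq T) (F : T -> R) :
  uniq s1 -> uniq s2 -> {subset s1 <= s2} -> (forall x, 0 <= F x) ->
  \sum_(x <- s1) F x <= \sum_(x <- s2) F x.
Proof.
move=> u1 u2 sub F0.
rewrite [leRHS](bigID [pred x | x \in s1])/= -[X in _ <= X + _]big_filter.
rewrite (perm_big [seq x <- s2 | x \in s1]); first by rewrite lerDl sumr_ge0.
apply: uniq_perm; rewrite ?filter_uniq// => x; rewrite mem_filter.
by case: (boolP (x \in s1)) => // /sub ->.
Qed.

Section CoordinateSums.
Context {R : realType} {d : nat}.
Variables (s : R) (B : nat).
(** The integers of absolute value at most [B], split into zero, positive and negative ones, so that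
    sums over them split too. *)
Let T := (unit + ('I_B + 'I_B))%type.
Let valT (t : T) : int := match t with
  | inl _ => 0 | inr (inl i) => i.+1%:Z | inr (inr i) => - i.+1%:Z end.

Let valT_inj : injective valT.
Proof. by move=> [[]|[i|i]] [[]|[j|j]] //= [] => [/val_inj ->|/val_inj ->]. Qed.

Let valT_surj (z : int) : (`|z| <= B)%N -> exists t, valT t = z.
Proof.
case: z => [[|m]|m] h.
- by exists (inl tt).
- by exists (inr (inl (Ordinal h))).
- by exists (inr (inr (Ordinal h))); rewrite /= NegzE.
Qed.

(** [b] tells whether the coordinate lies in the prescribed support; a product of such factors
    vanishes on all vectors with another support. *)
Let phi (b : bool) (z : int) : R := if b then (z != 0)%:R * `|z|%:~R `^ (- s) else (z == 0)%:R.

Let phi_sum b : \sum_(t : T) phi b (valT t) = if b then 2 * \sum_(k < B) k.+1%:R `^ (- s) else 1.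
Proof.
rewrite !big_sumType /= big_const card_unit /= addr0.
case: b; rewrite /phi /= ?mul0r ?add0r.
  rewrite mulr_natl mulr2n; congr (_ + _); apply: eq_bigr => i _; rewrite mul1r//.
by rewrite !big1 ?addr0.
Qed.

(** [A] is enlarged to the box of all vectors with entries bounded by [B], over which the sum of
    products is a product of sums. *)
Lemma sum_supp_le (A : seq 'rV[int]_d) (v : {set 'I_d}) : uniq A ->
  (forall k j, k \in A -> (`|k ord0 j| <= B)%N) ->
  \sum_(k <- A | supp k == v) \prod_(j in v) `|k ord0 j|%:~R `^ (- s) <=
  (2 * \sum_(k < B) k.+1%:R `^ (- s)) ^+ #|v|.
Proof.
move=> uA hA.
pose F (k : 'rV[int]_d) : R := \prod_j phi (j \in v) (k ord0 j).
have phi0 b z : 0 <= phi b z by rewrite /phi; case: b => //; rewrite mulr_ge0 ?powR_ge0.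
have F0 k : 0 <= F k by apply: prodr_ge0.
pose vec (g : {ffun 'I_d -> T}) : 'rV[int]_d := \row_j valT (g j).
have vec_inj : injective vec.
  by move=> g g' /rowP e; apply/ffunP => j; apply: valT_inj; have := e j; rewrite !mxE.
apply: (@le_trans _ _ (\sum_(k <- A) F k)).
  rewrite big_mkcond; apply: ler_sum => k _; case: eqP => // e.
  rewrite /F -e [leRHS](bigID (mem (supp k)))/= [X in _ <= _ * X]big1 ?mulr1 => [|j].
    rewrite le_eqVlt; apply/orP; left; apply/eqP/eq_bigr => j jk.
    by rewrite jk /phi; move: jk; rewrite inE => ->; rewrite mul1r.
  by move=> jk; rewrite (negbTE jk) /phi; move: jk; rewrite inE negbK => ->.
apply: (@le_trans _ _ (\sum_(k <- [seq vec g | g <- enum {: {ffun 'I_d -> T}}]) F k)).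
  apply: ler_sum_subset => //; first by rewrite map_inj_uniq ?enum_uniq.
  move=> k kA; pose g : {ffun 'I_d -> T} := [ffun j => projT1 (cid (valT_surj (hA k j kA)))].
  apply/mapP; exists g; first by rewrite mem_enum.
  by apply/rowP => j; rewrite !mxE ffunE; case: cid.
rewrite big_map big_enum /=.
rewrite (eq_bigr (fun g : {ffun 'I_d -> T} => \prod_j phi (j \in v) (valT (g j)))); last first.
  by move=> g _; apply: eq_bigr => j _; rewrite mxE.
rewrite -(bigA_distr_bigA (fun j t => phi (j \in v) (valT t))).
under eq_bigr do rewrite phi_sum.
by rewrite -big_mkcond prodr_const.
Qed.

End CoordinateSums.

Lemma powR_prod {R : realType} (I : Type) (r : seq I) (P : pred I) (F : I -> R) (x : R) :
  (forall i, 0 <= F i) -> (\prod_(i <- r | P i) F i) `^ x = \prod_(i <- r | P i) F i `^ x.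
Proof.
move=> F0; elim: r => [|i r ih]; first by rewrite !big_nil powR1.
by rewrite !big_cons; case: (P i) => //; rewrite powRM ?ih// prodr_ge0.
Qed.

Section IndexCard.
Context {R : realType} {d : nat}.
Variables (alpha lambda M : R) (gamma : {fset nat} -> R).
Hypotheses (l0 : 0 < lambda) (al : 1 < alpha * lambda) (M0 : 0 < M) (g0 : forall u, 0 <= gamma u).
Local Notation A := (korobov_index d alpha gamma M).
Hypothesis memA : forall k : 'rV[int]_d, k \in A -> (korobov_r alpha gamma k <= M%:E)%E.

Lemma korobov_index_card : #|` A|%:R <= M `^ lambda * weight_sum d gamma alpha lambda.
Proof.
pose s := alpha * lambda.
pose Pk (k : 'rV[int]_d) : R := \prod_(j in supp k) `|k ord0 j|%:~R `^ (- s).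
(* On the index set this is r(k)^(-lambda). *)
pose Fk (k : 'rV[int]_d) : R := gamma (coords (supp k)) `^ lambda * Pk k.
have h1 k : k \in A -> 1 <= M `^ lambda * Fk k.
  move=> /memA; rewrite /korobov_r; case: ifP => [_|/negbT gk]; first by rewrite leye_eq.
  rewrite lee_fin => rM; set gu := gamma _ in gk rM *.
  have gk0 : 0 < gu by rewrite lt_neqAle eq_sym gk g0.
  have kj0 j : j \in supp k -> 0 < `|k ord0 j|%:~R :> R.
    by rewrite inE => kj; rewrite ltr0z normr_gt0.
  set p := \prod_(j in _) _ in rM.
  have p0 : 0 < p by apply: prodr_gt0 => j /kj0 h; rewrite powR_gt0.
  have pP : Pk k = (p `^ lambda)^-1.
    rewrite /Pk /p powR_prod => [|j]; last exact: powR_ge0.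
    by rewrite -prodfV; apply: eq_bigr => j _; rewrite -powRrM powRN.
  have rp0 : 0 < gu^-1 * p by rewrite mulr_gt0 ?invr_gt0.
  have -> : Fk k = ((gu^-1 * p) `^ lambda)^-1.
    rewrite powRM ?invr_ge0 ?(ltW gk0) ?(ltW p0)// invfM /Fk pP -/gu; congr (_ * _).
    by rewrite -[in RHS]powR_inv1 ?(ltW gk0)// -powRrM mulN1r powRN invrK.
  rewrite ler_pdivlMr ?powR_gt0// mul1r.
  by rewrite ge0_ler_powR ?nnegrE ?(ltW rp0) ?(ltW M0)// ltW.
have -> : #|` A|%:R = \sum_(k <- A) (1 : R).
  by rewrite big_const_seq count_predT iter_addr_0.
apply: (@le_trans _ _ (\sum_(k <- A) M `^ lambda * Fk k)).
  by rewrite big_seq [leRHS]big_seq; apply: ler_sum.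
rewrite -mulr_sumr ler_wpM2l ?powR_ge0// /weight_sum.
pose B := (\max_(k <- A) \max_j `|k ord0 j|)%N.
have hB k j : k \in A -> (`|k ord0 j| <= B)%N.
  move=> kA; rewrite /B (big_rem k)//= leq_max; apply/orP; left.
  exact: (leq_bigmax (F := fun j => `|k ord0 j|%N)).
have -> : \sum_(k <- A) Fk k = \sum_(v : {set 'I_d}) \sum_(k <- A | supp k == v) Fk k.
  rewrite (exchange_big_dep xpredT) //=; apply: eq_bigr => k _.
  by rewrite (big_pred1 (supp k)).
apply: ler_sum => v _.
have -> : \sum_(k <- A | supp k == v) Fk k = gamma (coords v) `^ lambda *
    \sum_(k <- A | supp k == v) \prod_(j in v) `|k ord0 j|%:~R `^ (- s).
  by rewrite mulr_sumr; apply: eq_bigr => k /eqP <-.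
rewrite ler_wpM2l ?powR_ge0//.
apply: (le_trans (sum_supp_le s v (fset_uniq A) hB)).
have S0 : 0 <= \sum_(k < B) k.+1%:R `^ (- s) :> R by apply: sumr_ge0 => k _; exact: powR_ge0.
have S1 := zeta_partial_le al B.
rewrite lerXn2r ?nnegrE ?mulr_ge0//; first exact: le_trans S0 S1.
by rewrite ler_wpM2l.
Qed.

End IndexCard.

(** * The size of the lattices *)

Section Growth.
Context {R : realType}.

(** Apply ln (1 + t) <= t to t = x^theta - 1. *)
Lemma ln_le_powR (x theta : R) : 0 < x -> 0 < theta -> ln x <= x `^ theta / theta.
Proof.
move=> x0 t0; rewrite ler_pdivlMr// mulrC -ln_powR.
apply: (@le_trans _ _ (x `^ theta - 1)); last by rewrite gerBl.
by rewrite -{1}[x `^ theta](subrK 1) addrC le_ln1Dx// ltrBrDl subrr powR_gt0.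
Qed.

Lemma Lmax_le (c delta theta : R) : 1 < c -> 0 < delta < 1 -> 0 < theta ->
  exists2 C : R, 1 <= C & forall (d : nat) (A : {fset 'rV[int]_d}), (0 < #|` A|)%N ->
    1 + (Lmax A c delta)%:R <= C * #|` A|%:R `^ theta.
Proof.
move=> c1 /andP[d0 d1] t0; set K := (c / (c - 1)) ^+ 2.
have K0 : 0 <= K by exact: sqr_ge0.
have ld : 0 <= - ln delta by rewrite oppr_ge0 ln_le0// ltW.
(* The 2 is the leading 1 of the statement plus the rounding of the ceiling; the rest comes from ln
   x <= x^theta / theta. *)
exists (2 + K / 2 * (theta^-1 - ln delta)).
  have : 0 <= K / 2 * (theta^-1 - ln delta) by rewrite mulr_ge0 ?divr_ge0// addr_ge0// invr_ge0 ltW.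
  by lra.
move=> d A A0; set a : R := #|` A|%:R.
have a1 : 1 <= a by rewrite ler1n.
have a0 : 0 < a := lt_le_trans ltr01 a1.
have at1 : 1 <= a `^ theta by rewrite -(powRr0 a) ler_powR// ltW.
rewrite /Lmax -/K -/a; set T := K * _.
have T0 : 0 <= T by rewrite mulr_ge0// divr_ge0// addr_ge0// ln_ge0.
have cl : (`|Num.ceil T|%N)%:R <= T + 1.
  rewrite natr_absz ger0_norm ?ceil_ge0//; last by rewrite (lt_le_trans _ T0)// ltrN10.
  by have := ceil_itv T; rewrite intrD => /andP[]; lra.
apply: (@le_trans _ _ (2 + T)); first by move: cl; lra.
have lnb : ln a - ln delta <= a `^ theta * (theta^-1 - ln delta).
  rewrite mulrBr lerD//; first exact: ln_le_powR.
  by rewrite -mulrN ler_peMl.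
rewrite mulrDl lerD//; first by rewrite ler_peMr.
rewrite /T; have -> : K * ((ln a - ln delta) / 2) = (K / 2) * (ln a - ln delta) by ring.
have -> : K / 2 * (theta^-1 - ln delta) * a `^ theta = (K / 2) * (a `^ theta * (theta^-1 - ln delta)) by ring.
by rewrite ler_wpM2l// divr_ge0.
Qed.

(** Inverts m ln 2 <= pi(2m) ln (2m), the logarithmic form of the binomial bounds, where pi counts
    primes. Trading ln (2m) for a power leads to y^(1/(1-theta)) in place of y ln y. *)
Lemma prime_count_ge (theta : R) : 0 < theta < 1 -> exists2 C : R, 1 <= C &
  forall y : R, 1 <= y -> exists n : nat,
    y <= (count prime (iota 0 n.+1))%:R /\ n%:R <= C * y `^ (1 - theta)^-1.
Proof.
move=> /andP[t0 t1].
have l2 : 0 < ln 2 :> R by rewrite ln_gt0// ltr1n.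
have t1' : 0 < 1 - theta by rewrite subr_gt0.
set e := (1 - theta)^-1; have e0 : 0 < e by rewrite invr_gt0.
(* As ln (2m) <= (2m)^theta / theta, the condition kap * y <= m^(1-theta) is what gives y ln (2m) <=
   m ln 2. *)
set kap := 2 `^ theta / (theta * ln 2).
have kap0 : 0 < kap by rewrite divr_gt0 ?powR_gt0 ?mulr_gt0.
exists (2 * kap `^ e + 2).
  have := powR_ge0 kap e; lra.
move=> y y1; have y0 : 0 < y := lt_le_trans ltr01 y1.
set z := (kap * y) `^ e; have z0 : 0 < z by rewrite powR_gt0// mulr_gt0.
pose m := `|Num.ceil z|%N.
have mz : z <= m%:R by rewrite (le_trans (ceil_ge z))// natr_absz ler_int ler_norm.
have mz' : m%:R <= z + 1.
  rewrite /m natr_absz ger0_norm ?ceil_ge0//; last by rewrite (lt_trans _ z0)// ltrN10.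
  by have := ceil_itv z; rewrite intrD => /andP[]; lra.
have m0 : (0 < m)%N by rewrite -(ltr0n R) (lt_le_trans z0).
have m0' : 0 < m%:R :> R by rewrite ltr0n.
exists m.*2; split; last first.
  rewrite -muln2 natrM mulrC.
  have -> : (2 * kap `^ e + 2) * y `^ e = 2 * (z + y `^ e).
    by rewrite /z powRM ?(ltW kap0) ?(ltW y0)//; ring.
  rewrite ler_wpM2l// (le_trans mz')// lerD2l.
  by rewrite -(powRr0 y) ler_powR// ltW.
set p := count _ _.
have key : m%:R * ln 2 <= p%:R * ln (m.*2%:R : R).
  have h : (2 ^ m <= m.*2 ^ p)%N := leq_trans (bin2n_ge m) (bin_le_pi m0).
  rewrite !mulr_natl -!lnXn ?ltr0n ?double_gt0// -!natrX ler_ln ?posrE ?ltr0n ?expn_gt0 ?double_gt0 ?m0//.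
  by rewrite ler_nat.
have ln0 : 0 < ln (m.*2%:R : R) by rewrite ln_gt0// ltr1n -muln2; case: (m) m0 => // k _.
rewrite -(ler_pM2r ln0) (le_trans _ key)//.
apply: (@le_trans _ _ (y * (m.*2%:R `^ theta / theta))).
  by rewrite ler_wpM2l ?(ltW y0)// ln_le_powR// ltr0n double_gt0.
rewrite -muln2 natrM mulrC powRM//.
have mt : kap * y <= m%:R `^ (1 - theta).
  have -> : kap * y = z `^ (1 - theta) by rewrite /z -powRrM mulVf ?gt_eqF// powRr1// ltW// mulr_gt0.
  by rewrite ge0_ler_powR ?nnegrE ?(ltW z0) ?(ltW m0')// ltW.
have -> : m%:R * ln 2 = m%:R `^ theta * (m%:R `^ (1 - theta) * ln 2).
  rewrite mulrA -powRD; first by rewrite subrKC powRr1 ?(ltW m0').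
  by rewrite subrKC oner_eq0.
have -> : m%:R `^ theta * 2 `^ theta / theta * y = m%:R `^ theta * (kap * y * ln 2).
  by rewrite /kap; field; rewrite !gt_eqF.
by rewrite ler_wpM2l ?powR_ge0// ler_wpM2r// ltW.
Qed.

End Growth.

(** * Existence and size of the candidate primes *)

Section Candidates.
Context {R : realType} {d : nat}.
Variables (A : {fset 'rV[int]_d}) (c delta : R).
Hypothesis sp : (freq_spread A)%:~R <= lc_eta A c.
Local Notation cand := (lc_candidate A c).

Lemma bigmin_seq_le {T : eqType} (s : seq T) (x0 : int) (F : T -> int) (k : T) : k \in s ->
  \big[Num.min/x0]_(h <- s) F h <= F k.
Proof.
elim: s => [//|h s ih]; rewrite inE big_cons => /orP[/eqP ->|/ih le].
  by rewrite ge_min lexx.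
by rewrite ge_min le orbT.
Qed.

Lemma freq_spread_ge (k m : 'rV[int]_d) j : k \in A -> m \in A ->
  k ord0 j - m ord0 j <= freq_spread A.
Proof.
move=> kA mA; rewrite /freq_spread; set k0 := head _ _.
apply: le_trans (le_bigmax _ _ j); rewrite lerB//.
  exact: (le_bigmax_seq (k0 ord0 j) k xpredT (fun k : 'rV[int]_d => k ord0 j) kA isT).
exact: (bigmin_seq_le (k0 ord0 j) (fun k : 'rV[int]_d => k ord0 j) mA).
Qed.

(** Two elements of [A] differ by at most N_A <= eta < n in each coordinate, so congruent ones are
    equal. *)
Lemma candidateE n : cand n = prime n && (lc_eta A c < n%:R).
Proof.
rewrite /lc_candidate /separating_prime -andbA; congr andb.
have [lt|] := boolP (lc_eta A c < n%:R); rewrite ?andbF// andbT.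
rewrite map_inj_in_uniq ?fset_uniq// => k m kA mA e; apply/rowP => j.
have : (n%:Z %| k ord0 j - m ord0 j)%Z.
  by rewrite -eqz_mod_dvd; have := congr1 (fun v : 'rV[int]_d => v ord0 j) e; rewrite !mxE => ->.
have lt' : (`|k ord0 j - m ord0 j| < n)%N.
  have : (freq_spread A < n%:Z)%R by rewrite -(ltr_int R) (le_lt_trans sp).
  rewrite -ltz_nat abszE; apply: le_lt_trans.
  by rewrite ler_norml freq_spread_ge// andbT lerNl opprB freq_spread_ge.
by rewrite dvdzE /= /dvdn modn_small// absz_eq0 subr_eq0 => /eqP.
Qed.

(** The condition n > eta discards at most floor(eta) + 1 natural numbers, 0 included. *)
Lemma count_candidate_ge (X L : nat) : 0 <= lc_eta A c ->
  lc_eta A c + 1 + L%:R <= (count prime (iota 0 X.+1))%:R ->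
  (L <= count cand (iota 0 X.+1))%N.
Proof.
move=> eta0 h; set s := iota _ _ in h *.
pose E := `|Num.floor (lc_eta A c)|%N.
have EE : E%:R <= lc_eta A c.
  by rewrite /E natr_absz ger0_norm ?floor_ge0// floor_le_tmp.
have c1 : (count prime s <= count cand s + count (fun n => (n <= E)%N) s)%N.
  rewrite -count_predUI; apply: leq_trans (leq_addr _ _); apply: sub_count => n /= pn.
  rewrite candidateE pn /=; case: (ltrP (lc_eta A c) n%:R) => //= le.
  by rewrite -lez_nat /E abszE ger0_norm ?floor_ge0// floor_ge_int.
have c2 : (count (fun n => (n <= E)%N) s <= E.+1)%N.
  rewrite -size_filter -[leqRHS](size_iota 0); apply: uniq_leq_size; first by rewrite filter_uniq ?iota_uniq.
  by move=> n; rewrite mem_filter mem_iota => /andP[].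
rewrite -(ler_nat R) -(lerD2l (lc_eta A c + 1)) (le_trans h)//.
apply: (@le_trans _ _ (count cand s + E.+1)%N%:R).
  by rewrite ler_nat (leq_trans c1)// leq_add2l.
by rewrite natrD addrC lerD2r -natr1 lerD2r.
Qed.

(** The least n with more than [t] candidates in {0, ..., n} is a candidate with exactly [t] smaller
    ones; hence [xget] does not return its default. *)
Lemma lc_prime_spec (X t : nat) : (t < count cand (iota 0 X.+1))%N ->
  cand (lc_prime A c t) /\ (lc_prime A c t <= X)%N.
Proof.
pose f n := count cand (iota 0 n).
have fS n : f n.+1 = (f n + cand n)%N by rewrite /f -addn1 iotaD count_cat /= add0n addn0.
have fm n m : (n <= m)%N -> (f n <= f m)%N.
  by move=> nm; rewrite -(subnKC nm) /f iotaD count_cat leq_addr.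
rewrite -/(f X.+1) => tX.
have ex : exists n, (t < f n.+1)%N by exists X.
have [n tn nmin] := ex_minnP ex.
have ne : [set n | cand n /\ f n = t] n.
  have fn : (f n <= t)%N.
    case: n tn nmin => [//|n] tn nmin; rewrite leqNgt; apply/negP => /nmin.
    by rewrite ltnn.
  have := tn; rewrite fS; case: (boolP (cand n)) => cn.
    by rewrite addn1 ltnS => tf; split => //; apply/eqP; rewrite eqn_leq fn tf.
  by rewrite addn0 ltnNge fn.
have [cp fp] : cand (lc_prime A c t) /\ f (lc_prime A c t) = t by exact: (xgetPex 0%N (ex_intro _ n ne)).
split => //; rewrite leqNgt; apply/negP => /fm.
by rewrite fp leqNgt tX.
Qed.

End Candidates.

Lemma lattice_size_bounds {R : realType} (c delta beta : R) : 1 < c -> 0 < delta < 1 -> 0 < beta < 1 ->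
  exists2 C : R, 1 <= C & forall (d : nat) (A : {fset 'rV[int]_d}), (2 <= #|` A|)%N ->
    (freq_spread A)%:~R <= lc_eta A c ->
    1 + (Lmax A c delta)%:R <= C * #|` A|%:R `^ (beta / 2) /\
    forall t, (t < Lmax A c delta)%N -> lc_candidate A c (lc_prime A c t) /\
      (lc_prime A c t)%:R <= C * #|` A|%:R `^ (1 + beta / 2).
Proof.
move=> c1 d01 /andP[b0 b1].
(* Exponent 1 is enough inside the prime count, where Lmax only has to be O(|A|), like eta. *)
have [C1 C11 h1] := Lmax_le c1 d01 ltr01.
have b20 : 0 < beta / 2 by rewrite divr_gt0.
have [C2 C21 h2] := Lmax_le c1 d01 b20.
(* Chosen so that 1/(1 - theta) = 1 + beta/2. *)
pose theta := beta / (2 + beta).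
have b2 : 0 < 2 + beta by rewrite addr_gt0.
have t01 : 0 < theta < 1 by rewrite divr_gt0//= ltr_pdivrMr// mul1r; lra.
have te : (1 - theta)^-1 = 1 + beta / 2.
  have -> : 1 - theta = 2 / (2 + beta) by rewrite /theta; field; rewrite gt_eqF.
  by rewrite invf_div; field.
have [C3 C31 h3] := prime_count_ge t01.
have c0 : 0 < c := lt_trans ltr01 c1.
pose C4 := C3 * (c + C1) `^ (1 + beta / 2).
have C40 : 0 <= C4 by rewrite mulr_ge0 ?powR_ge0// (le_trans ler01).
exists (C2 + C4); first by rewrite (le_trans C21)// lerDl.
move=> d A A2 sp; have A0 : (0 < #|` A|)%N by rewrite (leq_trans _ A2).
set a : R := #|` A|%:R; have a1 : 1 <= a by rewrite ler1n.
have a0 : 0 < a := lt_le_trans ltr01 a1.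
split; first by rewrite (le_trans (h2 d A A0))// ler_wpM2r ?powR_ge0// lerDl.
have eta0 : 0 <= lc_eta A c by rewrite mulr_ge0 ?(ltW c0)// subr_ge0.
pose y := lc_eta A c + 1 + (Lmax A c delta)%:R.
have y1 : 1 <= y by rewrite /y addrAC lerDr addr_ge0.
have ya : y <= (c + C1) * a.
  rewrite /y -addrA mulrDl lerD//; first by rewrite ler_wpM2l ?(ltW c0)// gerBl.
  by have := h1 d A A0; rewrite powRr1 ?(ltW a0).
have [X [yX XC]] := h3 y y1.
have cX := count_candidate_ge sp eta0 yX.
move=> t tL; have [cand le] := lc_prime_spec (leq_trans tL cX); split => //.
apply: (@le_trans _ _ X%:R); first by rewrite ler_nat.
rewrite te in XC; apply: (le_trans XC).
apply: (@le_trans _ _ (C4 * a `^ (1 + beta / 2))); last by rewrite ler_wpM2r ?powR_ge0// lerDr (le_trans ler01).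
have cC : 0 <= c + C1 by rewrite addr_ge0 ?(ltW c0)// (le_trans ler01).
rewrite /C4 -mulrA -powRM ?(ltW a0)// ler_wpM2l ?(le_trans ler01)//.
apply: ge0_ler_powR => //; first by rewrite addr_ge0// ltW.
- by rewrite nnegrE (le_trans ler01).
- by rewrite nnegrE mulr_ge0// ltW.
Qed.

(** * The rate *)

(** As (1 + beta) times the rate is 1/lambda - beta, a nonnegative rate gives N^rate <= C^(2 rate)
    a^(1/lambda - beta). With a^(-1/lambda) from 1/M and a^(beta/4) from the root, the remaining
    exponent beta/4 - beta is negative. *)
Lemma rate_bound {R : realType} (C beta lambda a M W l N : R) :
  1 <= C -> 0 < beta < 1 -> 0 < lambda < 2 -> 1 <= a -> 0 < M -> 0 < W ->
  a <= M `^ lambda * W -> 0 <= l -> 1 + l <= C * a `^ (beta / 2) -> 1 <= N ->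
  N <= C ^+ 2 * a `^ (1 + beta) ->
  Num.sqrt (1 + l) / M <= (Num.sqrt C * (1 + (C ^+ 2) `^ rate lambda beta)) / N `^ rate lambda beta * W `^ lambda^-1.
Proof.
move=> C1 /andP[b0 b1] /andP[l0 l2] a1 M0 W0 aMW l0' lC N1 NC.
have a0 : 0 < a := lt_le_trans ltr01 a1.
have C0 : 0 < C := lt_le_trans ltr01 C1.
have N0 : 0 < N := lt_le_trans ltr01 N1.
have a_neq0 : a != 0 by rewrite gt_eqF.
set rt := rate lambda beta.
have rtE : (1 + beta) * rt = lambda^-1 - beta.
  by rewrite /rt /rate; field; rewrite !gt_eqF// addr_gt0.
have sq : Num.sqrt (1 + l) <= Num.sqrt C * a `^ (beta / 4).
  have -> : a `^ (beta / 4) = Num.sqrt (a `^ (beta / 2)).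
    rewrite -powR12_sqrt ?powR_ge0// -powRrM; congr (_ `^ _); by field.
  by rewrite -sqrtrM ?(ltW C0)// ler_wsqrtr.
have Minv : M^-1 <= W `^ lambda^-1 * a `^ (- lambda^-1).
  have h : a `^ lambda^-1 <= M * W `^ lambda^-1.
    have -> : M * W `^ lambda^-1 = (M `^ lambda * W) `^ lambda^-1.
      by rewrite powRM ?powR_ge0 ?(ltW W0)// -powRrM mulfV ?gt_eqF// powRr1 ?(ltW M0).
    by apply: ge0_ler_powR => //; rewrite ?nnegrE ?invr_ge0 ?mulr_ge0 ?powR_ge0 ?(ltW l0) ?(ltW a0) ?(ltW W0).
  rewrite powRN ler_pdivlMr ?powR_gt0// mulrC -ler_pdivlMr ?invr_gt0// invrK.
  by rewrite mulrC.
have key : a `^ (beta / 4 - lambda^-1) * N `^ rt <= 1 + (C ^+ 2) `^ rt.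
  have [rt0|rt0] := lerP 0 rt.
    apply: (@le_trans _ _ ((C ^+ 2) `^ rt)); last by rewrite lerDr.
    apply: (@le_trans _ _ (a `^ (beta / 4 - lambda^-1) * ((C ^+ 2) `^ rt * a `^ (lambda^-1 - beta)))).
      rewrite ler_wpM2l ?powR_ge0//.
      rewrite -rtE powRrM -powRM ?powR_ge0 ?exprn_ge0 ?(ltW C0)//.
      by apply: ge0_ler_powR => //; rewrite nnegrE ?(ltW N0)// mulr_ge0 ?powR_ge0 ?exprn_ge0 ?(ltW C0).
    rewrite mulrCA -powRD ?a_neq0 ?implybT// ler_piMr ?powR_ge0//.
    by rewrite -[leRHS](powRr0 a) ler_powR//; lra.
  (* Negative rate, that is lambda * beta > 1: N^rate <= 1 since N >= 1, and beta/4 < 1/2 <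
     1/lambda. *)
  apply: (@le_trans _ _ 1); last by rewrite lerDl powR_ge0.
  rewrite -[leRHS]mulr1 ler_pM ?powR_ge0//.
    rewrite -[leRHS](powRr0 a) ler_powR//.
    have : 2^-1 < lambda^-1 by rewrite ltf_pV2// posrE.
    by lra.
  by rewrite -[leRHS](powRr0 N) ler_powR// ltW.
have Nr0 : 0 < N `^ rt by rewrite powR_gt0.
apply: (@le_trans _ _ ((Num.sqrt C * a `^ (beta / 4)) * (W `^ lambda^-1 * a `^ (- lambda^-1)))).
  by rewrite ler_pM ?sqrtr_ge0 ?invr_ge0 ?(ltW M0).
have -> : Num.sqrt C * a `^ (beta / 4) * (W `^ lambda^-1 * a `^ (- lambda^-1)) =
   Num.sqrt C * a `^ (beta / 4 - lambda^-1) * W `^ lambda^-1.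
  by rewrite powRD ?a_neq0 ?implybT//; ring.
rewrite ler_wpM2r ?powR_ge0// -mulrA ler_wpM2l ?sqrtr_ge0// ler_pdivlMr//.
Qed.

Lemma rate_cvg {R : realType} (alpha : R) : 2^-1 < alpha ->
  (fun p : R * R => rate p.1 p.2) @ filter_prod (alpha^-1)^'+ (0 : R)^'+ --> alpha.
Proof.
move=> a2; have a0 : 0 < alpha by rewrite (lt_trans _ a2)// invr_gt0.
have F : Filter (filter_prod (alpha^-1)^'+ (0 : R)^'+) by exact: filter_prod_filter.
have c1 : (fun p : R * R => p.1) @ filter_prod (alpha^-1)^'+ (0 : R)^'+ --> alpha^-1.
  apply: cvg_trans (cvg_fst) _; exact: cvg_within.
have c2 : (fun p : R * R => p.2) @ filter_prod (alpha^-1)^'+ (0 : R)^'+ --> (0 : R).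
  apply: cvg_trans (cvg_snd) _; exact: cvg_within.
rewrite /rate [X in _ --> X](_ : _ = (1 - alpha^-1 * 0) / (alpha^-1 * (1 + 0))); last first.
  by rewrite mulr0 subr0 addr0 mulr1 invrK mul1r.
apply: cvgM.
  by apply: cvgB; [exact: cvg_cst|exact: cvgM].
apply: cvgV; first by rewrite addr0 mulr1 invr_neq0// gt_eqF.
by apply: cvgM => //; apply: cvgD => //; exact: cvg_cst.
Qed.

Unset Implicit Arguments.
Set Strict Implicit.
Set Printing Implicit Defensive.

Theorem corollary4p7 (R : realType) :
  (forall c delta beta lambda : R,
     1 < c -> 0 < delta < 1 -> 0 < beta < 1 -> 0 < lambda < 2 ->
     exists2 C : R, 0 < C &
     forall (alpha : R) (d : nat) (gamma : {fset nat} -> R) (M : R),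
       2^-1 < alpha -> alpha^-1 < lambda ->
       (0 < d)%N ->
       (forall u, 0 <= gamma u) -> gamma fset0 = 1 ->
       1 <= M ->
       let A := korobov_index d alpha gamma M in
       let L := Lmax A c delta in
       (2 <= #|` A|)%N ->
       Num.max (freq_spread A)%:~R (4 * L%:R * ln L%:R) <= lc_eta A c ->
       forall (disp : measure_display) (Omega : measurableType disp)
              (P : probability Omega R) (G : nat -> Omega -> 'rV[int]_d),
         lc_draws A c delta P G ->
         ((1 - delta)%:E <=
           P [set w | exists ls : seq (lattice d),
                [/\ lc_output A c delta (fun m => G m w) ls,
                    well_defined A ls &
                    err2_rand alpha gamma A ls <=
                      (C / (total_points ls)%:R `^ rate lambda beta *
                       weight_sum d gamma alpha lambda `^ lambda^-1)%:E]])%E)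
  /\
  (forall alpha : R, 2^-1 < alpha ->
     (fun p : R * R => rate p.1 p.2) @
       filter_prod (alpha^-1)^'+ (0 : R)^'+ --> alpha).
Proof.
split; last exact: rate_cvg.
move=> c delta beta lambda c1 d01 b01 l02.
have [C C1 hC] := lattice_size_bounds c1 d01 b01.
have C0 : 0 < C := lt_le_trans ltr01 C1.
exists (Num.sqrt C * (1 + (C ^+ 2) `^ rate lambda beta)).
  by rewrite mulr_gt0 ?sqrtr_gt0// ltr_wpDr ?powR_ge0.
move=> alpha d gamma M a2 al d0 g0 g1 M1 A L A2 hmax disp Omega P G HG.
have A0 : (0 < #|` A|)%N by rewrite (leq_trans _ A2).
have M0 : 0 < M := lt_le_trans ltr01 M1.
have l0 : 0 < lambda by case/andP: l02.
have sp : (freq_spread A)%:~R <= lc_eta A c by rewrite (le_trans _ hmax)// le_max lexx.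
have [Lb pb] := hC d A A2 sp.
have al1 : 1 < alpha * lambda.
  by rewrite mulrC -ltr_pdivrMr ?div1r// (lt_trans _ a2)// invr_gt0.
have memA (k : 'rV[int]_d) : k \in A -> (korobov_r alpha gamma k <= M%:E)%E.
  by rewrite (mem_korobov_index _ A0).
have card := korobov_index_card l0 al1 M0 g0 memA.
set a : R := #|` A|%:R in Lb pb card.
have a1 : 1 <= a by rewrite ler1n.
set W := weight_sum d gamma alpha lambda in card *.
have W0 : 0 < W by rewrite -(pmulr_rgt0 _ (powR_gt0 lambda M0)) (lt_le_trans _ card)// (lt_le_trans ltr01).
have cand t : (t < Lmax A c delta)%N -> lc_candidate A c (lc_prime A c t) by move=> /pb[].
set E := [set w | _].
pose run w m := lc_run A c delta (fun i => G i w) m.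
pose Q (s : lc_state d) := [/\ ~~ lc_running A c delta s, well_defined A s.1 & (err2_rand alpha gamma A s.1 <=
   (Num.sqrt C * (1 + (C ^+ 2) `^ rate lambda beta) / (total_points s.1)%:R `^ rate lambda beta * W `^ lambda^-1)%:E)%E].
(* The unknown stopping time makes the event a countable union of events about finite runs, hence
   measurable. *)
have EQ : E = \bigcup_m [set w | Q (run w m)].
  apply/seteqP; split => w /=.
    by move=> [ls [[m [nr <-]] wd er]]; exists m.
  by move=> [m _ [nr wd er]]; exists (run w m).1; split => //; exists m.
have mQ m : measurable [set w | Q (run w m)] by exact: measurable_run HG m Q.
have mE : measurable E by rewrite EQ; exact: bigcup_measurable.
(* Once the loop has stopped with every frequency covered, the bound is deterministic. *)
have good m w : ~~ lc_running A c delta (run w m) -> (A `<=` (run w m).2)%fset -> Q (run w m).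
  move=> nr As; have [[sA sz cov] pr] := lc_inv_run A c delta (fun i => G i w) m.
  rewrite -/(run w m) in sA sz cov pr.
  have wd : well_defined A (run w m).1 by move=> k kA; exact/cov/(fsubsetP As).
  have ls0 : all (fun l => 0 < l.1)%N (run w m).1.
    by apply/allP => l /pr[t tL ->]; have /andP[/andP[/prime_gt0]] := cand t tL.
  split => //; apply: (le_trans (err2_rand_le g0 M0 A0 ls0 wd)); rewrite lee_fin.
  apply: (rate_bound C1 b01 l02 a1 M0 W0 card) => //.
  - by rewrite (le_trans _ Lb)// lerD2l ler_nat.
  - rewrite ler1n; have [k kA] : exists k, k \in A by apply/fset0Pn; rewrite -cardfs_gt0.
    have := wd k kA; case: ((run w m).1) ls0 => [|l ls] /=; first by rewrite /xi big_nil.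
    by move=> /andP[lp _] _; rewrite /total_points big_cons addn_gt0 lp.
  - apply: (@le_trans _ _ ((size (run w m).1)%:R * (C * a `^ (1 + beta / 2)))).
      rewrite /total_points natr_sum -sum1_size natr_sum mulr_suml.
      rewrite big_seq [leRHS]big_seq; apply: ler_sum => l /pr[t tL ->].
      by rewrite mul1r; have [] := pb t tL.
    have -> : C ^+ 2 * a `^ (1 + beta) = (C * a `^ (beta / 2)) * (C * a `^ (1 + beta / 2)).
      rewrite mulrACA -expr2 -powRD; first by congr (_ * _ `^ _); field.
      by rewrite (gt_eqF (lt_le_trans ltr01 a1)) implybT.
    rewrite ler_wpM2r ?mulr_ge0 ?powR_ge0 ?(ltW C0)// (le_trans _ Lb)//.
    by rewrite -[leLHS]add0r lerD// ler_nat.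
(* [E] does not refer to a fixed number of draws, so the loss [e] can be made arbitrarily small. *)
rewrite (prE P mE) lee_fin; apply/ler_addgt0Pr => e e0.
have [m hm] := lc_success c1 d01 A0 cand HG e0.
rewrite -lerBlDr (le_trans hm)//; apply: pr_le => //.
  exact: (measurable_run HG m (fun s => ~~ lc_running A c delta s /\ (A `<=` s.2)%fset)).
by move=> w [nr As]; rewrite EQ; exists m => //; exact: good.
Qed.
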